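(* Let $\mathbf{k}$ be a field and let $q\in\mathbf{k}^\times$ not be a root of unity. Let $0\le s\le r$ be integers and let $M$ be a holonomic $\mathcal{D}_{r,q}(\mathbf{k})$-module which is finite (i.e. finitely generated as a module) over the subalgebra $\mathcal{D}_{s,q}(\mathbf{k}[x_{s+1}^{\pm1},\dots,x_r^{\pm1}])\subset \mathcal{D}_{r,q}(\mathbf{k})$. Then: (i) there exists $g\in \mathrm{Sp}(2s,\mathbb{Z})$ such that $gM$ is finite over $\mathbf{k}[x_1^{\pm1},\dots,x_r^{\pm1}]$; (ii) $M$ is a free $\mathbf{k}[x_{s+1}^{\pm1},\dots,x_r^{\pm1}]$-module; (iii) for every holonomic $\mathcal{D}_{r,q}(\mathbf{k})$-module $M$ there is $g\in \mathrm{Sp}(2r,\mathbb{Z})$ such that $gM$ is finite over $\mathbf{k}[x_1^{\pm1},\dots,x_r^{\pm1}]$.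
   Context: For a commutative ring $A$ and $q\in A^\times$, $\mathcal{D}_{r,q}(A)$ is the $A$-algebra generated by $x_i^{\pm1},T_i^{\pm1}$, $1\le i\le r$, with defining relations $[x_i,x_j]=[T_i,T_j]=0$, $T_ix_j=q^{\delta_{ij}}x_jT_i$. The subalgebra $\mathcal{D}_{s,q}(\mathbf{k}[x_{s+1}^{\pm1},\dots,x_r^{\pm1}])$ of $\mathcal{D}_{r,q}(\mathbf{k})$ is generated by $x_1^{\pm1},\dots,x_r^{\pm1},T_1^{\pm1},\dots,T_s^{\pm1}$. When $q$ is not a root of unity, a finitely generated $\mathcal{D}_{r,q}(\mathbf{k})$-module is called holonomic if its Gelfand-Kirillov dimension is $\le r$ (by Bernstein's inequality, such a module is zero or has dimension exactly $r$). The group $\mathrm{Sp}(2r,\mathbb{Z})$ acts on $\mathcal{D}_{r,q}(\mathbf{k})$ by automorphisms: regarding Laurent monomials in the $x_i,T_i$ as elements of $\mathbb{Z}^{2r}$ (their exponent vectors) with the standard symplectic form, $g$ sends a monomial with exponent vector $v$ to a nonzero scalar multiple of the monomial with exponent vector $gv$ (any such choice of scalars making $g$ an algebra automorphism may be used, as different choices differ by a rescaling of the generators). For $g\in\mathrm{Sp}(2r,\mathbb{Z})$, $gM$ denotes the twist of $M$ by the automorphism $g$: the same space, with $a$ acting as $g^{-1}(a)$ acts on $M$. For $s\le r$, $\mathrm{Sp}(2s,\mathbb{Z})\subset \mathrm{Sp}(2r,\mathbb{Z})$ acts on the exponents of $x_1,\dots,x_s,T_1,\dots,T_s$ and fixes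 the remaining generators. *)

(* Defs.v *)
From HB Require Import structures.
From mathcomp Require Import all_boot all_order all_algebra generic_quotient.
From mathcomp Require Import all_classical all_reals all_analysis.
From Stdlib Require Rdefinitions.
From mathcomp Require Import Rstruct.

Set Implicit Arguments.
Unset Strict Implicit.
Unset Printing Implicit Defensive.

Import Order.TTheory GRing.Theory Num.Theory.

Local Open Scope classical_set_scope.
Local Open Scope ring_scope.
Local Open Scope quotient_scope.

Local Notation R := Rdefinitions.R.

(* MathComp's [algType] requires [1 != 0], which is not known in advance for an
algebra given by a presentation. So an [A]-algebra is here a [pzRingType]
together with a ring morphism from [A] with central image. *)

Inductive aexpr (A X : Type) : Type :=
| EConst of A
| EGen of X
| EAdd of aexpr A X & aexpr A X
| EMul of aexpr A X & aexpr A X.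
Arguments EConst {A X}.
Arguments EGen {A X}.

HB.instance Definition _ (A X : Type) := gen_eqMixin (aexpr A X).
HB.instance Definition _ (A X : Type) := gen_choiceMixin (aexpr A X).

Section Presentation.
Variables (A : comPzRingType) (X : Type).
Variable rel : aexpr A X -> aexpr A X -> Prop.
Local Notation E := (aexpr A X).

(* The least [A]-algebra congruence on expressions that contains [rel]. *)
Inductive acong : E -> E -> Prop :=
| acong_rel s t : rel s t -> acong s t
| acong_refl t : acong t t
| acong_sym s t : acong s t -> acong t s
| acong_trans s t u : acong s t -> acong t u -> acong s u
| acong_add s s' t t' : acong s s' -> acong t t' -> acong (EAdd s t) (EAdd s' t')
| acong_mul s s' t t' : acong s s' -> acong t t' -> acong (EMul s t) (EMul s' t')
| acong_addA s t u : acong (EAdd s (EAdd t u)) (EAdd (EAdd s t) u)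
| acong_addC s t : acong (EAdd s t) (EAdd t s)
| acong_add0 t : acong (EAdd (EConst 0) t) t
| acong_mulA s t u : acong (EMul s (EMul t u)) (EMul (EMul s t) u)
| acong_mul1 t : acong (EMul (EConst 1) t) t
| acong_mul0 t : acong (EMul (EConst 0) t) (EConst 0)
| acong_mulDl s t u : acong (EMul (EAdd s t) u) (EAdd (EMul s u) (EMul t u))
| acong_mulDr s t u : acong (EMul s (EAdd t u)) (EAdd (EMul s t) (EMul s u))
| acong_constD a b : acong (EConst (a + b)) (EAdd (EConst a) (EConst b))
| acong_constM a b : acong (EConst (a * b)) (EMul (EConst a) (EConst b))
| acong_constC a t : acong (EMul (EConst a) t) (EMul t (EConst a)).

Definition acongb (s t : E) : bool := `[< acong s t >].

Lemma acongb_equiv : equiv_class_of acongb.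
Proof.
split=> [t|s t|t s u].
- exact/asboolP/acong_refl.
- by apply/asboolP/asboolP => /acong_sym.
- by move=> /asboolP st /asboolP tu; apply/asboolP/(acong_trans st tu).
Qed.
Canonical acongb_eqv := EquivRelPack acongb_equiv.

Definition palg := {eq_quot acongb_eqv}.
HB.instance Definition _ := Choice.on palg.
HB.instance Definition _ := EqQuotient.on palg.

Definition pclass (t : E) : palg := \pi t.

Lemma pclassP (s t : E) : pclass s = pclass t <-> acong s t.
Proof. by split=> [/eqmodP/asboolP|st]; last apply/eqmodP/asboolP. Qed.

Lemma pclassE (u : palg) : exists t, u = pclass t.
Proof. by exists (repr u); rewrite /pclass reprK. Qed.

Lemma acong_repr t : acong (repr (pclass t)) t.
Proof. by apply/pclassP; rewrite /pclass reprK. Qed.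

Definition padd (u v : palg) := pclass (EAdd (repr u) (repr v)).
Definition pmul (u v : palg) := pclass (EMul (repr u) (repr v)).
Definition popp (u : palg) := pclass (EMul (EConst (-1)) (repr u)).

Lemma paddE s t : padd (pclass s) (pclass t) = pclass (EAdd s t).
Proof. by apply/pclassP/acong_add; apply: acong_repr. Qed.
Lemma pmulE s t : pmul (pclass s) (pclass t) = pclass (EMul s t).
Proof. by apply/pclassP/acong_mul; apply: acong_repr. Qed.
Lemma poppE s : popp (pclass s) = pclass (EMul (EConst (-1)) s).
Proof. by apply/pclassP/acong_mul; [exact: acong_refl|apply: acong_repr]. Qed.

Lemma paddA : associative padd.
Proof.
move=> u v w; have [[s ->] [t ->] [z ->]] := And3 (pclassE u) (pclassE v) (pclassE w).
by rewrite !paddE; apply/pclassP/acong_addA.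
Qed.
Lemma paddC : commutative padd.
Proof.
move=> u v; have [[s ->] [t ->]] := conj (pclassE u) (pclassE v).
by rewrite !paddE; apply/pclassP/acong_addC.
Qed.
Lemma padd0 : left_id (pclass (EConst 0)) padd.
Proof. by move=> u; have [s ->] := pclassE u; rewrite paddE; apply/pclassP/acong_add0. Qed.
Lemma paddN : left_inverse (pclass (EConst 0)) popp padd.
Proof.
move=> u; have [s ->] := pclassE u; rewrite poppE paddE.
have /pclassP := acong_mul1 s; rewrite -paddE => <-; rewrite paddE.
apply/pclassP/(acong_trans (acong_sym (acong_mulDl _ _ _))).
apply: acong_trans (acong_mul0 s); apply: acong_mul (acong_refl s).
by apply: acong_sym; rewrite -{1}(addNr 1); exact: acong_constD.
Qed.
Lemma pmulA : associative pmul.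
Proof.
move=> u v w; have [[s ->] [t ->] [z ->]] := And3 (pclassE u) (pclassE v) (pclassE w).
by rewrite !pmulE; apply/pclassP/acong_mulA.
Qed.
Lemma pmul1 : left_id (pclass (EConst 1)) pmul.
Proof. by move=> u; have [s ->] := pclassE u; rewrite pmulE; apply/pclassP/acong_mul1. Qed.
Lemma pmulr1 : right_id (pclass (EConst 1)) pmul.
Proof.
move=> u; have [s ->] := pclassE u; rewrite pmulE; apply/pclassP.
exact: acong_trans (acong_sym (acong_constC _ _)) (acong_mul1 s).
Qed.
Lemma pmulDl : left_distributive pmul padd.
Proof.
move=> u v w; have [[s ->] [t ->] [z ->]] := And3 (pclassE u) (pclassE v) (pclassE w).
by rewrite !(pmulE, paddE); apply/pclassP/acong_mulDl.
Qed.
Lemma pmulDr : right_distributive pmul padd.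
Proof.
move=> u v w; have [[s ->] [t ->] [z ->]] := And3 (pclassE u) (pclassE v) (pclassE w).
by rewrite !(pmulE, paddE); apply/pclassP/acong_mulDr.
Qed.

HB.instance Definition _ := GRing.isPzRing.Build palg
  paddA paddC padd0 paddN pmulA pmul1 pmulr1 pmulDl pmulDr.

Definition pscal (a : A) : palg := pclass (EConst a).
Definition pgen (x : X) : palg := pclass (EGen x).

Lemma pscal_zmod : zmod_morphism pscal.
Proof.
move=> a b; apply: (addIr (pscal b)); rewrite addrNK.
by rewrite /GRing.add /= paddE; apply/pclassP; rewrite -{2}(subrK b a); apply/acong_sym/acong_constD.
Qed.
Lemma pscal_monoid : monoid_morphism pscal.
Proof.
split=> // a b; rewrite /GRing.mul /= pmulE.
by apply/pclassP; exact: acong_constM.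
Qed.
HB.instance Definition _ := GRing.isZmodMorphism.Build A palg pscal pscal_zmod.
HB.instance Definition _ := GRing.isMonoidMorphism.Build A palg pscal pscal_monoid.

Lemma pscal_central (a : A) (u : palg) : pscal a * u = u * pscal a.
Proof.
have [s ->] := pclassE u; rewrite /GRing.mul /= !pmulE.
by apply/pclassP; exact: acong_constC.
Qed.

Section Universal.
Variables (B : pzRingType) (f : {rmorphism A -> B}) (g : X -> B).
Hypothesis f_central : forall a b, f a * b = b * f a.

Fixpoint aeval (t : E) : B :=
  match t with
  | EConst a => f a
  | EGen x => g x
  | EAdd s t => aeval s + aeval t
  | EMul s t => aeval s * aeval t
  end.

Lemma aeval_acong : (forall s t, rel s t -> aeval s = aeval t) ->
  forall s t, acong s t -> aeval s = aeval t.
Proof.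
move=> relP s t; elim=> //=.
- by move=> ? ? ? _ -> _ ->.
- by move=> ? ? ? ? _ -> _ ->.
- by move=> ? ? ? ? _ -> _ ->.
- by move=> *; rewrite addrA.
- by move=> *; rewrite addrC.
- by move=> *; rewrite rmorph0 add0r.
- by move=> *; rewrite mulrA.
- by move=> *; rewrite rmorph1 mul1r.
- by move=> *; rewrite rmorph0 mul0r.
- by move=> *; rewrite mulrDl.
- by move=> *; rewrite mulrDr.
- by move=> *; rewrite rmorphD.
- by move=> *; rewrite rmorphM.
Qed.

Lemma palg_universal : (forall s t, rel s t -> aeval s = aeval t) ->
  exists! h : palg -> B,
    [/\ zmod_morphism h, monoid_morphism h,
        forall a, h (pscal a) = f a & forall x, h (pgen x) = g x].
Proof.
move=> relP; pose h (u : palg) := aeval (repr u).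
have hE t : h (pclass t) = aeval t.
  exact: aeval_acong relP _ _ (acong_repr t).
have hD u v : h (u + v) = h u + h v.
  have [[s ->] [t ->]] := conj (pclassE u) (pclassE v).
  by rewrite {1}/GRing.add /= paddE !hE.
have hM u v : h (u * v) = h u * h v.
  have [[s ->] [t ->]] := conj (pclassE u) (pclassE v).
  by rewrite {1}/GRing.mul /= pmulE !hE.
exists h; split.
  split.
  - by move=> u v; apply: (addIr (h v)); rewrite -hD !addrNK.
  - by split=> [|u v]; [rewrite hE /= rmorph1 | exact: hM].
  - by move=> a; rewrite hE.
  - by move=> x; rewrite hE.
move=> h' [h'B [_ h'M] h'f h'g]; apply/funext => u.
have h'0 : h' 0 = 0 by rewrite -(subrr 0) h'B subrr.
have h'D v w : h' (v + w) = h' v + h' w.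
  have h'N : h' (- w) = - h' w by rewrite -[- w]sub0r h'B h'0 sub0r.
  by rewrite -[w in LHS]opprK h'B h'N opprK.
have [t ->] := pclassE u; rewrite hE; elim: t => //= [a|x|s IHs t IHt|s IHs t IHt].
- by rewrite -h'f.
- by rewrite -h'g.
- by rewrite IHs IHt -h'D {1}/GRing.add /= paddE.
- by rewrite IHs IHt -h'M {1}/GRing.mul /= pmulE.
Qed.
End Universal.
End Presentation.

Definition pullback (A B : pzRingType) (f : {rmorphism A -> B})
  (M : lmodType B) : Type := M.

Section Pullback.
Variables (A B : pzRingType) (f : {rmorphism A -> B}) (M : lmodType B).
HB.instance Definition _ := GRing.Zmodule.on (pullback f M).
Definition pullback_scale (a : A) (m : pullback f M) : pullback f M :=
  f a *: (m : M).
Lemma pullback_scaleA a b m :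
  pullback_scale a (pullback_scale b m) = pullback_scale (a * b) m.
Proof. by rewrite /pullback_scale rmorphM scalerA. Qed.
Lemma pullback_scale1 : left_id 1 pullback_scale.
Proof. by move=> m; rewrite /pullback_scale rmorph1; exact: scale1r. Qed.
Lemma pullback_scaleDr : right_distributive pullback_scale +%R.
Proof. by move=> a m n; rewrite /pullback_scale; exact: scalerDr. Qed.
Lemma pullback_scaleDl m : {morph pullback_scale^~ m : a b / a + b}.
Proof. by move=> a b; rewrite /pullback_scale rmorphD; exact: scalerDl. Qed.
HB.instance Definition _ := GRing.Zmodule_isLmodule.Build A (pullback f M)
  pullback_scaleA pullback_scale1 pullback_scaleDr pullback_scaleDl.
End Pullback.

Section Modules.
Variables (A : pzRingType) (M : lmodType A).

Definition lspan (e : seq M) : set M :=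
  [set m | exists c : nat -> A, m = \sum_(i < size e) c i *: e`_i].

Definition lin_independent (e : seq M) : Prop :=
  forall c : nat -> A, \sum_(i < size e) c i *: e`_i = 0 ->
  forall i, (i < size e)%N -> c i = 0.

Definition finitely_generated : Prop := exists e : seq M, lspan e = setT.

Definition is_basis (B : set M) : Prop :=
  (forall e : seq M, uniq e -> [set` e] `<=` B -> lin_independent e) /\
  (forall m, exists2 e : seq M, [set` e] `<=` B & lspan e m).

Definition free_module : Prop := exists B : set M, is_basis B.

(* [0] if [W] has no finite basis. *)
Definition ldim (W : set M) : nat :=
  xget 0%N [set d | exists e : seq M, [/\ size e = d, lin_independent e & lspan e = W]].
End Modules.

Section Subalgebra.
Variables (A D : pzRingType) (f : {rmorphism A -> D}).

Definition is_subalgebra (P : set D) : Prop :=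
  [/\ forall a, P (f a), forall u v, P u -> P v -> P (u + v)
    & forall u v, P u -> P v -> P (u * v)].

Definition gen_subalg (S : set D) : pred D :=
  fun d => `[< smallest is_subalgebra S d >].

Lemma gen_subalg_closed S : subring_closed (gen_subalg S).
Proof.
split.
- apply/asboolP => P [[Pf PD PM] _]; rewrite -(rmorph1 f); exact: Pf.
- move=> u v /asboolP Su /asboolP Sv; apply/asboolP => P PP.
  have [[Pf PD PM] _] := PP; apply: PD; first exact: Su.
  by rewrite -mulN1r -(rmorph1 f) -rmorphN; apply: PM => //; exact: Sv.
- move=> u v /asboolP Su /asboolP Sv; apply/asboolP => P PP.
  by have [[Pf PD PM] _] := PP; apply: PM; [exact: Su | exact: Sv].
Qed.
HB.instance Definition _ S :=
  GRing.isSubringClosed.Build D (gen_subalg S) (gen_subalg_closed S).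

Record subalg (S : set D) : Type :=
  Subalg { subalg_val : D; _ : subalg_val \in gen_subalg S }.
HB.instance Definition _ S := [isSub for @subalg_val S].
HB.instance Definition _ S := [Choice of subalg S by <:].
HB.instance Definition _ S :=
  GRing.SubChoice_isSubPzRing.Build D (gen_subalg S) (subalg S)
    (gen_subalg_closed S).
End Subalgebra.

(* [M] as a module over the subalgebra generated by [S]. *)
Definition over_subalg (A D : pzRingType) (f : {rmorphism A -> D}) (S : set D)
  (M : lmodType D) : lmodType (subalg f S) :=
  pullback (val : {rmorphism subalg f S -> D}) M.

(* The Gelfand-Kirillov dimension of M is the supremum, over the
   finite-dimensional subspaces V of D containing 1 and F of M, of
   limsup_n (log dim (V^n F) / log n). V is given by a sequence spanning it
   together with 1, and F by a spanning sequence. Since [ln 0 = 0], the zero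
   module gets dimension 0. *)

Section GKdim.
Variables (k : fieldType) (D : pzRingType) (f : {rmorphism k -> D}).
Variable M : lmodType D.

(* A spanning sequence of V^n F. *)
Definition gk_words (V : seq D) (F : seq M) (n : nat) : seq M :=
  iter n (fun W => [seq a *: m | a <- V, m <- W]) F.

Definition gk_growth (V : seq D) (F : seq M) (n : nat) : nat :=
  ldim (lspan (gk_words (1 :: V) F n : seq (pullback f M))).

Definition gkdim : \bar R :=
  ereal_sup (range (fun VF : seq D * seq M =>
    limn_esup (fun n : nat =>
      (ln (gk_growth VF.1 VF.2 n)%:R / ln n%:R : R)%:E))).
End GKdim.

Inductive qgen (r : nat) : Type :=
| GX of 'I_r | GXinv of 'I_r | GT of 'I_r | GTinv of 'I_r.

Section QuantumTorus.
Variables (r : nat) (A : comPzRingType) (q : A).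

Inductive qrel : aexpr A (qgen r) -> aexpr A (qgen r) -> Prop :=
| qrel_XV i : qrel (EMul (EGen (GX i)) (EGen (GXinv i))) (EConst 1)
| qrel_VX i : qrel (EMul (EGen (GXinv i)) (EGen (GX i))) (EConst 1)
| qrel_TV i : qrel (EMul (EGen (GT i)) (EGen (GTinv i))) (EConst 1)
| qrel_VT i : qrel (EMul (EGen (GTinv i)) (EGen (GT i))) (EConst 1)
| qrel_XX i j : qrel (EMul (EGen (GX i)) (EGen (GX j)))
                     (EMul (EGen (GX j)) (EGen (GX i)))
| qrel_TT i j : qrel (EMul (EGen (GT i)) (EGen (GT j)))
                     (EMul (EGen (GT j)) (EGen (GT i)))
| qrel_TX i j : qrel (EMul (EGen (GT i)) (EGen (GX j)))
                     (EMul (EConst (q ^+ (i == j)))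
                           (EMul (EGen (GX j)) (EGen (GT i)))).

Definition qtorus : pzRingType := palg qrel.
Definition qscal : {rmorphism A -> qtorus} := @pscal A (qgen r) qrel.

Definition qx (i : 'I_r) : qtorus := pgen qrel (GX i).
Definition qxV (i : 'I_r) : qtorus := pgen qrel (GXinv i).
Definition qT (i : 'I_r) : qtorus := pgen qrel (GT i).
Definition qTV (i : 'I_r) : qtorus := pgen qrel (GTinv i).

(* Integer powers of [u], where [uV] is the inverse of [u]. *)
Definition zpow (u uV : qtorus) (n : int) : qtorus :=
  match n with Posz m => u ^+ m | Negz m => uV ^+ m.+1 end.

(* The first [r] entries of an exponent vector are the exponents of the x_i,
   the last [r] those of the T_i. *)
Definition qmono (v : 'cV[int]_(r + r)) : qtorus :=
  (\prod_(i < r) zpow (qx i) (qxV i) (v (lshift r i) 0)) *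
  (\prod_(i < r) zpow (qT i) (qTV i) (v (rshift r i) 0)).

(* Generators of the subalgebra D_{s,q}(A[x_(s+1)^±1, ..., x_r^±1]). *)
Definition sub_gens (s : nat) : set qtorus :=
  [set d | (exists i, d = qx i \/ d = qxV i) \/
           (exists2 i : 'I_r, (i < s)%N & d = qT i \/ d = qTV i)].

(* Generators of the subalgebra A[x_(s+1)^±1, ..., x_r^±1]. *)
Definition laurent_gens (s : nat) : set qtorus :=
  [set d | exists2 i : 'I_r, (s <= i)%N & d = qx i \/ d = qxV i].

(* [phi] is an algebra automorphism, with inverse [psi], through which the
   matrix [g] acts on [qtorus]. *)
Definition lifts (g : 'M[int]_(r + r)) (phi psi : {rmorphism qtorus -> qtorus}) :
  Prop :=
  [/\ cancel phi psi, cancel psi phi, forall a, phi (qscal a) = qscal a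
    & forall v, exists2 c : A, c != 0 & phi (qmono v) = qscal c * qmono (g *m v)].
End QuantumTorus.
Arguments qmono {r A q}.
Arguments sub_gens r {A} q s.
Arguments laurent_gens r {A} q s.
Arguments lifts {r A} q.

Definition symplectic_form (n : nat) : 'M[int]_(n + n) :=
  block_mx 0 1%:M (- 1%:M) 0.

Definition symplectic (n : nat) (g : 'M[int]_(n + n)) : Prop :=
  g^T *m symplectic_form n *m g = symplectic_form n.

Definition sub_index (s r : nat) (i : 'I_(r + r)) : option 'I_(s + s) :=
  match fintype.split i with
  | inl a => omap (@lshift s s) (insub (a : nat))
  | inr a => omap (@rshift s s) (insub (a : nat))
  end.

(* For [s <= r], the inclusion of Sp(2s,Z) in Sp(2r,Z). *)
Definition sp_incl (s r : nat) (h : 'M[int]_(s + s)) : 'M[int]_(r + r) :=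
  \matrix_(i, j) match sub_index s i, sub_index s j with
                 | Some i', Some j' => h i' j'
                 | _, _ => (i == j)%:R
                 end.

Section Holonomic.
Variables (r : nat) (k : fieldType) (q : k).
Implicit Type M : lmodType (qtorus r q).

Definition holonomic M : Prop :=
  finitely_generated M /\ (gkdim (qscal r q) M <= (r%:R : R)%:E)%E.

Definition finite_over (S : set (qtorus r q)) M : Prop :=
  finitely_generated (over_subalg (qscal r q) S M).

Definition free_over (S : set (qtorus r q)) M : Prop :=
  free_module (over_subalg (qscal r q) S M).

(* [g M] is finite over k[x_1^±1, ..., x_r^±1], for every choice of scalars in
   the action of [g]. *)
Definition twist_finite_laurent (g : 'M[int]_(r + r)) M : Prop :=
  (exists phi psi, lifts q g phi psi) /\
  forall phi psi, lifts q g phi psi ->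
    finite_over (laurent_gens r q 0) (pullback psi M).
End Holonomic.

(* Main.v *)
Require Import Defs.
From HB Require Import structures.
From mathcomp Require Import all_boot all_order all_algebra.
From mathcomp Require Import perm all_classical all_reals all_analysis.
From Stdlib Require Rdefinitions.
From mathcomp Require Import Rstruct.
From mathcomp Require Import ring lra zify.

(* For a symmetric integer matrix S and t <= r let A(S, t) be the span of the monomials
x^a T^b with (b + S a)_i = 0 for all i > t; the symplectic shear (a, b) -> (a, b + S a)
carries it to D_t(k[x_1^±1, ..., x_r^±1]). The hypothesis says that M is finite over A(0, s).

Suppose that M is finite over A(S, t) with t > 0. Since the dimension of M is at most r, a
generator g satisfies a relation sum_i l_i x^(a_i) T^(b_i) g = 0 with coefficients l_i in
the Laurent ring of the sheared x_j, j > t. Adding large powers of an integer K to row and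
column t of S gives a matrix S' for which the numbers (b_i + S' a_i)_t are distinct, so the
extreme terms of the relation allow one to reduce powers of T_t in both directions after
inverting some F != 0 in that Laurent ring. Because q is not a root of unity, the q-shifts of
F generate the unit ideal, and T-translates of the generators make M finite over A(S', t-1).
At t = 0 a shear of M is finite over k[x_1^±1, ..., x_r^±1], which gives (i), and (iii) is
the case s = r.

For (ii), M is now finitely generated over the commutative ring A(S, 0), where S is supported
on indices at most s. The same comaximality of shifts turns a generic basis into a dual
basis, so M is projective, hence free by Swan's theorem on Laurent polynomial rings. The
products of a basis with the monomials in x_1, ..., x_s (sheared) form a basis over
k[x_(s+1)^±1, ..., x_r^±1]. *)

Set Implicit Arguments.
Unset Strict Implicit.
Unset Printing Implicit Defensive.

Import Order.TTheory GRing.Theory Num.Theory.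
Local Open Scope ring_scope.

(** * Laurent polynomials *)

(** The relation exists because the r + 1 elements x_1, ..., x_r (sheared) and T_t have K^(r+1)
    products of length at most (r + 1) K, too many for dimension r. The sheared x_j with j > t
    commute with every monomial of A(S, t). They can therefore serve as coefficients, and F is
    handled like a central denominator: no localization of a noncommutative ring is formed, and one
    only asks that F^n m lie in a given span. What fails to commute with F are the T_j with j > t,
    and these are what later removes F. Each step changes only entries of S with both indices at
    most t, so the shears stay in Sp(2s, Z).

    Swan's theorem is reached without induction on the number of variables. An automorphism makes
    the denominator f of a generic splitting monic with unit constant term. Division by f then shows
    that the projective module P contains a free module N such that P / N is projective and finitely
    generated over the smaller Laurent ring. The characteristic sequence of multiplication by X on P
    / N makes P stably free, and Suslin's theorem on unimodular columns makes it free. *)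

Section Laurent.
Variable A : idomainType.
Local Notation F := {fraction {poly A}}.
Local Notation "x %:F" := (@FracField.tofrac _ x).

(** Laurent polynomials are realized inside the fraction field of [{poly A}], so that integrality is
    inherited and the construction can be iterated. *)
Definition laurent_pred : pred F :=
  fun z => `[< exists n (p : {poly A}), z * ('X^n)%:F = p%:F >].

Lemma laurent_pred_subring : subring_closed laurent_pred.
Proof.
split.
- by apply/asboolP; exists 0%N, 1; rewrite expr0 mulr1 tofrac1.
- move=> u v /asboolP[n [p up]] /asboolP[m [p' vp]]; apply/asboolP.
  exists (n + m)%N, (p * 'X^m - p' * 'X^n).
  rewrite tofracB !tofracM -up -vp exprD tofracM mulrBl !mulrA.
  by congr (_ - _); rewrite -!mulrA; congr (_ * _); rewrite mulrC.
- move=> u v /asboolP[n [p up]] /asboolP[m [p' vp]]; apply/asboolP.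
  exists (n + m)%N, (p * p').
  by rewrite tofracM -up -vp exprD tofracM mulrACA.
Qed.
HB.instance Definition _ :=
  GRing.isSubringClosed.Build F laurent_pred laurent_pred_subring.

Record laurent : Type := MkLaurent { laurent_val : F; _ : laurent_val \in laurent_pred }.
HB.instance Definition _ := [isSub for laurent_val].
HB.instance Definition _ := [Choice of laurent by <:].
HB.instance Definition _ := [SubChoice_isSubComNzRing of laurent by <:].

(** The subring is not closed under inverses of the fraction field: units are defined by the
    existence of an inverse, which is then chosen classically. *)
Definition laurent_unit : pred laurent := fun x => `[< exists y, y * x = 1 >].
Definition laurent_inv (x : laurent) : laurent :=
  if pselect (exists y, y * x = 1) is left xu then sval (cid xu) else x.

Fact laurent_mulVx : {in laurent_unit, left_inverse 1 laurent_inv *%R}.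
Proof.
move=> x /asboolP xu; rewrite /laurent_inv; case: pselect => [e|//].
exact: svalP (cid e).
Qed.
Fact laurent_unitPl (x y : laurent) : y * x = 1 -> laurent_unit x.
Proof. by move=> yx; apply/asboolP; exists y. Qed.
Fact laurent_invr_out : {in [predC laurent_unit], laurent_inv =1 id}.
Proof.
by move=> x; rewrite inE /= => /asboolPn xu; rewrite /laurent_inv; case: pselect.
Qed.
HB.instance Definition _ := GRing.ComNzRing_hasMulInverse.Build laurent
  laurent_mulVx laurent_unitPl laurent_invr_out.
Fact laurent_idomain (x y : laurent) : x * y = 0 -> (x == 0) || (y == 0).
Proof.
move=> /(congr1 val) /eqP; rewrite rmorphM rmorph0 mulf_eq0.
by rewrite -!(inj_eq val_inj) rmorph0.
Qed.
HB.instance Definition _ := GRing.ComUnitRing_isIntegral.Build laurent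
  laurent_idomain.

Fact laurent_poly_subproof (p : {poly A}) : p%:F \in laurent_pred.
Proof. by apply/asboolP; exists 0%N, p; rewrite expr0 tofrac1 mulr1. Qed.
Definition laurent_poly (p : {poly A}) : laurent := MkLaurent (laurent_poly_subproof p).

Fact laurent_poly_zmod : zmod_morphism laurent_poly.
Proof. by move=> p q; apply: val_inj; rewrite /= tofracB. Qed.
Fact laurent_poly_monoid : monoid_morphism laurent_poly.
Proof. by split=> [|p q]; apply: val_inj; rewrite /= ?tofrac1 ?tofracM. Qed.
HB.instance Definition _ :=
  GRing.isZmodMorphism.Build {poly A} laurent laurent_poly laurent_poly_zmod.
HB.instance Definition _ :=
  GRing.isMonoidMorphism.Build {poly A} laurent laurent_poly laurent_poly_monoid.

Lemma laurent_poly_inj : injective laurent_poly.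
Proof.
by move=> p q [] /eqP; rewrite tofrac_eq => /eqP.
Qed.

Definition laurentX : laurent := laurent_poly 'X.
Definition laurentC : A -> laurent := laurent_poly \o polyC.
HB.instance Definition _ := GRing.RMorphism.on laurentC.

Lemma laurentX_unit : laurentX \is a GRing.unit.
Proof.
have Xi : ('X%:F)^-1 \in laurent_pred.
  by apply/asboolP; exists 1%N, 1; rewrite expr1 tofrac1 mulVf // tofrac_eq0 polyX_eq0.
apply/asboolP; exists (MkLaurent Xi); apply: val_inj => /=.
by rewrite mulVf // tofrac_eq0 polyX_eq0.
Qed.

Lemma laurentP (l : laurent) : exists n p, l * laurentX ^+ n = laurent_poly p.
Proof.
have /asboolP[n [p e]] := valP l; exists n, p; apply: val_inj.
by rewrite rmorphM rmorphXn -[RHS]e /= tofracXn.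
Qed.

Section Eval.
Variables (B : pzRingType) (f : {rmorphism A -> B}) (y y' : B).
Hypotheses (yy' : y * y' = 1) (y'y : y' * y = 1).
Hypothesis fy : forall a, GRing.comm y (f a).

Let pev (p : {poly A}) : B := \sum_(i < size p) f p`_i * y ^+ i.

Let pevE n (p : {poly A}) : (size p <= n)%N ->
  pev p = \sum_(i < n) f p`_i * y ^+ i.
Proof.
move=> le_pn; rewrite /pev (big_ord_widen n (fun i => f p`_i * y ^+ i)) //.
rewrite [LHS]big_mkcond; apply: eq_bigr => i _; case: ltnP => // lei.
by rewrite nth_default // rmorph0 mul0r.
Qed.

Let pevB p q : pev (p - q) = pev p - pev q.
Proof.
pose n := maxn (size p) (size q).
rewrite !(@pevE n) ?leq_maxl ?leq_maxr //; last first.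
  by rewrite (leq_trans (size_polyD _ _)) // size_polyN.
by rewrite -sumrB; apply: eq_bigr => i _; rewrite coefB rmorphB mulrBl.
Qed.

Let pev0 : pev 0 = 0. Proof. by rewrite -(subrr 0) pevB subrr. Qed.
Let pevN p : pev (- p) = - pev p. Proof. by rewrite -sub0r pevB pev0 sub0r. Qed.
Let pevD p q : pev (p + q) = pev p + pev q.
Proof. by rewrite -[q in LHS]opprK pevB pevN opprK. Qed.

Let pevC a : pev a%:P = f a.
Proof.
by rewrite (@pevE 1) ?size_polyC ?leq_b1 // big_ord1 coefC mulr1.
Qed.

Let pevMX p : pev (p * 'X) = pev p * y.
Proof.
rewrite (@pevE (size p).+1) ?(leq_trans (size_polyMleq _ _)) ?size_polyX ?addn2 //.
rewrite big_ord_recl coefMX rmorph0 mul0r add0r mulr_suml.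
by apply: eq_bigr => i _; rewrite coefMX /= exprSr mulrA.
Qed.

Let pevMC p a : pev (p * a%:P) = pev p * f a.
Proof.
rewrite (@pevE (size p)); last first.
  by rewrite mulrC mul_polyC size_scale_leq.
rewrite mulr_suml; apply: eq_bigr => i _.
rewrite coefMC rmorphM -!mulrA; congr (_ * _).
by apply: commrX; apply: commr_sym; apply: fy.
Qed.

Let pevM p q : pev (p * q) = pev p * pev q.
Proof.
elim/poly_ind: q p => [|q a IH] p; first by rewrite mulr0 pev0 mulr0.
by rewrite mulrDr !pevD mulrA !pevMX pevMC IH pevC mulrDr mulrA.
Qed.

Let pevX : pev 'X = y.
Proof. by rewrite -['X]mul1r pevMX -polyC1 pevC rmorph1 mul1r. Qed.

Let pevXn n : pev 'X^n = y ^+ n.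
Proof.
elim: n => [|n IH]; first by rewrite expr0 -polyC1 pevC rmorph1.
by rewrite exprS pevM IH pevX -exprS.
Qed.

Let yC : GRing.comm y y'. Proof. by rewrite /GRing.comm yy' y'y. Qed.
Let yXK n : y ^+ n * y' ^+ n = 1.
Proof. by rewrite -(exprMn_comm _ yC) yy' expr1n. Qed.

Let y'C p : GRing.comm y' (pev p).
Proof.
rewrite /GRing.comm.
suff: GRing.comm y (pev p).
  move=> c; rewrite -[in RHS](mul1r (_ * y')) -y'y -!mulrA; congr (_ * _).
  by rewrite !mulrA c -mulrA yy' mulr1.
have e : y * pev p = pev ('X * p) by rewrite pevM pevX.
by rewrite /GRing.comm e -commr_polyX pevMX.
Qed.

(** The target [B] may be noncommutative, since it will be a quantum torus; hence the commutation
    hypothesis [fy]. The last clause, on elements commuting with the generators, is what lets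
    [lring_ev] adjoin the next variable. *)
Lemma laurent_universal : exists G : {rmorphism laurent -> B},
  [/\ forall a, G (laurentC a) = f a, G laurentX = y &
    forall b, (forall a, GRing.comm b (f a)) -> GRing.comm b y ->
      forall l, GRing.comm b (G l)].
Proof.
have ex l : exists z : B, exists n p,
    l * laurentX ^+ n = laurent_poly p /\ z = pev p * y' ^+ n.
  by have [n [p e]] := laurentP l; exists (pev p * y' ^+ n), n, p.
pose g l : B := sval (cid (ex l)).
have gE l n p : l * laurentX ^+ n = laurent_poly p -> g l = pev p * y' ^+ n.
  move=> lp; rewrite /g; case: cid => z /= [m [q [lq ->]]].
  have e : p * 'X^m = q * 'X^n.
    apply: laurent_poly_inj; rewrite !rmorphM !rmorphXn /= -lp -lq.
    by rewrite -!mulrA; congr (_ * _); rewrite mulrC.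
  have {}e := congr1 pev e; rewrite !pevM !pevXn in e.
  have c i j : GRing.comm (y' ^+ i) (y ^+ j).
    by apply: commrX; apply: commr_sym; apply: commrX.
  have -> : pev q = pev p * y ^+ m * y' ^+ n.
    by rewrite e -mulrA yXK mulr1.
  rewrite -mulrA -exprD addnC exprD -!mulrA; congr (_ * _).
  by rewrite mulrA yXK mul1r.
have gp p : g (laurent_poly p) = pev p.
  by rewrite (gE _ 0%N p) ?expr0 ?mulr1.
have gB : zmod_morphism g.
  move=> u v; have [n [p up]] := laurentP u; have [m [p' vp]] := laurentP v.
  rewrite (gE u n p) // (gE v m p') // (gE (u - v) (n + m)%N (p * 'X^m - p' * 'X^n)); last first.
    rewrite rmorphB !rmorphM !rmorphXn /= -up -vp exprD mulrBl !mulrA.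
    by congr (_ - _); rewrite -!mulrA; congr (_ * _); rewrite mulrC.
  rewrite pevB !pevM !pevXn mulrBl exprD -!mulrA.
  congr (_ * _ - _ * _); last by rewrite mulrA yXK mul1r.
  by rewrite -exprD addnC exprD mulrA yXK mul1r.
have gM : monoid_morphism g.
  split; first by rewrite (gE _ 0%N 1%:P) ?expr0 ?mulr1 ?rmorph1 // pevC rmorph1.
  move=> u v; have [n [p up]] := laurentP u; have [m [p' vp]] := laurentP v.
  rewrite (gE u n p) // (gE v m p') // (gE (u * v) (n + m)%N (p * p')); last first.
    by rewrite [RHS]rmorphM /= -up -vp exprD mulrACA.
  rewrite pevM exprD -!mulrA; congr (_ * _); rewrite [RHS]mulrA.
  by rewrite (commr_sym (commrX n (commr_sym (y'C p')))) mulrA.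
pose mZ := GRing.isZmodMorphism.Build laurent B g gB.
pose mM := GRing.isMonoidMorphism.Build laurent B g gM.
pose G : {rmorphism laurent -> B} := HB.pack g mZ mM.
exists G; split=> [a||b bf by_ l] /=.
- by rewrite [LHS]gp pevC.
- by rewrite [LHS]gp pevX.
- have [n [p lp]] := laurentP l; rewrite (gE _ n p) //.
  apply: commrM; first by rewrite /pev; apply: commr_sum => i _; apply: commrM (bf _) (commrX _ by_).
  apply: commrX; rewrite /GRing.comm -[in LHS](mul1r (b * _)) -y'y -!mulrA.
  by congr (_ * _); rewrite mulrA -by_ -mulrA yy' mulr1.
Qed.
End Eval.

Lemma laurent_rmorph_eq (B : pzRingType) (g h : {rmorphism laurent -> B}) :
  (forall a, g (laurentC a) = h (laurentC a)) -> g laurentX = h laurentX -> g =1 h.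
Proof.
move=> ghC ghX l; have [n [p lp]] := laurentP l.
have ghp q : g (laurent_poly q) = h (laurent_poly q).
  elim/poly_ind: q => [|q a IH]; first by rewrite !rmorph0.
  by rewrite !rmorphD !rmorphM /= IH [X in _ * g X]/= [X in _ + g X]/= -/(laurentC a) -/laurentX ghC ghX.
have /(congr1 g) := lp; rewrite ghp -lp !rmorphM !rmorphXn /= ghX.
move/(congr1 (fun z => z * h (laurentX^-1) ^+ n)).
have hX : h laurentX ^+ n * h laurentX^-1 ^+ n = 1.
  transitivity (h ((laurentX * laurentX^-1) ^+ n)).
    by rewrite exprMn [RHS]rmorphM !rmorphXn.
  by rewrite divrr ?laurentX_unit // expr1n rmorph1.
by rewrite -!mulrA hX !mulr1.
Qed.
End Laurent.

(** * Iterated Laurent polynomial rings and their monomials *)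

Section LaurentRing.
Variable k : fieldType.

Fixpoint lring (n : nat) : idomainType :=
  if n is m.+1 then laurent (lring m) else k.

Fixpoint lcst n : {rmorphism k -> lring n} :=
  match n with
  | 0 => idfun
  | m.+1 => (@laurentC (lring m) \o lcst m)
  end.

(** An index [i >= n] gets the default value 1, so that [lvar n i] is always a unit. *)
Fixpoint lvar n (i : nat) : lring n :=
  match n with
  | 0 => 1
  | m.+1 => if i == m then laurentX (lring m) else laurentC (lvar m i)
  end.

Definition lmon n (u : 'cV[int]_n) : lring n := \prod_(i < n) lvar n i ^ u i 0.

Lemma lvar_unit n i : lvar n i \is a GRing.unit.
Proof.
elim: n => [|n IH] /=; first exact: unitr1.
by case: eqP => _; [exact: laurentX_unit | rewrite (rmorph_unit (@laurentC _))].
Qed.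

Lemma lmon_unit n (u : 'cV_n) : lmon u \is a GRing.unit.
Proof. by apply: rpred_prod => i _; rewrite unitrXz // lvar_unit. Qed.

Lemma lmonD n (u v : 'cV_n) : lmon (u + v) = lmon u * lmon v.
Proof.
rewrite -big_split; apply: eq_bigr => i _.
by rewrite mxE exprzDr // lvar_unit.
Qed.

Lemma lmon0 n : lmon (0 : 'cV_n) = 1.
Proof. by apply: big1 => i _; rewrite mxE expr0z. Qed.

Lemma lmonN n (u : 'cV_n) : lmon (- u) * lmon u = 1.
Proof. by rewrite -lmonD addNr lmon0. Qed.

Lemma lmon_delta n (i : 'I_n) : lmon (delta_mx i 0) = lvar n i.
Proof.
rewrite /lmon (bigD1 i) //= mxE !eqxx expr1z big1 ?mulr1 // => j /negPf ji.
by rewrite mxE ji expr0z.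
Qed.

Lemma lring_ev (B : pzRingType) (f : {rmorphism k -> B}) (y y' : nat -> B) n :
    (forall c i, GRing.comm (y i) (f c)) ->
    (forall i j, (i < n)%N -> (j < n)%N -> GRing.comm (y i) (y j)) ->
    (forall i, (i < n)%N -> y i * y' i = 1 /\ y' i * y i = 1) ->
  exists G : {rmorphism lring n -> B},
    [/\ forall c, G (lcst n c) = f c,
        forall i, (i < n)%N -> G (lvar n i) = y i &
        forall b, (forall c, GRing.comm b (f c)) ->
          (forall i, (i < n)%N -> GRing.comm b (y i)) ->
          forall l, GRing.comm b (G l)].
Proof.
move=> yf; elim: n => [|n IH] yC yV; first by exists f.
have [||G [Gc Gx GC]] := IH.
- by move=> i j lti ltj; apply: yC; rewrite ltnS ltnW.
- by move=> i lti; apply: yV; rewrite ltnS ltnW.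
have [//|yy' y'y] := yV n.
have yG a : GRing.comm (y n) (G a).
  apply: GC => [c|i lti]; first exact: yf.
  by apply: yC => //; rewrite ltnS ltnW.
have [H [HC HX HH]] := laurent_universal yy' y'y yG.
exists H; split=> [c|i|b bf by_ l] /=.
- by rewrite HC.
- rewrite ltnS leq_eqVlt; case: eqP => [-> _|_ /= lti]; first exact: HX.
  by rewrite HC Gx.
- apply: HH; last exact: by_.
  by move=> a; apply: GC => // i lti; apply: by_; rewrite ltnS ltnW.
Qed.

Lemma lring_rmorph_eq (B : pzRingType) n (g h : {rmorphism lring n -> B}) :
  (forall c, g (lcst n c) = h (lcst n c)) ->
  (forall i, (i < n)%N -> g (lvar n i) = h (lvar n i)) -> g =1 h.
Proof.
elim: n g h => [|n IH] g h ghC ghx; first exact: ghC.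
apply: laurent_rmorph_eq => [a|]; last first.
  by have := ghx n (ltnSn n); rewrite /= eqxx.
apply: (IH (g \o @laurentC _) (h \o @laurentC _)) a => [c|i lti] /=.
  exact: ghC.
by have := ghx i; rewrite /= ltnS (ltnW lti) (ltn_eqF lti); apply.
Qed.

Definition lsum n (s : seq (k * 'cV[int]_n)) : lring n :=
  \sum_(x <- s) lcst n x.1 * lmon x.2.

Lemma lmonS n (u : 'cV[int]_n) (z : int) :
  laurentC (lmon u) * laurentX (lring n) ^ z =
  lmon (\col_(i < n.+1) if insub (i : nat) is Some j then u j 0 else z).
Proof.
rewrite /lmon [in RHS]big_ord_recr /= eqxx; congr (_ * _ ^ _).
  rewrite rmorph_prod; apply: eq_bigr => i _; rewrite (ltn_eqF (ltn_ord i)).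
  rewrite rmorphXz ?lvar_unit //; congr (_ ^ _).
  by rewrite mxE insubT //= => lti; congr (u _ _); apply: val_inj.
by rewrite mxE insubF //= ltnn.
Qed.

Lemma lring_span n (l : lring n) : exists s, l = lsum s.
Proof.
elim: n l => [|n IH] l.
  exists [:: (l, 0)].
  by rewrite /lsum big_seq1 lmon0 mulr1.
have [N [p lp]] := laurentP l.
have {lp} -> : l = \sum_(i < size p) laurentC p`_i * laurentX (lring n) ^ (i%:Z - N%:Z).
  have XN : laurentX (lring n) ^+ N \is a GRing.unit by rewrite unitrX ?laurentX_unit.
  apply: (mulIr XN); rewrite lp mulr_suml -{1}[p]coefK poly_def rmorph_sum.
  apply: eq_bigr => i _; rewrite -mul_polyC rmorphM rmorphXn /= -mulrA; congr (_ * _).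
  by rewrite -(exprzDr _ _ (N%:Z)) ?laurentX_unit // subrK.
elim/big_ind: _ => [|_ _ [s ->] [t ->]|i _].
- by exists [::]; rewrite /lsum big_nil.
- by exists (s ++ t); rewrite /lsum big_cat.
have [s ->] := IH p`_i; rewrite /lsum rmorph_sum mulr_suml.
elim/big_ind: _ => [|_ _ [t1 ->] [t2 ->]|[c u] _].
- by exists [::]; rewrite /lsum big_nil.
- by exists (t1 ++ t2); rewrite /lsum big_cat.
set z := _ - _.
exists [:: (c, \col_j if insub (j : nat) is Some m then u m 0 else z)].
by rewrite /lsum big_seq1 rmorphM -mulrA lmonS.
Qed.

Lemma lring_uniq_span n (l : lring n) : exists (s : seq 'cV[int]_n) (c : 'cV[int]_n -> k),
  uniq s /\ l = \sum_(u <- s) lcst n (c u) * lmon u.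
Proof.
have [t ->] := lring_span l.
exists (undup (map snd t)), (fun u => \sum_(x <- t | x.2 == u) x.1); split.
  exact: undup_uniq.
under eq_bigr => u _ do rewrite rmorph_sum mulr_suml big_mkcond /=.
rewrite exchange_big /=; apply: eq_big_seq => x xt.
rewrite (bigD1_seq x.2) ?undup_uniq ?mem_undup ?map_f //= eqxx big1 ?addr0 //.
by move=> u /negPf xu; rewrite eq_sym xu.
Qed.
End LaurentRing.

(** * The q-shifts of Laurent polynomials *)

Section Shift.
Variables (k : fieldType) (q : k).
Hypotheses (q_neq0 : q != 0) (q_not_root : forall n : nat, (0 < n)%N -> q ^+ n != 1).

Lemma expqz_inj : injective (fun z : int => q ^ z).
Proof.
have H (z : int) : q ^ z = 1 -> z = 0.
  case: z => [[|n]|n] //; first by move/eqP; rewrite (negPf (q_not_root (ltn0Sn n))).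
  by move/eqP; rewrite NegzE -invr_expz invr_eq1 (negPf (q_not_root (ltn0Sn n))).
move=> a b /= ab; apply: subr0_eq; apply: H.
by rewrite expfzDr // ab -expfzDr // subrr expr0z.
Qed.

Variable n : nat.
Local Notation L := (lring k n).

Lemma lshift_ex (b : 'cV[int]_n) : exists G : {rmorphism L -> L},
  (forall c, G (lcst k n c) = lcst k n c) /\
  forall i : 'I_n, G (lvar k n i) = lcst k n (q ^ b i 0) * lvar k n i.
Proof.
pose e (i : nat) : int := if insub i is Some j then b (j : 'I_n) 0 else 0.
have ebE (i : 'I_n) : e i = b i 0 by rewrite /e valK.
have U i : lcst k n (q ^ e i) * lvar k n i \is a GRing.unit.
  by rewrite unitrMl ?lvar_unit // rmorph_unit // unitfE expfz_neq0.
have [|||G [Gc Gx _]] := @lring_ev k L (lcst k n)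
  (fun i => lcst k n (q ^ e i) * lvar k n i) (fun i => (lcst k n (q ^ e i) * lvar k n i)^-1) n.
- by move=> c i; apply: mulrC.
- by move=> *; apply: mulrC.
- by move=> i _; rewrite divrr ?mulVr.
by exists G; split=> // i; rewrite Gx // ebE.
Qed.

(** In the quantum torus this is the effect of conjugation by T^b on Laurent polynomials in the x_i;
    see [act_shift]. *)
Definition lshift_q b : {rmorphism L -> L} := sval (cid (lshift_ex b)).

Lemma lshift_cst b c : lshift_q b (lcst k n c) = lcst k n c.
Proof. by rewrite /lshift_q; case: cid => G []. Qed.

Definition dotz (u v : 'cV[int]_n) : int := \sum_i u i 0 * v i 0.

Lemma lshift_mon b u : lshift_q b (lmon k u) = lcst k n (q ^ dotz b u) * lmon k u.
Proof.
rewrite /lshift_q; case: cid => G [Gc Gx] /=; rewrite /lmon rmorph_prod.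
have -> : q ^ dotz b u = \prod_i (q ^ b i 0) ^ u i 0.
  rewrite /dotz (big_morph (fun z : int => q ^ z) (id1 := 1) (op1 := *%R)) //.
    by apply: eq_bigr => i _; rewrite exprz_exp.
  by move=> x y; rewrite expfzDr.
rewrite rmorph_prod -big_split; apply: eq_bigr => i _ /=.
rewrite rmorphXz ?lvar_unit // Gx exprMz_comm; last exact: mulrC.
- by rewrite [in RHS]rmorphXz // unitfE expfz_neq0.
- by rewrite rmorph_unit // unitfE expfz_neq0.
- exact: lvar_unit.
Qed.

Lemma lshift_delta i (w : L) (u : 'cV[int]_n) :
  (forall b, lshift_q b w = lcst k n (q ^ dotz b u) * w) ->
  lshift_q (delta_mx i 0) w = lcst k n (q ^ u i 0) * w.
Proof.
move->; congr (lcst k n (q ^ _) * _); rewrite /dotz (bigD1 i) //= mxE !eqxx mul1r.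
by rewrite big1 ?addr0 // => j /negPf ji; rewrite mxE ji mul0r.
Qed.

(* Vandermonde argument: to eliminate one eigenvector, apply a shift x_i -> q x_i minus
   its eigenvalue. *)
Lemma shift_eigen (I : L -> Prop) (J : eqType) (s : seq J)
    (u : J -> 'cV[int]_n) (w : J -> L) (X : pred 'I_n) :
    (forall a b, I a -> I b -> I (a + b)) ->
    (forall c a, I a -> I (lcst k n c * a)) ->
    (forall i a, X i -> I a -> I (lshift_q (delta_mx i 0) a)) ->
    (forall j i, X i -> lshift_q (delta_mx i 0) (w j) = lcst k n (q ^ u j i 0) * w j) ->
    uniq s -> {in s &, forall j j', (forall i, X i -> u j i 0 = u j' i 0) -> j = j'} ->
  I (\sum_(j <- s) w j) -> forall j, j \in s -> I (w j).
Proof.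
move=> ID IZ IS; elim: s w => [//|j0 s IH] w wS /= /andP[j0s us] uinj.
rewrite big_cons => Iw.
have Is j : j \in s -> I (w j).
  move=> js.
  have [i [Xi ui]] : exists i, X i /\ u j i 0 != u j0 i 0.
    apply: contrapT => /forallNP H.
    have e : j = j0.
      apply: uinj; rewrite ?inE ?js ?eqxx ?orbT // => i Xi; apply/eqP/negP => /negP ne.
      by apply: (H i).
    by rewrite e (negPf j0s) in js.
  pose w' j := lcst k n (q ^ u j i 0 - q ^ u j0 i 0) * w j.
  have Iw' : I (w' j).
    apply: IH js => //.
    - move=> j' i' Xi'; rewrite rmorphM lshift_cst wS // !mulrA.
      by congr (_ * _); rewrite mulrC.
    - by move=> a b aS bS; apply: uinj; rewrite inE ?aS ?bS orbT.
    have := ID _ _ (IS i _ Xi Iw) (IZ (- q ^ u j0 i 0) _ Iw).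
    rewrite rmorphD /= rmorph_sum wS // mulrDr addrACA -mulrDl -rmorphD subrr rmorph0.
    rewrite mul0r add0r mulr_sumr -big_split /=.
    under eq_bigr => a _ do rewrite wS // -mulrDl -rmorphD.
    by [].
  have ne : q ^ u j i 0 - q ^ u j0 i 0 != 0.
    by rewrite subr_eq0 (inj_eq expqz_inj).
  by have := IZ (q ^ u j i 0 - q ^ u j0 i 0)^-1 _ Iw'; rewrite mulrA -rmorphM mulVf // rmorph1 mul1r.
move=> j; rewrite inE => /predU1P[->|/Is //].
have -> : w j0 = (w j0 + \sum_(j <- s) w j) + lcst k n (-1) * \sum_(j <- s) w j.
  by rewrite rmorphN1 mulN1r addrK.
have I0 : I 0 by have := IZ 0 _ Iw; rewrite rmorph0 mul0r.
apply: (ID _ _ Iw); apply: (IZ); rewrite big_seq.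
by elim/big_ind: _.
Qed.

(** Distinct monomials are simultaneous eigenvectors of the shifts with distinct eigenvalues, so
    [shift_eigen] applies with the zero ideal. *)
Lemma lmon_free (J : eqType) (s : seq J) (u : J -> 'cV[int]_n) (c : J -> k) :
    uniq s -> {in s &, injective u} ->
  \sum_(j <- s) lcst k n (c j) * lmon k (u j) = 0 -> {in s, forall j, c j = 0}.
Proof.
move=> us ui s0 j sj.
have /(_ j sj) /eqP : forall j, j \in s -> lcst k n (c j) * lmon k (u j) = 0.
  apply: (@shift_eigen (fun x => x = 0) _ s u _ xpredT) s0 => //.
  - by move=> a b -> ->; rewrite addr0.
  - by move=> d a ->; rewrite mulr0.
  - by move=> i a _ ->; rewrite rmorph0.
  - move=> v i _; rewrite rmorphM lshift_cst mulrCA; congr (_ * _).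
    by apply: lshift_delta => b; apply: lshift_mon.
  - by move=> v w vs ws vw; apply: ui => //; apply/colP => i; apply: vw.
rewrite mulf_eq0 => /orP[|/eqP l0]; first by rewrite fmorph_eq0 => /eqP.
by have := lmon_unit k (u j); rewrite l0 unitr0.
Qed.

Lemma lshiftD b c l : lshift_q b (lshift_q c l) = lshift_q (b + c) l.
Proof.
have [s ->] := lring_span l; rewrite /lsum !rmorph_sum; apply: eq_bigr => -[d u] _ /=.
rewrite !rmorphM !lshift_cst lshift_mon rmorphM lshift_cst [in LHS]lshift_mon [in RHS]lshift_mon.
congr (_ * _); rewrite mulrA -rmorphM -expfzDr //; congr (lcst k n (q ^ _) * _).
rewrite addrC /dotz -big_split; apply: eq_bigr => i _ /=.
by rewrite mxE mulrDl.
Qed.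

Lemma lshift0 l : lshift_q 0 l = l.
Proof.
have [s ->] := lring_span l; rewrite /lsum rmorph_sum; apply: eq_bigr => x _.
rewrite rmorphM lshift_cst lshift_mon /dotz big1 ?expr0z ?rmorph1 ?mul1r //.
by move=> i _; rewrite mxE mul0r.
Qed.

(** The ideal generated by the shifts of [F] is stable under shifts, so by [shift_eigen] it contains
    every term of [F]; a nonzero term is a unit. *)
Lemma shift_ideal1 (F : L) : F != 0 ->
  exists t : seq (L * 'cV[int]_n), \sum_(x <- t) x.1 * lshift_q x.2 F = 1.
Proof.
move=> F0; have [s [c [us Fs]]] := lring_uniq_span F.
have [u su cu] : exists2 u, u \in s & c u != 0.
  apply: contrapT => /forall2NP H; case/eqP: F0; rewrite Fs big1_seq // => u /= su.
  by case: (H u) => // /negP; rewrite negbK => /eqP ->; rewrite rmorph0 mul0r.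
pose I a := exists t : seq (L * 'cV[int]_n), a = \sum_(x <- t) x.1 * lshift_q x.2 F.
have IM a b : I a -> I (b * a).
  move=> [t ->]; exists [seq (b * x.1, x.2) | x <- t].
  by rewrite big_map mulr_sumr; apply: eq_bigr => x _; rewrite /= mulrA.
have : I (lcst k n (c u) * lmon k u).
  apply: (@shift_eigen I _ s id (fun u => lcst k n (c u) * lmon k u) xpredT) su => //.
  - by move=> _ _ [t1 ->] [t2 ->]; exists (t1 ++ t2); rewrite big_cat.
  - by move=> d a; apply: IM.
  - move=> i _ _ [t ->]; exists [seq (lshift_q (delta_mx i 0) x.1, delta_mx i 0 + x.2) | x <- t].
    rewrite big_map rmorph_sum; apply: eq_bigr => x _.
    by rewrite rmorphM /= lshiftD.
  - move=> v i _; rewrite rmorphM lshift_cst mulrCA; congr (_ * _).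
    by apply: lshift_delta => b; apply: lshift_mon.
  - by move=> v w _ _ vw; apply/colP => i; apply: vw.
  - by exists [:: (1, 0)]; rewrite big_seq1 mul1r -Fs lshift0.
move/(IM _ (lcst k n (c u)^-1 * lmon k (- u))) => [t e]; exists t; rewrite -e.
by rewrite mulrACA -rmorphM mulVf // rmorph1 mul1r lmonN.
Qed.
End Shift.

(** * Unimodular columns *)

Section ResidueField.
Variable A : comNzRingType.

Lemma residue_field (I : A -> Prop) :
    (forall a b, I a -> I b -> I (a + b)) -> (forall a b, I b -> I (a * b)) ->
    ~ I 1 ->
  exists (F : fieldType) (f : {rmorphism A -> F}),
    (forall x, exists a, f a = x) /\ forall a, I a -> f a = 0.
Proof.
move=> ID IM I1.
pose ideal (J : set A) := [/\ J 0, forall a b, J a -> J b -> J (a + b) &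
  forall a b, J b -> J (a * b)].
(* The properties are only required of nonempty [J], because [Zorn_bigcup] also asks for the union
   of the empty chain. *)
pose P (J : set A) := (exists a, J a) -> [/\ ideal J, forall a, I a -> J a & ~ J 1].
have [F FP Ftot|m [Pm mmax]] := @Zorn_bigcup A P.
  move=> [a [J0 FJ0 J0a]].
  have FJ J : F J -> (exists a, J a) -> [/\ ideal J, forall a, I a -> J a & ~ J 1].
    by move=> FJ Ja; apply: (FP J FJ).
  have [[J00 _ _] IJ0 _] := FJ _ FJ0 (ex_intro _ a J0a).
  split; last by move=> [J FJ' J1]; have [_ _ /(_ J1)] := FJ J FJ' (ex_intro _ 1 J1).
  - split; first by exists J0.
    + move=> x y [J FJ' Jx] [J' FJ'' J'y].
      have [JJ'|J'J] := Ftot _ _ FJ' FJ''.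
        have [[_ D _] _ _] := FJ _ FJ'' (ex_intro _ y J'y).
        by exists J' => //; apply: D => //; apply: JJ'.
      have [[_ D _] _ _] := FJ _ FJ' (ex_intro _ x Jx).
      by exists J => //; apply: D => //; apply: J'J.
    + move=> x y [J FJ' Jy]; exists J => //.
      by have [[_ _ D] _ _] := FJ _ FJ' (ex_intro _ y Jy); apply: D.
  - by move=> x /IJ0; exists J0.
(* An empty maximal [m] would be strictly contained in the proper ideal [I] with 0 adjoined. *)
have m0 : exists a, m a.
  apply: contrapT => m0; pose J a := I a \/ a = 0.
  apply: (mmax J).
    split; first by move=> a ma; case: m0; exists a.
    by move=> /(_ 0) J0; case: m0; exists 0; apply: J0; right.
  move=> _; split; last by case=> // /eqP; rewrite oner_eq0.
    split; first by right.
    - move=> a b [Ia|->] [Ib|->]; rewrite ?addr0 ?add0r; [left; exact: ID|by left|by left|by right].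
    - by move=> a b [Ib|->]; [left; apply: IM | right; rewrite mulr0].
  by left.
have [[m00 mD mM] Im m1] := Pm m0.
have mV a : ~ m a -> exists b, m (1 - b * a).
  move=> ma; apply: contrapT => nb.
  pose J x := exists b, m (x - b * a).
  apply: (mmax J).
    split; first by move=> x mx; exists 0; rewrite mul0r subr0.
    by move=> /(_ a); apply: contra_not ma; apply; exists 1; rewrite mul1r subrr.
  move=> _; split=> //; last by move=> x Ix; exists 0; rewrite mul0r subr0; apply: Im.
  split; first by exists 0; rewrite mul0r subr0.
  - move=> x y [b mb] [c mc]; exists (b + c).
    by rewrite mulrDl opprD addrACA; apply: mD.
  - move=> x y [b mb]; exists (x * b).
    by rewrite -mulrA -mulrBr; apply: mM.
pose S : pred A := fun a => `[< m a >].
have Scl : idealr_closed S.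
  split; [exact/asboolP | exact/asboolP|].
  by move=> a u v /asboolP mu /asboolP mv; apply/asboolP/mD => //; apply: mM.
pose S' : idealr A := HB.pack S (isIdealr.Build A S Scl).
pose Q : comNzRingType := {ideal_quot S'}.
pose pi : A -> Q := \pi_({ideal_quot S'})%qT.
have pi0 a : m a -> pi a = 0.
  move=> ma; apply/eqP; rewrite /pi; unlock; rewrite !piE Quotient.equivE subr0.
  exact/asboolP.
have piB : zmod_morphism pi by move=> a b; rewrite /pi !piE.
have piM : monoid_morphism pi by split=> [|a b]; rewrite /pi !piE.
pose f0 : {rmorphism A -> Q} := HB.pack pi
  (GRing.isZmodMorphism.Build A Q pi piB) (GRing.isMonoidMorphism.Build A Q pi piM).
have f0s x : exists a, f0 a = x by exists (repr x); rewrite /= /pi reprK.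
have Qinv (x : Q) : exists y, (x != 0 -> y * x = 1) /\ (x = 0 -> y = 0).
  case: (eqVneq x 0) => [->|x0]; first by exists 0; split => //; rewrite eqxx.
  have [a ax] := f0s x.
  have [|b mb] := mV a; first by move=> /pi0 /eqP; rewrite -[pi a]/(f0 a) ax (negPf x0).
  exists (f0 b); split=> [_|xe]; last by rewrite xe eqxx in x0.
  apply/eqP; rewrite eq_sym -subr_eq0 -(rmorph1 f0) -ax -rmorphM -rmorphB; exact/eqP/pi0.
pose inv x := sval (cid (Qinv x)).
have mulVf x : x != 0 -> inv x * x = 1 by exact: (proj1 (svalP (cid (Qinv x)))).
have invr0 : inv 0 = 0 by exact: (proj2 (svalP (cid (Qinv 0)))) erefl.
pose K : fieldType := HB.pack Q (GRing.ComNzRing_isField.Build Q mulVf invr0).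
exists K, f0; split; first exact: f0s.
by move=> a /Im /pi0.
Qed.
End ResidueField.

(** [gdcop a p] is the largest divisor of p coprime to a. Hence every irreducible factor of p
    divides exactly one of a and [gdcop a p * b], and does not divide their sum. *)
Lemma coprimep_shift (F : fieldType) (p a b : {poly F}) : p != 0 ->
  coprimep p (gcdp a b) -> coprimep p (a + gdcop a p * b).
Proof.
move=> p0 cpab; case: gdcopP => h hp; rewrite (negPf p0) orbF => cha hmax.
apply/coprimepP => d dp dab.
have cda : coprimep d a.
  apply/coprimepP => e ed ea.
  have eb : e %| b.
    have ehb : e %| h * b by rewrite -(dvdp_addr _ ea); apply: dvdp_trans dab.
    have ceh : coprimep e h.
      by rewrite coprimep_sym; apply: coprimep_dvdl ea cha.
    by rewrite Gauss_dvdpr in ehb.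
  apply: (coprimepP _ _ cpab); first exact: dvdp_trans ed dp.
  by rewrite dvdp_gcd ea.
have dh := hmax d dp cda.
have da : d %| a.
  by rewrite -(dvdp_addl _ (dvdp_mulr b dh)).
by move/coprimepP: cda => /(_ d (dvdpp d) da).
Qed.

Section UnitSimilar.
Variable R : comUnitRingType.

Definition usim m (v w : 'cV[R]_m) := exists2 G, G \in unitmx & G *m v = w.

Lemma usim_sym m (v w : 'cV[R]_m) : usim v w -> usim w v.
Proof.
by move=> [G uG <-]; exists (invmx G); rewrite ?unitmx_inv // mulKmx.
Qed.

Lemma usim_trans m (v w z : 'cV[R]_m) : usim v w -> usim w z -> usim v z.
Proof.
move=> [G uG <-] [H uH <-]; exists (H *m G); first by rewrite unitmx_mul uH.
by rewrite mulmxA.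
Qed.

Lemma usim_mul m (G : 'M[R]_m) v : G \in unitmx -> usim v (G *m v).
Proof. by move=> uG; exists G. Qed.

Lemma usim_unit_head m (a : R) (h : 'cV[R]_m) : a \is a GRing.unit ->
  usim (col_mx a%:M h) (col_mx 1%:M 0).
Proof.
move=> ua; exists (block_mx (a^-1)%:M 0 (- (a^-1 *: h)) 1%:M).
  by rewrite unitmxE det_lblock det1 mulr1 det_scalar1 unitrV.
rewrite mul_block_col mul0mx addr0 -scalar_mxM mulVr // mul1mx.
by rewrite mulNmx mul_mx_scalar scalerA divrr // scale1r addNr.
Qed.
End UnitSimilar.

(** * Suslin's theorem on unimodular columns with a monic entry *)

Section Suslin.
Variable A : idomainType.
Local Notation R := {poly A}.

Lemma comp_poly_diff (p : R) (s t y : R) (c : R) : s = t + c * y ->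
  exists d, p \Po s = p \Po t + c * d.
Proof.
move=> st; elim/poly_ind: p => [|p a [d IH]]; first by exists 0; rewrite !comp_poly0 mulr0 addr0.
exists (d * s + (p \Po t) * y).
rewrite !comp_polyD !comp_polyM !comp_polyX !comp_polyC IH st; ring.
Qed.

Definition evmx m (s : R) (v : 'cV[R]_m) : 'cV[R]_m := map_mx (comp_poly s) v.

Lemma evmxM m n (s : R) (G : 'M[R]_(n, m)) v :
  evmx s (G *m v) = map_mx (comp_poly s) G *m evmx s v.
Proof. by rewrite /evmx map_mxM. Qed.

Lemma suslin_step m (g0 g1 : R) (h : 'cV[R]_m) (a b : R) (c : A) (s t y : R) :
    c%:P = a * g0 + b * g1 -> s = t + c%:P * y ->
  usim (evmx t (col_mx (col_mx g0%:M g1%:M) h)) (evmx s (col_mx (col_mx g0%:M g1%:M) h)).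
Proof.
move=> cab st; have [c0|c0] := eqVneq c 0.
  have -> : s = t by rewrite st c0 mul0r addr0.
  by exists 1%:M; rewrite ?unitmx1 // mul1mx.
have cR0 : c%:P != 0 :> R by rewrite polyC_eq0.
have cab' u : c%:P = (a \Po u) * (g0 \Po u) + (b \Po u) * (g1 \Po u).
  by rewrite -!comp_polyM -comp_polyD -cab comp_polyC.
have [d0 e0] := comp_poly_diff g0 st; have [d1 e1] := comp_poly_diff g1 st.
have [da ea] := comp_poly_diff a st; have [db eb] := comp_poly_diff b st.
have /fin_all_exists[D eD] (i : 'I_m) : exists d, (h i 0) \Po s = (h i 0) \Po t + c%:P * d.
  exact: comp_poly_diff st.
move: (cab' t) (cab' s); rewrite e0 e1 ea eb => ct cs.
rewrite /evmx !map_col_mx !map_scalar_mx /= e0 e1.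
move: (g0 \Po t) (g1 \Po t) (a \Po t) (b \Po t) ct cs => {e0 e1 ea eb cab cab'} x0 x1 xa xb ct cs.
have Z : xa * d0 + x0 * da + xb * d1 + x1 * db + c%:P * (da * d0 + db * d1) = 0.
  apply: (mulfI cR0); rewrite mulr0.
  transitivity ((xa + c%:P * da) * (x0 + c%:P * d0) + (xb + c%:P * db) * (x1 + c%:P * d1)
     - (xa * x0 + xb * x1)); first by ring.
  by rewrite -cs -ct subrr.
(* Let N(u) be the matrix with rows (g0, -b) and (g1, a) evaluated at u; its determinant is c. The
   p's are the entries of N(s) N(t)^-1, which carries (g0, g1) at t to (g0, g1) at s and is
   polynomial because s = t modulo c. *)
pose p00 := 1 + d0 * xa + db * x1; pose p01 := d0 * xb - db * x0.
pose p10 := d1 * xa - da * x1; pose p11 := 1 + d1 * xb + da * x0.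
have sD u v : u%:M + v%:M = (u + v)%:M :> 'M[R]_1 by rewrite raddfD.
have detP : p00 * p11 - p01 * p10 = 1.
  transitivity (1 + (xa * d0 + x0 * da + xb * d1 + x1 * db +
    (xa * x0 + xb * x1) * (da * d0 + db * d1))); first by rewrite /p00 /p11 /p01 /p10; ring.
  by rewrite -ct Z addr0.
pose P : 'M[R]_(1 + 1) := block_mx p00%:M p01%:M p10%:M p11%:M.
have uP : P \in unitmx.
  have /mulmx1_unit[//] : P *m block_mx p11%:M (- p01)%:M (- p10)%:M p00%:M = 1%:M.
  rewrite mulmx_block -!scalar_mxM !sD (scalar_mx_block 1 1).
  congr (block_mx _ _ _ _).
  - by congr (_%:M); rewrite -detP; ring.
  - by rewrite (_ : _ + _ = 0) ?raddf0 //; ring.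
  - by rewrite (_ : _ + _ = 0) ?raddf0 //; ring.
  - by congr (_%:M); rewrite -detP; ring.
(* The change of [h] from t to s is c times [D], and c is the combination [xa * x0 + xb * x1] of the
   two head entries at t. *)
pose W : 'M[R]_(m, 1 + 1) := row_mx (\col_i (D i * xa)) (\col_i (D i * xb)).
exists (block_mx P 0 W 1%:M).
  by rewrite unitmxE det_lblock det1 mulr1 -unitmxE.
rewrite mul_block_col mul0mx addr0 mul1mx; congr col_mx.
  rewrite mul_block_col -!scalar_mxM !sD; congr (col_mx _%:M _%:M).
    by rewrite ct /p00 /p01; ring.
  by rewrite ct /p10 /p11; ring.
apply/matrixP => i j; rewrite (ord1 j) mul_row_col !mul_mx_scalar !mxE eD ct; ring.
Qed.

Lemma monic_lift (p g : R) : g \is monic -> (p + 'X^((size p).+1) * g) \is monic.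
Proof.
move=> mg; have g0 := monic_neq0 mg; rewrite monicE addrC lead_coefDl.
  by rewrite lead_coef_monicM ?monicXn // (monicP mg).
by rewrite mulrC size_mulXn // addSn ltnS leq_addr.
Qed.

Lemma size_monic_lift (p g : R) : g != 0 -> (1 < size (p + 'X^((size p).+1) * g)%R)%N.
Proof.
move=> g0; rewrite addrC size_polyDl mulrC size_mulXn //; last by rewrite addSn ltnS leq_addr.
by rewrite addSn ltnS ltn_addl // size_poly_gt0.
Qed.

(** Monic polynomials keep their degree under [f], so the Sylvester matrix keeps its size. *)
Lemma map_resultant_monic (F : fieldType) (f : {rmorphism A -> F}) (p q : R) :
  p \is monic -> q \is monic ->
  f (resultant p q) = resultant (map_poly f p) (map_poly f q).
Proof.
move=> /monicP mp /monicP mq.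
rewrite /resultant /Sylvester_mx !size_map_poly_id0 ?mp ?mq ?rmorph1 ?oner_eq0 //.
rewrite -det_map_mx /= map_col_mx; congr (\det (col_mx _ _));
  by apply: map_lin1_mx => v; rewrite map_poly_rV rmorphM /= map_rVpoly.
Qed.

Lemma evmx_unit m (s : R) (G : 'M[R]_m) : G \in unitmx ->
  map_mx (comp_poly s) G \in unitmx.
Proof. by rewrite !unitmxE det_map_mx => /(rmorph_unit (comp_poly s)). Qed.

Lemma evmx_usim m (s t : R) (G : 'M[R]_m) v : G \in unitmx ->
  usim (evmx t (G *m v)) (evmx s (G *m v)) -> usim (evmx t v) (evmx s v).
Proof.
move=> uG vG.
have E u : usim (evmx u v) (evmx u (G *m v)).
  by rewrite evmxM; exists (map_mx (comp_poly u) G); rewrite ?evmx_unit.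
exact: usim_trans (E t) (usim_trans vG (usim_sym (E s))).
Qed.

(* The constants c such that v is unimodularly equivalent to itself after any substitution
   'X -> 'X + c y form an ideal I. If I were proper, then modulo a maximal ideal containing it
   the entry g1 could be made coprime to g0, and their resultant would be a constant of I
   outside of that ideal. *)
Theorem suslin m (g0 g1 : R) (h : 'cV[R]_m) (w0 w1 : R) (w : 'rV[R]_m) :
    w0 * g0 + w1 * g1 + (w *m h) 0 0 = 1 -> g0 \is monic ->
  let v := col_mx (col_mx g0%:M g1%:M) h in usim v (evmx 0 v).
Proof.
move=> unim mg0 v.
pose I c := forall s t y, s = t + c%:P * y -> usim (evmx t v) (evmx s v).
suff I1 : I 1.
  apply: usim_sym; rewrite {2}(_ : v = evmx 'X v); first by apply: (I1 _ _ 'X); rewrite add0r mul1r.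
  by apply/matrixP => i j; rewrite [RHS]mxE [RHS]comp_polyXr.
apply: contrapT => nI1.
have [|||F [f [fS fI]]] := @residue_field A I.
- move=> a b Ia Ib s t y st; apply: usim_trans (Ia (t + a%:P * y) t y erefl) _.
  by apply: (Ib _ _ y); rewrite st polyCD mulrDl addrA.
- by move=> a b Ib s t y st; apply: (Ib _ _ (a%:P * y)); rewrite st polyCM mulrCA mulrA.
- exact: nI1.
pose B := (w *m h) 0 0.
(* By [coprimep_shift], adding [H * B] to [g1] makes it coprime to [g0] over the residue field;
   since [B] is a combination of the entries of [h], this is an elementary row operation. *)
have [H Hf] : exists H, map_poly f H = gdcop (map_poly f g1) (map_poly f g0).
  set p := gdcop _ _.
  have /choice[g gE] : forall x, exists a, f a = x by [].
  exists (\poly_(i < size p) g p`_i); apply/polyP => i.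
  rewrite coef_map coef_poly; case: ltnP => [_|?]; first exact: gE.
  by rewrite nth_default //; exact: rmorph0.
(* Adding ['X^N * g0] changes nothing modulo [g0], but makes the second entry monic, so that the
   resultant commutes with reduction. *)
pose N := (size (g1 + H * B)).+1.
pose g1' := g1 + H * B + 'X^N * g0.
have mg1' : g1' \is monic by apply: monic_lift.
pose E : 'M[R]_(1 + 1 + m) :=
  block_mx (block_mx 1%:M 0 'X^N%:M 1%:M) (col_mx 0 (H *: w)) 0 1%:M.
have uE : E \in unitmx.
  by rewrite unitmxE det_ublock det_lblock !det1 !mulr1 unitr1.
have Ev : E *m v = col_mx (col_mx g0%:M g1'%:M) h.
  rewrite mul_block_col mul0mx add0r mul1mx; congr col_mx.
  rewrite mul_block_col mul0mx addr0 mul1mx mul_col_mx add_col_mx mul0mx addr0.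
  congr col_mx; rewrite -scalemxAl; apply/matrixP => i j.
  rewrite (ord1 i) (ord1 j) mul1mx -scalar_mxM /g1' /B; move: (w *m h) => z.
  by rewrite !mxE !eqxx !mulr1n; ring.
have g0n : g0 != 0 := monic_neq0 mg0.
have nIc c a b : c%:P = a * g0 + b * g1' -> f c = 0.
  move=> cab; apply: fI => s t y st; apply: (evmx_usim uE); rewrite Ev.
  exact: suslin_step cab st.
have [sg0|sg0] := leqP (size g0) 1.
  have e : g0 = 1.
    by move: mg0; rewrite (size1_polyC sg0) monicE lead_coefC => /eqP ->.
  have : f 1 = 0 by apply: (nIc _ 1 0); rewrite e mul1r mul0r addr0.
  by move/eqP; rewrite rmorph1 oner_eq0.
have [[a b] _ /= cab] := resultant_in_ideal sg0 (size_monic_lift (g1 + H * B) g0n).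
have /eqP := nIc _ _ _ cab.
rewrite map_resultant_monic // resultant_eq0.
apply/negP; rewrite -leqNgt leq_eqVlt -coprimep_def; apply/orP; left.
rewrite /g1' addrC !rmorphD !rmorphM /= coprimep_addl_mul Hf.
apply: coprimep_shift; first by rewrite monic_neq0 // monic_map.
apply/coprimepP => d d0; rewrite dvdp_gcd => /andP[d1 dB].
rewrite -size_poly_eq1 -dvdp1 -(rmorph1 (map_poly f)) -unim.
by rewrite !rmorphD !rmorphM /= !dvdp_add // dvdp_mull.
Qed.
End Suslin.

Lemma usim_map (R S : comUnitRingType) (f : {rmorphism R -> S}) m (v w : 'cV[R]_m) :
  usim v w -> usim (map_mx f v) (map_mx f w).
Proof.
move=> [G uG <-]; rewrite map_mxM; apply: usim_mul.
by move: uG; rewrite !unitmxE det_map_mx => /(rmorph_unit f).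
Qed.

(* Some automorphism turns f into a polynomial with unit leading and constant coefficients,
   up to a unit: the analogue for Laurent polynomials of Nagata's change of variables. *)
Definition normalizable (A : idomainType) := forall f : laurent A, f != 0 ->
  exists (g h : {rmorphism laurent A -> laurent A}) (e : laurent A) (p : {poly A}),
    [/\ cancel g h, cancel h g, e \is a GRing.unit &
        [/\ p \is monic, p`_0 \is a GRing.unit & e * g f = laurent_poly p]].

(** Such a p is invertible modulo X, hence modulo every power of X. *)
Lemma coprime_Xn (A : idomainType) (p : {poly A}) N : p`_0 \is a GRing.unit ->
  exists c d, c * p + d * 'X^N = 1.
Proof.
move=> up.
pose g := \poly_(i < size p) p`_i.+1.
have pE : p = (p`_0)%:P + 'X * g.
  apply/polyP => i; rewrite coefD coefC coefXM coef_poly.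
  case: i => [|i] /=; first by rewrite addr0.
  rewrite add0r; case: ltnP => // le_pi; rewrite nth_default //; exact: ltnW.
elim: N => [|n [c [d cd]]]; first by exists 0, 1; rewrite mul0r mul1r expr0 add0r.
exists (c + d * 'X^n * (p`_0)^-1%:P), (- (d * (p`_0)^-1%:P * g)).
rewrite -cd mulrDl -addrA; congr (_ + _).
have e : (p`_0)^-1%:P * p = 1 + (p`_0)^-1%:P * ('X * g).
  by rewrite {2}pE mulrDr -polyCM mulVr // polyC1.
rewrite -mulrA e exprS; ring.
Qed.

Section Unimodular.
Variable A : idomainType.
Local Notation L := (laurent A).
Local Notation X := (laurentX A).
Local Notation pl := (@laurent_poly A).
Hypothesis normA : normalizable A.

Lemma laurent_common m n (M : 'M[L]_(m, n)) :
  exists N (P : 'M[{poly A}]_(m, n)), X ^+ N *: M = map_mx pl P.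
Proof.
have /choice[N /choice[P PE]] (x : 'I_m * 'I_n) := laurentP (M x.1 x.2).
exists (\max_x N x), (\matrix_(i, j) (P (i, j) * 'X^(\max_x N x - N (i, j)))).
apply/matrixP => i j; rewrite !mxE rmorphM rmorphXn /= -PE /= -mulrA -exprD.
by rewrite subnKC ?(leq_bigmax (i, j)) // mulrC.
Qed.

Lemma unimodular_poly (p : {poly A}) m (h : 'cV[{poly A}]_(1 + m)) (w0 : L) (w : 'rV[L]_(1 + m)) :
    p \is monic -> p`_0 \is a GRing.unit ->
    w0 * pl p + (w *m map_mx pl h) 0 0 = 1 ->
  usim (map_mx pl (col_mx p%:M h)) (col_mx 1%:M 0).
Proof.
move=> mp up wh.
have [N [W WE]] := laurent_common (row_mx w0%:M w : 'rV_(1 + (1 + m))).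
have [c [d cd]] := coprime_Xn N up.
pose W0 := W 0 (lshift _ 0); pose W1 : 'rV_(1 + m) := \row_j W 0 (rshift 1 j).
have WX : W0 * p + (W1 *m h) 0 0 = 'X^N.
  apply: (@laurent_poly_inj A); rewrite rmorphD rmorphM rmorphXn /=.
  have e0 : pl W0 = X ^+ N * w0.
    have := congr1 (fun M : 'M[L]_(1, 1 + (1 + m)) => M 0 (lshift _ 0)) WE.
    by rewrite mxE row_mxEl !mxE mulr1n => ->.
  have e1 : map_mx pl W1 = X ^+ N *: w.
    apply/matrixP => i j; have := congr1 (fun M : 'M[L]_(1, 1 + (1 + m)) => M 0 (rshift _ j)) WE.
    by rewrite mxE row_mxEr !mxE (ord1 i) => ->.
  have -> : pl ((W1 *m h) 0 0) = (map_mx pl W1 *m map_mx pl h) 0 0.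
    by rewrite -map_mxM [RHS]mxE.
  by rewrite e0 e1 -scalemxAl [X in _ + X]mxE -mulrA -mulrDr wh mulr1.
pose g1 := h 0 0; pose h' : 'cV_m := dsubmx h.
have hE : h = col_mx g1%:M h'.
  rewrite -[LHS]vsubmxK; congr col_mx; apply/matrixP => i j; rewrite (ord1 i) (ord1 j) !mxE mulr1n.
  by congr (h _ _); apply: val_inj.
have [|G uG GE] := @suslin A m p g1 h' (c + d * W0) (d * W1 0 0) (d *: rsubmx W1) _ mp.
  rewrite -[RHS]cd -WX -scalemxAl [X in _ + X]mxE.
  have -> : (W1 *m h) 0 0 = W1 0 0 * g1 + (rsubmx W1 *m h') 0 0.
    rewrite -[W1 in LHS]hsubmxK hE mul_row_col mxE; congr (_ + _).
    rewrite mxE big_ord1 !mxE mulr1n; congr (W _ _ * _); exact: val_inj.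
  by ring.
have : usim (col_mx p%:M h) (col_mx 1%:M 0).
  have -> : col_mx p%:M h = col_mx (col_mx p%:M g1%:M) h' :> 'cV_(1 + 1 + m).
    by rewrite hE col_mxA castmx_id.
  apply: usim_trans (ex_intro2 _ _ G uG GE) _.
  rewrite /evmx !map_col_mx !map_scalar_mx /=.
  have -> (a b : 'M[{poly A}]_1) (z : 'cV_m) :
    col_mx (col_mx a b) z = col_mx a (col_mx b z) :> 'cV[{poly A}]_(1 + (1 + m)).
    by rewrite [RHS]col_mxA castmx_id.
  apply: usim_unit_head; rewrite comp_poly0r.
  by rewrite rmorph_unit.
by move/(usim_map pl); rewrite !map_col_mx !map_scalar_mx map_mx0 rmorph1.
Qed.

(** A nonzero entry is moved to the head and normalized by an automorphism; scaling the other
    entries by a power of X leads to [unimodular_poly]. Columns of length 1 are treated apart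
    because Suslin's theorem needs a second entry. *)
Lemma unimodular m (v : 'cV[L]_(1 + m)) (w : 'rV[L]_(1 + m)) :
  w *m v = 1%:M -> usim v (col_mx 1%:M 0).
Proof.
case: m v w => [|m] v w wv.
  have vw : v *m (w : 'M[L]_(1, 1 + 0)) = 1%:M by apply: mulmx1C.
  exists w; first by have [] := mulmx1_unit wv.
  rewrite wv -[LHS](@vsubmxK _ 1 0); congr col_mx; last by apply/matrixP => [[]].
  by apply/matrixP => i j; rewrite (ord1 i) (ord1 j) !mxE.
have [i vi] : exists i, v i 0 != 0.
  apply: contrapT => /forallNP H.
  have v0 : v = 0 by apply/colP => i; rewrite !mxE; apply/eqP/negP => /negP; exact: H.
  have := congr1 (fun M : 'M[L]_1 => M 0 0) wv.
  by rewrite v0 mulmx0 !mxE /= => /eqP; rewrite eq_sym oner_eq0.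
pose P : 'M[L]_(1 + m.+1) := perm_mx (tperm 0 i).
have uP : P \in unitmx by rewrite unitmx_perm.
apply: usim_trans (usim_mul v uP) _.
have : (w *m invmx P) *m (P *m v) = 1%:M by rewrite mulmxA mulmxKV.
have : (P *m v) 0 0 != 0 by rewrite -row_permE mxE tpermL.
move: (P *m v) (w *m invmx P) => {P uP i vi wv}v {}w v0 wv.
have [g [g' [e [p [gK _ ue [mp up ep]]]]]] := normA v0.
pose a := v 0 0; pose h := dsubmx v.
have vE : v = col_mx a%:M h.
  rewrite -[LHS]vsubmxK; congr col_mx; apply/matrixP => i j; rewrite (ord1 i) (ord1 j) !mxE mulr1n.
  by congr (v _ _); apply: val_inj.
suff gv : usim (map_mx g v) (col_mx 1%:M 0).
  have := usim_map g' gv; rewrite map_col_mx map_scalar_mx map_mx0 rmorph1.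
  by rewrite -map_mx_comp (_ : map_mx _ v = v) //; apply/matrixP => i j; rewrite mxE /= gK.
have [N [Q QE]] := laurent_common (map_mx g h).
have uX : X ^+ N \is a GRing.unit by rewrite unitrX ?laurentX_unit.
have uD : block_mx e%:M 0 0 (X ^+ N)%:M \in @unitmx L (1 + m.+1).
  by rewrite unitmxE det_lblock !det_scalar unitrM !unitrX ?laurentX_unit.
apply: usim_trans (usim_mul _ uD) _.
rewrite vE map_col_mx map_scalar_mx mul_block_col !mul0mx addr0 add0r -scalar_mxM ep mul_scalar_mx QE.
rewrite -(map_scalar_mx pl) -map_col_mx.
apply: (unimodular_poly (w0 := g (w 0 0) * e^-1) (w := (X ^- N) *: map_mx g (rsubmx w))) => //.
have <- : g ((w *m v) 0 0) = 1 by rewrite wv mxE rmorph1.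
rewrite [in RHS]vE -[w in RHS]hsubmxK mul_row_col [X in _ = g X]mxE rmorphD; congr (_ + _).
  rewrite -ep mulrA mulrVK // -rmorphM; congr (g _).
  by rewrite mxE big_ord1 !mxE mulr1n; congr (w _ _ * _); apply: val_inj.
rewrite -QE -scalemxAl -scalemxAr scalerA mulVr // scale1r -map_mxM.
by rewrite [LHS]mxE; congr (g _); rewrite hsubmxK.
Qed.

(** This is the matrix form of the statement that stably free modules over [laurent A] are free: the
    columns of a split injection are straightened one at a time. *)
Lemma left_inverse_completion d m (M : 'M[L]_(d + m, d)) (N : 'M[L]_(d, d + m)) :
  N *m M = 1%:M -> exists2 G, G \in unitmx & G *m M = col_mx 1%:M 0.
Proof.
elim: d M N => [|d IH] M N NM.
  by exists 1%:M; rewrite ?unitmx1 //; apply/matrixP => i [].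
pose M' : 'M[L]_(1 + (d + m), 1 + d) := M; pose N' : 'M[L]_(1 + d, 1 + (d + m)) := N.
have {}NM : N' *m M' = 1%:M by [].
suff [G uG GM] : exists2 G, G \in unitmx & G *m M' = block_mx 1%:M 0 0 (col_mx 1%:M 0).
  exists G => //; rewrite -[LHS]/(G *m M') GM block_mxEv -[X in row_mx X (col_mx _ _)]col_mx0.
  rewrite -block_mxEh block_mxEv row_mx0 col_mxA castmx_id -block_mxEv.
  by rewrite -scalar_mx_block.
have wv : usubmx N' *m lsubmx M' = 1%:M.
  rewrite mulmx_lsub mul_usub_mx NM (scalar_mx_block 1 d).
  by rewrite block_mxEv col_mxKu row_mxKl.
have [G1 uG1 G1v] := unimodular wv.
pose r := ursubmx (G1 *m M'); pose M1 := drsubmx (G1 *m M').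
have G1M : G1 *m M' = block_mx 1%:M r 0 M1.
  rewrite -[LHS]submxK; congr block_mx.
    have <- : usubmx (lsubmx (G1 *m M')) = 1%:M by rewrite -mulmx_lsub G1v col_mxKu.
    by apply/matrixP => i j; rewrite !mxE.
  have <- : dsubmx (lsubmx (G1 *m M')) = 0 by rewrite -mulmx_lsub G1v col_mxKd.
  by apply/matrixP => i j; rewrite !mxE.
pose N2 := N' *m invmx G1.
have : N2 *m (G1 *m M') = 1%:M by rewrite mulmxA mulmxKV.
rewrite G1M -[N2]submxK mulmx_block (scalar_mx_block 1 d) => /eq_block_mx[_ _].
rewrite mulmx1 mulmx0 addr0 => ->; rewrite mul0mx add0r => /IH[G2 uG2 G2M].
have uB : block_mx 1%:M 0 0 G2 \in @unitmx L (1 + (d + m)).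
  by rewrite unitmxE det_lblock det1 mul1r -unitmxE.
pose C : 'M[L]_(1, d + m) := - row_mx r 0.
have uC : block_mx 1%:M C 0 1%:M \in @unitmx L (1 + (d + m)).
  by rewrite unitmxE det_ublock !det1 mul1r unitr1.
exists (block_mx 1%:M C 0 1%:M *m block_mx 1%:M 0 0 G2 *m G1).
  by rewrite !unitmx_mul uC uB.
rewrite -!mulmxA G1M mulmx_block !mul1mx !mul0mx !mulmx0 !addr0 !add0r G2M.
rewrite mulmx_block !mul1mx !mul0mx !mulmx0 !addr0 !add0r.
by congr block_mx; rewrite mulNmx mul_row_col mulmx1 mulmx0 addr0 subrr.
Qed.
End Unimodular.

(** * Projective modules over Laurent polynomial rings *)

Section LaurentDivision.
Variables (A : idomainType) (f : {poly A}).
Local Notation L := (laurent A).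
Local Notation X := (laurentX A).
Local Notation pl := (@laurent_poly A).
Hypotheses (mf : f \is monic) (uf : f`_0 \is a GRing.unit).

(** Since X is invertible modulo [f], every Laurent polynomial is congruent to a polynomial, which
    can be divided by the monic [f]. *)
Lemma laurent_edivp (l : L) : exists qr : L * {poly A},
  l = pl f * qr.1 + pl qr.2 /\ (size qr.2 < size f)%N.
Proof.
have [N [p lp]] := laurentP l.
have [c [d cd]] := coprime_Xn N uf.
exists (pl c * l + pl (Pdiv.Ring.rdivp (d * p) f), Pdiv.Ring.rmodp (d * p) f).
split; last by rewrite Pdiv.Ring.ltn_rmodpN0 // monic_neq0.
have e := Pdiv.RingMonic.rdivp_eq mf (d * p).
have dp : pl (d * p) = l * pl (d * 'X^N) by rewrite !rmorphM rmorphXn /= -lp mulrCA.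
rewrite mulrDr -addrA -[pl f * pl _]rmorphM -rmorphD [f * _]mulrC -e /= dp.
by rewrite mulrA -rmorphM mulrC -mulrDr -rmorphD [f * c]mulrC cd rmorph1 mulr1.
Qed.

Lemma laurent_edivp_uniq (q1 q2 : L) (r1 r2 : {poly A}) :
  (size r1 < size f)%N -> (size r2 < size f)%N ->
  pl f * q1 + pl r1 = pl f * q2 + pl r2 -> q1 = q2 /\ r1 = r2.
Proof.
move=> s1 s2 e.
have e1 : pl f * (q1 - q2) = pl (r2 - r1).
  rewrite mulrBr rmorphB /=; apply/eqP; rewrite subr_eq addrAC eq_sym subr_eq.
  by rewrite e addrC eqxx.
have [N [s qs]] := laurentP (q1 - q2).
have [c [d cd]] := coprime_Xn N uf.
have e2 : f * (d * s + c * (r2 - r1)) = r2 - r1.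
  rewrite mulrDr mulrCA; have -> : f * s = (r2 - r1) * 'X^N.
    by apply: (@laurent_poly_inj A); rewrite !rmorphM rmorphXn /= -qs mulrA e1.
  by rewrite mulrCA -[RHS]mul1r -cd; ring.
have r0 : r2 - r1 = 0.
  apply: contraTeq isT => r0; have : (size (r2 - r1)%R < size f)%N.
    by rewrite (leq_ltn_trans (size_polyD _ _)) // size_polyN gtn_max s1 s2.
  rewrite -e2; set t := (X in f * X); have t0 : t != 0.
    by apply: contra_neq r0 => t0; rewrite -e2 -/t t0 mulr0.
  by rewrite size_monicM // -subn1 -addnBA ?size_poly_gt0 // -ltn_subRL subnn ltn0.
split; last by apply/esym/subr0_eq.
move/eqP: e1; rewrite r0 rmorph0 mulf_eq0 -(rmorph0 pl) (inj_eq (@laurent_poly_inj A)).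
by rewrite (negPf (monic_neq0 mf)) rmorph0 subr_eq0 => /eqP.
Qed.

(** This quotient is an [A]-linear left inverse of multiplication by [f]; its kernel consists of the
    polynomials of degree less than that of [f]. *)
Definition lquo (l : L) : L := (sval (cid (laurent_edivp l))).1.
Definition lrem (l : L) : {poly A} := (sval (cid (laurent_edivp l))).2.

Lemma ldiv_eq l : l = pl f * lquo l + pl (lrem l).
Proof. by rewrite /lquo /lrem; case: cid => x []. Qed.
Lemma size_lrem l : (size (lrem l) < size f)%N.
Proof. by rewrite /lrem; case: cid => x []. Qed.

Lemma lquoE l q (r : {poly A}) : l = pl f * q + pl r -> (size r < size f)%N ->
  lquo l = q /\ lrem l = r.
Proof.
move=> e sr; apply: laurent_edivp_uniq => //; first exact: size_lrem.
by rewrite -ldiv_eq.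
Qed.

Lemma ldivD u v : lquo (u + v) = lquo u + lquo v /\ lrem (u + v) = lrem u + lrem v.
Proof.
apply: lquoE; last by rewrite (leq_ltn_trans (size_polyD _ _)) // gtn_max !size_lrem.
by rewrite {1}(ldiv_eq u) {1}(ldiv_eq v) rmorphD /= mulrDr addrACA.
Qed.

Lemma ldivZ a u : lquo (u * laurentC a) = lquo u * laurentC a /\
  lrem (u * laurentC a) = lrem u * a%:P.
Proof.
apply: lquoE; last by rewrite mulrC mul_polyC (leq_ltn_trans (size_scale_leq _ _)) ?size_lrem.
by rewrite {1}(ldiv_eq u) rmorphM /= mulrDl mulrA.
Qed.

Lemma lquo0 : lquo 0 = 0 /\ lrem 0 = 0.
Proof.
by have := ldivZ 0 0; rewrite mul0r polyC0 !rmorph0 !mulr0.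
Qed.

Lemma lquo_mul u : lquo (pl f * u) = u.
Proof.
by have [] := @lquoE (pl f * u) u 0 _ _; rewrite ?rmorph0 ?addr0 // size_poly0 size_poly_gt0 monic_neq0.
Qed.

Lemma lquo_lrem l : lquo (pl (lrem l)) = 0.
Proof.
by have [] := @lquoE (pl (lrem l)) 0 (lrem l); rewrite ?mulr0 ?add0r // size_lrem.
Qed.

Definition quomx m n (M : 'M[L]_(m, n)) := map_mx lquo M.

Lemma quomxD m n (M N : 'M[L]_(m, n)) : quomx (M + N) = quomx M + quomx N.
Proof. by apply/matrixP => i j; rewrite !mxE (ldivD _ _).1. Qed.

Local Notation "N ^iota" := (map_mx (@laurentC A) N) (at level 2, format "N ^iota").

Lemma quomxM m n p (M : 'M[L]_(m, n)) (N : 'M[A]_(n, p)) :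
  quomx (M *m N^iota) = quomx M *m N^iota.
Proof.
apply/matrixP => i j; rewrite !mxE (big_morph lquo (id1 := 0) (op1 := +%R)).
- by apply: eq_bigr => h _; rewrite !mxE (ldivZ _ _).1.
- by move=> u v; rewrite (ldivD _ _).1.
- exact: lquo0.1.
Qed.

Lemma quomxZ m n (M : 'M[L]_(m, n)) : quomx (pl f *: M) = M.
Proof. by apply/matrixP => i j; rewrite !mxE lquo_mul. Qed.

Section Remainder.
Variable p : nat.
Local Notation I := ('I_p * 'I_(size f).-1)%type.
Local Notation delta := #|{: I}|.

(** The columns X^j e_i with j less than the degree of [f] form an [A]-basis of the remainders in
    L^p. *)
Definition rem_basis : 'M[L]_(p, delta) :=
  \matrix_(i, k) ((i == (enum_val k : I).1)%:R * X ^+ (enum_val k : I).2).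

Definition rem_coord n (M : 'M[L]_(p, n)) : 'M[A]_(delta, n) :=
  \matrix_(k, j) (lrem (M (enum_val k : I).1 j))`_(enum_val k : I).2.

Lemma rem_coordM n m (M : 'M[L]_(p, n)) (N : 'M[A]_(n, m)) :
  rem_coord (M *m N^iota) = rem_coord M *m N.
Proof.
apply/matrixP => i j; rewrite !mxE (big_morph lrem (id1 := 0) (op1 := +%R)).
- by rewrite coef_sum; apply: eq_bigr => h _; rewrite !mxE (ldivZ _ _).2 coefMC.
- by move=> u v; rewrite (ldivD _ _).2.
- exact: lquo0.2.
Qed.

Lemma rem_basisE n (M : 'M[L]_(p, n)) :
  M = pl f *: quomx M + rem_basis *m (rem_coord M)^iota.
Proof.
apply/matrixP => i j; rewrite !mxE [LHS]ldiv_eq; congr (_ + _).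
under eq_bigr => k _ do rewrite !mxE -mulrA.
pose G (x : I) := (i == x.1)%:R * (X ^+ x.2 * laurentC (lrem (M x.1 j))`_x.2).
transitivity (\sum_x G x).
  rewrite (eq_bigr (fun x => G (x.1, x.2))) => [|[]//]; rewrite -(pair_bigA _ (fun a b => G (a, b))) (bigD1 i) //= [X in _ + X]big1 ?addr0; last first.
    by move=> a /negPf ai; apply: big1 => b _; rewrite /G /= eq_sym ai mul0r.
  have -> : lrem (M i j) = \poly_(b < (size f).-1) (lrem (M i j))`_b.
    apply/polyP => b; rewrite coef_poly; case: ltnP => // lb.
    rewrite nth_default // (leq_trans _ lb) // -ltnS prednK ?size_lrem //.
    by rewrite size_poly_gt0 monic_neq0.
  rewrite poly_def rmorph_sum; apply: eq_bigr => b _.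
  by rewrite /G /= eqxx mul1r -mul_polyC rmorphM rmorphXn mulrC.
by rewrite (reindex (@enum_val I predT)) //; apply: onW_bij; apply: enum_val_bij.
Qed.
End Remainder.
End LaurentDivision.

(** For an idempotent [E] this says that its image is free of rank r. *)
Definition splits (R : pzRingType) p (E : 'M[R]_p) := exists r (B : 'M[R]_(r, p)) (C : 'M[R]_(p, r)),
  C *m B = E /\ B *m C = 1%:M.

Lemma scalemxI (R : idomainType) m n (a : R) : a != 0 ->
  injective (fun M : 'M[R]_(m, n) => a *: M).
Proof.
move=> a0 M N /matrixP MN; apply/matrixP => i j; apply: (mulfI a0).
by have := MN i j; rewrite !mxE.
Qed.

(** * Images of idempotents over Laurent rings are stably free, hence free *)

Section StablyFree.
Variables (A : idomainType) (f : {poly A}).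
Local Notation L := (laurent A).
Local Notation X := (laurentX A).
Local Notation pl := (@laurent_poly A).
Hypothesis normA : normalizable A.
Hypotheses (mf : f \is monic) (uf : f`_0 \is a GRing.unit).
Variables (p r : nat) (E : 'M[L]_p) (B : 'M[L]_(r, p)) (C : 'M[L]_(p, r)).
Hypotheses (EE : E *m E = E) (BC : B *m C = (pl f)%:M) (CB : C *m B = pl f *: E).
Local Notation "N ^iota" := (map_mx (@laurentC A) N) (at level 2, format "N ^iota").
Local Notation quo := (quomx mf uf).
Local Notation sigma := (rem_coord mf uf).

Let f0 : pl f != 0.
Proof. by rewrite -(rmorph0 pl) (inj_eq (@laurent_poly_inj A)) monic_neq0. Qed.

Let EC : E *m C = C.
Proof.
by apply: (scalemxI f0); rewrite scalemxAl -CB -mulmxA BC mul_mx_scalar.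
Qed.

(* With M the image of E and N = C L^r inside M, the A-module M / N is the
   complement {m | quo (B m) = 0} of N, and D1 is the projection onto it. *)
Let D1 n (M : 'M[L]_(p, n)) := M - C *m quo (B *m M).
Let inQ n (M : 'M[L]_(p, n)) := E *m M = M /\ quo (B *m M) = 0.

Let D1Q n (M : 'M[L]_(p, n)) : E *m M = M -> inQ (D1 M).
Proof.
move=> EM; split; first by rewrite mulmxBr EM mulmxA EC.
rewrite mulmxBr mulmxA BC mul_scalar_mx.
move: (B *m M) => Z.
have -> : Z - pl f *: quo Z = map_mx (pl \o lrem mf uf) Z.
  apply/matrixP => i j; rewrite !mxE.
  by rewrite {1}(ldiv_eq mf uf (Z i j)) addrC addKr.
by apply/matrixP => i j; rewrite !mxE lquo_lrem.
Qed.

Let D1C n (U : 'M[L]_(r, n)) : D1 (C *m U) = 0.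
Proof. by rewrite /D1 mulmxA BC mul_scalar_mx quomxZ subrr. Qed.

Let D1id n (M : 'M[L]_(p, n)) : inQ M -> D1 M = M.
Proof. by move=> [_ qM]; rewrite /D1 qM mulmx0 subr0. Qed.

Let D1D n (M N : 'M[L]_(p, n)) : D1 (M + N) = D1 M + D1 N.
Proof. by rewrite /D1 mulmxDr quomxD mulmxDr opprD addrACA. Qed.

Let D1M n m (M : 'M[L]_(p, n)) (N : 'M[A]_(n, m)) : D1 (M *m N^iota) = D1 M *m N^iota.
Proof. by rewrite /D1 mulmxA quomxM mulmxA mulmxBl. Qed.

Let W0 := D1 (E *m rem_basis f p).
Let W0Q : inQ W0. Proof. by apply: D1Q; rewrite mulmxA EE. Qed.

(** Multiples of [f] in the image of [E] lie in N, because [C *m B = pl f *: E], and [D1] kills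
    them. So an element of the complement is determined by its remainder, which makes the complement
    a retract of a finite free [A]-module. *)
Let Wsigma n (M : 'M[L]_(p, n)) : inQ M -> M = W0 *m (sigma M)^iota.
Proof.
move=> QM; have [EM _] := QM; rewrite -[LHS]D1id // -[in LHS]EM.
rewrite {1}(rem_basisE mf uf M) mulmxDr -scalemxAr scalemxAl -CB -mulmxA D1D D1C add0r.
by rewrite mulmxA D1M.
Qed.

Let iotaM m n q (M : 'M[A]_(m, n)) (N : 'M[A]_(n, q)) : (M *m N)^iota = M^iota *m N^iota.
Proof. exact: map_mxM. Qed.

(** [W] generates the complement Q of N over [A], and [Eh] projects A^d onto a copy of Q. [Th] is
    multiplication by X on M / N read on that copy, and [C *m kappa] is the part of X W that falls
    into N. The last two clauses express that M is the direct sum of Q and N over [A]. *)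
Lemma stable_data : exists d (W : 'M[L]_(p, d)) (Eh Th : 'M[A]_d) (kappa : 'M[L]_(r, d))
    (S1 : 'M[A]_(d, p)) (S2 : 'M[L]_(r, p)),
  [/\ E *m W = W, W *m Eh^iota = W, Eh *m Th = Th & Th *m Eh = Th] /\
  [/\ Eh *m Eh = Eh, C *m kappa = X *: W - W *m Th^iota,
      W *m S1^iota + C *m S2 = E &
      forall n (a : 'M[A]_(d, n)) v, W *m a^iota + C *m v = 0 -> Eh *m a = 0 /\ v = 0].
Proof.
have [d [W [sg [WQ sgM sg0 Wsg]]]] : exists d (W : 'M[L]_(p, d))
    (sg : forall n, 'M[L]_(p, n) -> 'M[A]_(d, n)),
    [/\ inQ W, forall n m (M : 'M[L]_(p, n)) (N : 'M[A]_(n, m)), sg m (M *m N^iota) = sg n M *m N,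
      forall n, sg n 0 = 0 &
    forall n (M : 'M[L]_(p, n)), inQ M -> M = W *m (sg n M)^iota].
  exists #|{: 'I_p * 'I_(size f).-1}|, W0, (fun n => @rem_coord _ _ mf uf p n).
  split; [exact: W0Q | move=> n m M N; exact: rem_coordM | | exact: Wsigma].
  by move=> n; apply/matrixP => i j; rewrite !mxE (lquo0 mf uf).2 coef0.
have EW : E *m W = W by case: WQ.
have [Eh EhE] : exists Eh, Eh = sg _ W by eexists.
have XWQ : inQ (D1 (X *: W)) by apply: D1Q; rewrite -scalemxAr EW.
have EQ : inQ (D1 E) by apply: D1Q.
have [T TE] : exists T, T = sg _ (D1 (X *: W)) by eexists.
have WEh : W *m Eh^iota = W by rewrite EhE; apply/esym/Wsg.
have WT : W *m T^iota = D1 (X *: W) by rewrite TE; apply/esym/Wsg.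
exists d, W, Eh, T, (quo (B *m (X *: W))), (sg _ (D1 E)), (quo (B *m E)); split; split=> //.
- by rewrite {1}EhE -sgM WT TE.
- by rewrite {1}TE -sgM -D1M -scalemxAl WEh -TE.
- by rewrite {1}EhE -sgM WEh -EhE.
- by rewrite WT /D1 subKr.
- by rewrite -(Wsg _ _ EQ) /D1 subrK.
move=> n a v Wv.
have Wa : W *m a^iota = 0.
  have WaQ : inQ (W *m a^iota).
    by split; [rewrite mulmxA EW | rewrite mulmxA quomxM WQ.2 mul0mx].
  rewrite -(D1id WaQ); have := congr1 (@D1 _) Wv; rewrite D1D D1C addr0 => ->.
  by have := D1C (0 : 'M[L]_(r, n)); rewrite mulmx0.
split; first by rewrite EhE -sgM Wa.
apply: (scalemxI f0); rewrite scaler0 -mul_scalar_mx -BC -mulmxA.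
by move: Wv; rewrite Wa add0r => ->; rewrite mulmx0.
Qed.

(** [Psi] and [Phi] form an exact sequence from L^d to L^(d+r) to the image of [E], the
    characteristic sequence of [Th]. It splits since the image is projective, and
    [left_inverse_completion] turns the resulting complement of L^d into a free module. *)
Lemma stably_free_splits : splits E.
Proof.
have [d [W [Eh [Th [kappa [S1 [S2 [[EW WEh EhTh ThEh] [EhEh Ckappa WS WC0]]]]]]]]] := stable_data.
(* On the image of [Eh] the matrix [Y] is X - Th; on the complementary image of 1 - Eh it is the
   identity, so that free modules suffice in the sequence. *)
have [Y YE] : exists Y, Y = 1%:M - Eh^iota + X *: Eh^iota - Th^iota by eexists.
pose Phi := row_mx W C.
pose Psi := col_mx Y (- kappa).
pose S := col_mx S1^iota S2.
have PhiPsi : Phi *m Psi = 0.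
{ rewrite mul_row_col mulmxN Ckappa YE !mulmxDr !mulmxN mulmx1 WEh subrr add0r.
by rewrite -scalemxAr WEh subrr. }
have PhiS : Phi *m S = E by rewrite mul_row_col.
have EPhi : E *m Phi = Phi by rewrite mul_mx_row EW EC.
have YEh : Y *m Eh^iota = X *: Eh^iota - Th^iota.
  by rewrite YE !mulmxDl !mulNmx mul1mx -scalemxAl -!iotaM EhEh ThEh subrr add0r.
have EhY : Eh^iota *m Y = X *: Eh^iota - Th^iota.
  by rewrite YE !mulmxDr !mulmxN mulmx1 -scalemxAr -!iotaM EhEh EhTh subrr add0r.
have YEhC : Y *m (1%:M - Eh^iota) = 1%:M - Eh^iota.
  by rewrite mulmxBr mulmx1 YEh YE -[X in X - _]addrA addrK.
(* Modulo the columns of [Y], multiplication by X on the image of [Eh] is [Th], so induction on the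
   degree leaves only constants in that image. *)
have Y_span n s (a : 'M[{poly A}]_(d, n)) : (forall i j, size (a i j) <= s)%N ->
    exists b a0, map_mx pl a = Y *m b + Eh^iota *m a0^iota.
  elim: s a => [|s IH] a sa.
    have -> : a = 0 by apply/matrixP => i j; rewrite mxE; apply/eqP; rewrite -size_poly_leq0.
    by exists 0, 0; rewrite !map_mx0 !mulmx0 addr0.
  pose a1 := \matrix_(i, j) \poly_(h < s) (a i j)`_h.+1.
  pose a2 := \matrix_(i, j) (a i j)`_0.
  have [|b [c bc]] := IH a1; first by move=> i j; rewrite mxE size_poly.
  have aE : map_mx pl a = X *: map_mx pl a1 + a2^iota.
    apply/matrixP => i j; rewrite !mxE -[X in _ + X]/(pl _) -rmorphM -rmorphD; congr (pl _).
    apply/polyP => -[|h]; rewrite coefD coefC coefXM /= ?add0r // addr0 coef_poly.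
    by case: ltnP => // lesh; rewrite nth_default // (leq_trans (sa i j)).
  exists (X *: b + Eh^iota *m c^iota + (1%:M - Eh^iota) *m a2^iota), (Th *m c + a2).
  rewrite aE bc [in RHS]mulmxDr [in RHS]mulmxDr !mulmxA YEhC YEh -scalemxAr.
  rewrite map_mxD iotaM [in RHS]mulmxDr (mulmxA Eh^iota Th^iota) -(iotaM Eh Th) EhTh scalerDr.
  by rewrite !mulmxBl mul1mx -scalemxAl [RHS]addrACA subrK addrA subrK.
have kerPhi n (u : 'M[L]_(_, n)) : Phi *m u = 0 -> exists b, u = Psi *m b.
  move=> Pu; have [N [a aE]] := laurent_common (usubmx u).
  pose s := (\max_i size (a i.1 i.2))%N.
  have [|b [a0 ba]] := @Y_span n s a.
    by move=> i j; apply: (leq_bigmax (i, j)).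
  have e : X ^+ N *: u - Psi *m b = col_mx (Eh^iota *m a0^iota) (dsubmx (X ^+ N *: u - Psi *m b)).
    rewrite -[LHS]vsubmxK; congr col_mx.
    rewrite [LHS]linearB /= linearZ /= aE ba /Psi mul_col_mx col_mxKu.
    by rewrite addrC addKr.
  have : Phi *m (X ^+ N *: u - Psi *m b) = 0.
    by rewrite mulmxBr -scalemxAr Pu scaler0 mulmxA PhiPsi mul0mx subr0.
  move: (dsubmx _) e => v e; rewrite e mul_row_col mulmxA WEh => /WC0[Eha v0].
  move: e; rewrite -iotaM Eha v0 map_mx0 col_mx0 => /subr0_eq e.
  exists ((X ^- N) *: b); rewrite -scalemxAr -e scalerA mulVr ?scale1r //.
  by rewrite unitrX ?laurentX_unit.
(* A column killed by [Y] lies in the image of [Eh] and is killed by X - Th. The adjugate shows that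
   it is killed by the characteristic polynomial of [Th], which is monic. *)
have Y_inj n (a : 'M[L]_(_, n)) : Y *m a = 0 -> a = 0.
  move=> Ya.
  have aE : a = Eh^iota *m a.
    have : (1%:M - Eh^iota) *m (Y *m a) = 0 by rewrite Ya mulmx0.
    by rewrite mulmxA mulmxBl mul1mx EhY YE -[X in X - _]addrA addrK mulmxBl mul1mx => /subr0_eq.
  have : map_mx pl (char_poly_mx Th) *m a = 0.
    rewrite /char_poly_mx map_mxB map_scalar_mx /= -map_mx_comp mulmxBl mul_scalar_mx.
    by rewrite -[RHS]Ya [in RHS]aE mulmxA YEh mulmxBl -scalemxAl -aE.
  move/(congr1 (mulmx (\adj (map_mx pl (char_poly_mx Th))))).
  rewrite mulmx0 mulmxA mul_adj_mx det_map_mx mul_scalar_mx => e.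
  apply: (@scalemxI _ _ _ (pl (char_poly Th))); last by rewrite scaler0.
  by rewrite -(rmorph0 pl) (inj_eq (@laurent_poly_inj A)) monic_neq0 // char_poly_monic.
have [Psi' PP] : exists Psi', 1%:M - S *m Phi = Psi *m Psi'.
  by apply: kerPhi; rewrite mulmxBr mulmx1 mulmxA PhiS EPhi subrr.
have P'P : Psi' *m Psi = 1%:M.
  have : Psi *m (Psi' *m Psi - 1%:M) = 0.
    by rewrite mulmxBr mulmxA -PP mulmx1 mulmxBl mul1mx -mulmxA PhiPsi mulmx0 subr0 subrr.
  rewrite mul_col_mx -[RHS]col_mx0 => /eq_col_mx[/Y_inj /subr0_eq //].
have [G uG GP] := left_inverse_completion normA P'P.
pose H := invmx G.
have HG : lsubmx H *m usubmx G + rsubmx H *m dsubmx G = 1%:M.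
  by rewrite -mul_row_col hsubmxK vsubmxK mulVmx.
have HP : lsubmx H = Psi.
  rewrite -[RHS](mulKmx uG) GP -[invmx G]hsubmxK mul_row_col mulmx1 mulmx0 addr0 //.
have dGP : dsubmx G *m Psi = 0 by rewrite mul_dsub_mx GP col_mxKd.
have GH : dsubmx G *m rsubmx H = 1%:M.
  by rewrite mulmx_rsub mul_dsub_mx mulmxV // scalar_mx_block block_mxEv col_mxKd row_mxKr.
exists r, (dsubmx G *m S), (Phi *m rsubmx H); split.
  rewrite mulmxA -[X in X *m S]mulmxA.
  have -> : rsubmx H *m dsubmx G = 1%:M - Psi *m usubmx G.
    by rewrite -HG HP addrC addKr.
  by rewrite mulmxBr mulmx1 mulmxA PhiPsi mul0mx subr0 PhiS.
rewrite mulmxA -[X in X *m rsubmx H]mulmxA.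
have -> : S *m Phi = 1%:M - Psi *m Psi' by rewrite -PP subKr.
by rewrite mulmxBr mulmx1 mulmxA dGP mul0mx subr0.
Qed.
End StablyFree.

(** The lowest digit is divisible by K and smaller than K in absolute value, hence zero; then one
    divides by K. *)
Lemma digits_eq0 (K : nat) n (d : nat -> int) : (forall i, (i < n)%N -> `|d i| < K%:Z) ->
  \sum_(i < n) d i * K%:Z ^+ i = 0 -> forall i, (i < n)%N -> d i = 0.
Proof.
elim: n d => [//|n IH] d dK; rewrite big_ord_recl expr0 mulr1 => e.
pose s := \sum_(i < n) d i.+1 * K%:Z ^+ i.
have {}e : d 0%N + s * K%:Z = 0.
  rewrite -e /=; congr (_ + _); rewrite mulr_suml; apply: eq_bigr => i _.
  by rewrite -mulrA -exprSr.
have s0 : s = 0 by have := dK 0%N isT; move: e; nia.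
have d0 : d 0%N = 0 by rewrite s0 in e; lia.
move=> [//|i]; rewrite ltnS => lti.
by apply: (IH (fun j => d j.+1)) => // j ltj; apply: dK.
Qed.

Lemma seq_argmin (J : eqType) (s : seq J) (w : J -> int) : s != [::] ->
  exists2 j, j \in s & {in s, forall i, w j <= w i}.
Proof.
elim: s => [//|j s IH] _; have [->|/IH[i si wi]] := eqVneq s [::].
  by exists j; rewrite ?inE // => i; rewrite inE => /eqP ->.
have [ji|ij] := leP (w j) (w i).
  exists j; rewrite ?inE ?eqxx // => h; rewrite inE => /predU1P[->//|/wi].
  exact: le_trans.
exists i; rewrite ?inE ?si ?orbT // => h; rewrite inE => /predU1P[->|/wi//].
exact: ltW.
Qed.

(** With distinct exponents the extreme terms cannot cancel. Dividing by the lowest power of X and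
    by the coefficient of the highest one gives p. *)
Lemma bimonic_sum (A : idomainType) (J : eqType) (s : seq J) (w : J -> int) (a : J -> A) :
    s != [::] -> uniq s -> {in s &, injective w} -> {in s, forall j, a j \is a GRing.unit} ->
  exists (e : laurent A) (p : {poly A}),
    [/\ e \is a GRing.unit, p \is monic, p`_0 \is a GRing.unit &
        e * \sum_(j <- s) laurentC (a j) * laurentX A ^ w j = laurent_poly p].
Proof.
move=> s0 us wi ua.
have [j0 sj0 min0] := seq_argmin w s0.
have [j1 sj1 max1] := seq_argmin (fun j => - w j) s0.
pose d j := `|w j - w j0|%N.
have dE j : j \in s -> w j = w j0 + (d j)%:Z.
  by move/min0 => le; rewrite /d; lia.
have di : {in s &, injective d}.
  by move=> i j si sj e; apply: wi => //; rewrite dE // e -dE.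
pose p0 := \sum_(j <- s) (a j)%:P * 'X^(d j).
have p0E j : j \in s -> p0`_(d j) = a j.
  move=> sj; rewrite /p0 coef_sum (bigD1_seq j) //= coefCM coefXn eqxx mulr1.
  rewrite big_seq_cond big1 ?addr0 // => i /andP[si ij].
  by rewrite coefCM coefXn (inj_in_eq di) // eq_sym (negPf ij) mulr0.
have sp0 : size p0 = (d j1).+1.
  apply/eqP; rewrite eqn_leq; apply/andP; split.
    apply/leq_sizeP => i lti; rewrite /p0 coef_sum big1_seq // => j /= sj.
    rewrite coefCM coefXn gtn_eqF ?mulr0 //; apply: leq_ltn_trans lti.
    have := max1 j sj; rewrite lerN2 (dE _ sj) (dE _ sj1); lia.
  rewrite ltnNge; apply/negP => /leq_sizeP/(_ _ (leqnn _)).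
  by rewrite p0E // => a0; have := ua j1 sj1; rewrite a0 unitr0.
have u1 := ua j1 sj1; have uX := laurentX_unit A.
exists (laurentC (a j1)^-1 * laurentX A ^ (- w j0)), ((a j1)^-1%:P * p0); split.
- rewrite unitrM (unitrXz _ uX) andbT.
  by rewrite (rmorph_unit (@laurentC A)) // unitrV.
- by rewrite monicE mul_polyC lead_coefZ /lead_coef sp0 p0E // mulVr.
- rewrite coefCM unitrM unitrV u1 -[X in p0`_X](_ : d j0 = 0%N) ?p0E ?ua //.
  by rewrite /d subrr.
- rewrite rmorphM -mulrA; congr (_ * _); rewrite mulr_sumr rmorph_sum.
  apply: eq_big_seq => j sj; rewrite rmorphM rmorphXn mulrCA; congr (_ * _).
  by rewrite -exprzDr // (dE _ sj) addKr.
Qed.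

(** * Normalization by the substitutions x_i -> x_i X^(N_i) *)

Section Normalization.
Variables (k : fieldType) (n : nat).
Local Notation A := (lring k n).
Local Notation L := (lring k n.+1).
Local Notation X := (laurentX A).

Let twist_ex (N : nat -> int) : exists G : {rmorphism L -> L},
  [/\ forall c, G (lcst k n.+1 c) = lcst k n.+1 c,
      forall i, (i < n)%N -> G (laurentC (lvar k n i)) = laurentC (lvar k n i) * X ^ N i
    & G X = X].
Proof.
pose y i : L := if (i < n)%N then laurentC (lvar k n i) * X ^ N i else X.
have uy i : y i \is a GRing.unit.
  rewrite /y; case: ifP => _; rewrite ?unitrM ?laurentX_unit //.
  by rewrite unitrXz ?laurentX_unit // (rmorph_unit (@laurentC A)) ?lvar_unit.
have [|||G [Gc Gx _]] := @lring_ev k L (lcst k n.+1) y (fun i => (y i)^-1) n.+1.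
- by move=> c i; apply: mulrC.
- by move=> *; apply: mulrC.
- by move=> i _; rewrite divrr ?mulVr.
exists G; split=> // [i lti|].
  by have := Gx i; rewrite ltnS ltnW //= /y lti ltn_eqF // => ->.
by have := Gx n (ltnSn n); rewrite /= eqxx /y ltnn.
Qed.

Definition twist N : {rmorphism L -> L} := sval (cid (twist_ex N)).
Let twistc N c : twist N (lcst k n.+1 c) = lcst k n.+1 c.
Proof. by rewrite /twist; case: cid => G []. Qed.
Let twistx N i : (i < n)%N ->
  twist N (laurentC (lvar k n i)) = laurentC (lvar k n i) * X ^ N i.
Proof. by case: (svalP (cid (twist_ex N))) => _ H _; apply: H. Qed.
Let twistX N : twist N X = X.
Proof. by rewrite /twist; case: cid => G []. Qed.

Let uX := laurentX_unit A.

Let twistK N : cancel (twist N) (twist (fun i => - N i)).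
Proof.
move=> l; rewrite -[RHS]/(idfun l) -[LHS]/((twist (fun i => - N i) \o twist N) l).
apply: (@lring_rmorph_eq k L n.+1) => [c|i] /=; first by rewrite !twistc.
case: eqP => [_ _|ne]; first by rewrite !twistX.
rewrite ltnS leq_eqVlt => /predU1P[//|lti].
rewrite twistx // rmorphM twistx // rmorphXz // twistX -mulrA -exprzDr //.
by rewrite addNr expr0z mulr1.
Qed.

Lemma lring_normalizable : normalizable A.
Proof.
move=> f f0; have [s0 [c [us0 fE]]] := lring_uniq_span (f : L).
pose s := [seq u <- s0 | c u != 0].
have us : uniq s by rewrite filter_uniq.
have {}fE : f = \sum_(u <- s) lcst k n.+1 (c u) * lmon k u :> L.
  rewrite big_filter fE [RHS]big_mkcond; apply: eq_bigr => u _.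
  by case: eqP => [->|] //; rewrite [X in X * _]rmorph0 mul0r.
have sn : s != [::] by apply: contra_neq f0 => s0'; rewrite fE s0' big_nil.
pose h (u : 'cV[int]_n.+1) := (\max_(i < n.+1) `|u i 0%R|)%N.
pose b := (\max_(u <- s) h u)%N.
have ub u i : u \in s -> (`|u i 0%R| <= b)%N.
  move=> su; apply: leq_trans (_ : h u <= b)%N; last exact: (@leq_bigmax_seq _ s xpredT h u).
  exact: (@leq_bigmax _ (fun i => `|u i 0%R|%N) i).
(* Exponents of f differ by at most 2b < K. Under x_i -> x_i X^(K^(i+1)) the monomial x^u acquires
   the exponent [w u] in X, so uniqueness of signed base-K digits separates the monomials. *)
pose K := (b + b).+1.
pose w (u : 'cV[int]_n.+1) : int := u ord_max 0 + \sum_(i < n) u (widen_ord (leqnSn n) i) 0 * K%:Z ^+ i.+1.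
have wi : {in s &, injective w}.
  move=> u v su sv uv.
  pose z i : int := if i is j.+1 then u (inord j) 0 - v (inord j) 0 else u ord_max 0 - v ord_max 0.
  have z0 : forall i, (i < n.+1)%N -> z i = 0.
    apply: (@digits_eq0 K).
      move=> [|i] _; rewrite /z.
        by have := ub u ord_max su; have := ub v ord_max sv; rewrite /K; lia.
      by have := ub u (inord i) su; have := ub v (inord i) sv; rewrite /K; lia.
    transitivity (w u - w v); last by rewrite uv subrr.
    rewrite big_ord_recl /= mulr1 /w opprD addrACA -sumrB; congr (_ + _).
    apply: eq_bigr => i _.
    rewrite mulrBl; congr (u _ 0 * _ - v _ 0 * _);
      by apply: val_inj; rewrite /= add0n inordK // ltnS ltnW.
  apply/colP => i; apply/eqP; rewrite -subr_eq0; apply/eqP.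
  have [e|lti] := eqVneq (i : nat) n.
    by have := z0 0%N isT; rewrite (_ : i = ord_max) //; apply: val_inj.
  have {}lti : (i < n)%N by rewrite ltn_neqAle lti -ltnS ltn_ord.
  by have := z0 i.+1 lti; rewrite /z inord_val.
pose N i : int := K%:Z ^+ i.+1.
pose a (u : 'cV[int]_n.+1) : A := lcst k n (c u) * \prod_(i < n) lvar k n i ^ u (widen_ord (leqnSn n) i) 0.
have ua : {in s, forall u, a u \is a GRing.unit}.
  move=> u; rewrite mem_filter => /andP[cu _]; rewrite unitrM rmorph_unit ?unitfE //=.
  by apply: rpred_prod => i _; rewrite unitrXz ?lvar_unit.
have [e [p [ue mp up ep]]] := bimonic_sum sn us wi ua.
exists (twist N), (twist (fun i => - N i)), e, p; split=> //.
- have := twistK (fun i => - N i); rewrite (_ : (fun i => - - N i) = N) //.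
  by apply/funext => i; rewrite opprK.
split=> //; rewrite -ep fE rmorph_sum; congr (_ * _); apply: eq_bigr => u _.
rewrite rmorphM twistc /a rmorphM -mulrA; congr (_ * _).
rewrite /lmon rmorph_prod big_ord_recr /= eqxx rmorphXz // twistX.
rewrite /w addrC exprzDr // mulrA; congr (_ * _).
rewrite (big_morph (fun z : int => X ^ z) (id1 := 1) (op1 := *%R)) //; last first.
  by move=> z1 z2; rewrite exprzDr.
rewrite rmorph_prod -big_split; apply: eq_bigr => i _ /=.
rewrite ltn_eqF // rmorphXz ?(rmorph_unit (@laurentC A)) ?lvar_unit // twistx //.
rewrite exprMz_comm ?unitrXz ?(rmorph_unit (@laurentC A)) ?lvar_unit //; last exact: mulrC.
by rewrite exprz_exp [N i * _]mulrC [in RHS]rmorphXz ?lvar_unit.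
Qed.
End Normalization.

Lemma field_splits (F : fieldType) p (E : 'M[F]_p) : E *m E = E -> splits E.
Proof.
move=> EE; exists (\rank E), (row_base E), (col_base E); split; first exact: mulmx_base.
have H : col_base E *m (row_base E *m col_base E *m row_base E) =
  col_base E *m (1%:M *m row_base E).
  by rewrite mul1mx mulmx_base -(mulmxA (row_base E)) mulmx_base (mulmxA (col_base E)) mulmx_base.
by apply: (row_free_inj (row_base_free E)); apply: (row_full_inj (col_base_full E)).
Qed.

Lemma fraction_common (R : idomainType) m n (M : 'M[{fraction R}]_(m, n)) :
  exists (d : R) (N : 'M[R]_(m, n)), d != 0 /\
    FracField.tofrac d *: M = map_mx (@FracField.tofrac R) N.
Proof.
have fracE (x : {fraction R}) : exists nd : R * R, nd.2 != 0 /\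
    x * FracField.tofrac nd.2 = FracField.tofrac nd.1.
  elim/quotW: x => x; exists (frac x); split; first exact: denom_ratioP.
  apply/eqP; rewrite !piE /FracField.equivf /FracField.mulf.
  rewrite !numden_Ratio ?mulf_neq0 ?oner_eq0 ?denom_ratioP //.
  by rewrite !mulr1 mulrC.
have /choice[nd ndE] (x : 'I_m * 'I_n) := fracE (M x.1 x.2).
exists (\prod_x (nd x).2), (\matrix_(i, j) ((nd (i, j)).1 * \prod_(x | x != (i, j)) (nd x).2)).
split; first by apply/prodf_neq0 => x _; have [] := ndE x.
apply/matrixP => i j; rewrite !mxE tofracM; have [_ <-] := ndE (i, j).
by rewrite [in LHS](bigD1 (i, j)) //= [in LHS]tofracM [LHS]mulrC mulrA.
Qed.

(** The rank factorization over the fraction field, with the denominators of both factors collected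
    in f. *)
Lemma idempotent_generic (R : idomainType) p (E : 'M[R]_p) : E *m E = E ->
  exists r (B : 'M[R]_(r, p)) (C : 'M[R]_(p, r)) (f : R),
    [/\ f != 0, C *m B = f *: E & B *m C = f%:M].
Proof.
move=> EE; pose F := @FracField.tofrac R.
have inj m n (M N : 'M[R]_(m, n)) : map_mx F M = map_mx F N -> M = N.
  move=> /matrixP MN; apply/matrixP => i j; have := MN i j.
  by rewrite !mxE => /eqP; rewrite tofrac_eq => /eqP.
have [|r [B [C [CB BC]]]] := @field_splits _ _ (map_mx F E); first by rewrite -map_mxM EE.
have [b [B' [b0 eB]]] := fraction_common B; have [c [C' [c0 eC]]] := fraction_common C.
exists r, B', C', (c * b); split; first by rewrite mulf_neq0.
- apply: inj; rewrite map_mxM -eB -eC map_mxZ -CB.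
  by rewrite -scalemxAl -scalemxAr scalerA rmorphM.
- apply: inj; rewrite map_mxM -eB -eC map_scalar_mx.
  by rewrite -scalemxAl -scalemxAr scalerA BC scalemx1 mulrC rmorphM.
Qed.

Lemma splits_map (R S : pzRingType) (f : {rmorphism R -> S}) p (E : 'M[R]_p) :
  splits E -> splits (map_mx f E).
Proof.
move=> [r [B [C [CB BC]]]]; exists r, (map_mx f B), (map_mx f C).
by rewrite -!map_mxM CB BC map_mx1.
Qed.

(** The automorphism [g] turns the denominator f of a generic splitting into a monic polynomial with
    unit constant term, up to the unit [e], which is absorbed in [B]; then [stably_free_splits]
    applies. *)
Theorem swan (k : fieldType) n p (E : 'M[lring k n]_p) : E *m E = E -> splits E.
Proof.
case: n E => [|n] E EE; first exact: field_splits.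
have [r [B [C [f [f0 CB BC]]]]] := idempotent_generic EE.
have [g [h [e [P [gK _ ue [mP uP eP]]]]]] := @lring_normalizable k n f f0.
have -> : E = map_mx h (map_mx g E).
  by rewrite -map_mx_comp; apply/matrixP => i j; rewrite mxE /= gK.
apply: splits_map.
apply: (@stably_free_splits _ P (@lring_normalizable k n) mP uP _ _ _
  (e *: map_mx g B) (map_mx g C)).
- by rewrite -map_mxM EE.
- by rewrite -scalemxAl -map_mxM BC map_scalar_mx -eP scale_scalar_mx.
- by rewrite -scalemxAr -map_mxM CB map_mxZ scalerA eP.
Qed.

(** * Gelfand-Kirillov dimension *)

Section LinearSpan.
Variables (A : pzRingType) (N : lmodType A).
Implicit Types e : seq N.

Lemma lspanD e u v : lspan e u -> lspan e v -> lspan e (u + v).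
Proof.
move=> [c ->] [d ->]; exists (fun i => c i + d i).
by rewrite -big_split; apply: eq_bigr => i _; rewrite scalerDl.
Qed.

Lemma lspanZ e a u : lspan e u -> lspan e (a *: u).
Proof.
move=> [c ->]; exists (fun i => a * c i).
by rewrite scaler_sumr; apply: eq_bigr => i _; rewrite scalerA.
Qed.

Lemma lspan0 e : lspan e 0.
Proof. by exists (fun=> 0); rewrite big1 // => i _; rewrite scale0r. Qed.

Lemma lspan_sum e (I : Type) (s : seq I) (F : I -> N) :
  (forall i, lspan e (F i)) -> lspan e (\sum_(i <- s) F i).
Proof.
by move=> H; elim/big_ind: _ => //; [exact: lspan0 | exact: lspanD].
Qed.

Lemma mem_lspan e u : u \in e -> lspan e u.
Proof.
move=> ue; exists (fun i => if i == index u e then 1 else 0).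
have lt : (index u e < size e)%N by rewrite index_mem.
rewrite (bigD1 (Ordinal lt)) //= eqxx scale1r nth_index // big1 ?addr0 // => i ne.
by rewrite (negPf (_ : (i : nat) != index u e)) ?scale0r //; apply: contra_neq ne => ?; exact: val_inj.
Qed.

Lemma lspan_sub e e' u : {subset e <= e'} -> lspan e u -> lspan e' u.
Proof. by move=> ee' [c ->]; apply: lspan_sum => i; apply/lspanZ/mem_lspan/ee'/mem_nth. Qed.
End LinearSpan.

Section LinearDimension.
Variables (k : fieldType) (N : lmodType k).
Implicit Types (e z : seq N) (W : set N).

(* A matrix with more rows than columns has a nonzero row in its kernel. *)
Lemma size_independent e z : lin_independent z -> {in z, forall u, lspan e u} ->
  (size z <= size e)%N.
Proof.
move=> iz ze; rewrite leqNgt; apply/negP => lt.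
have /choice[c cE] (i : 'I_(size z)) : exists c : nat -> k, z`_i = \sum_(j < size e) c j *: e`_j.
  by apply: ze; apply: mem_nth.
pose C : 'M[k]_(size z, size e) := \matrix_(i, j) c i j.
have : kermx C != 0.
  rewrite kermx_eq0 -row_leq_rank -ltnNge; exact: leq_ltn_trans (rank_leq_col C) lt.
move=> /rowV0Pn[v /sub_kermxP vC v0].
case/negP: v0; apply/eqP/rowP => i; rewrite mxE.
pose d (n : nat) : k := if insub n is Some j then v 0 j else 0.
have dE (j : 'I_(size z)) : d j = v 0 j by rewrite /d valK.
rewrite -dE; apply: iz => //.
under eq_bigr => j _ do rewrite dE cE scaler_sumr.
rewrite exchange_big big1 // => j _ /=.
under eq_bigr => h _ do rewrite scalerA.
rewrite -scaler_suml; have /rowP/(_ j) := vC; rewrite !mxE => vCj.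
by rewrite [X in X *: _](_ : _ = 0) ?scale0r // -[RHS]vCj; apply: eq_bigr => h _; rewrite mxE.
Qed.

Lemma lspan_basis e : exists2 b, lin_independent b & lspan b = lspan e.
Proof.
pose P n := `[< exists b, [/\ size b = n, lin_independent b & {in b, forall u, lspan e u}] >].
have Pe n : P n -> (n <= size e)%N.
  by move=> /asboolP[b [<- ib be]]; apply: size_independent.
have P0 : exists n, P n by exists 0%N; apply/asboolP; exists [::]; split.
have /asboolP[b [sb ib be]] := xchooseP P0.
case: (ex_maxnP P0 Pe) => n /asboolP[{}b [{}sb {}ib {}be]] nmax.
exists b => //; apply/seteqP; split.
  by move=> u [c ->]; apply: lspan_sum => i; apply/lspanZ/be/mem_nth.
move=> u ue; apply: contrapT => ub.
have : P n.+1.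
  apply/asboolP; exists (rcons b u); split; first by rewrite size_rcons sb.
    move=> c; rewrite size_rcons big_ord_recr /= nth_rcons ltnn eqxx => c0.
    have cu : c (size b) = 0.
      apply/eqP/negP => /negP cn; apply: ub.
      have -> : u = - (c (size b))^-1 *: \sum_(i < size b) c i *: (rcons b u)`_i.
        apply: (scalerI cn).
        rewrite scalerA mulrN divff // scaleN1r; apply/eqP; rewrite -addr_eq0 addrC.
        exact/eqP.
      apply: lspanZ; apply: lspan_sum => i; apply: lspanZ.
      by rewrite nth_rcons ltn_ord; apply/mem_lspan/mem_nth.
    move: c0; rewrite cu scale0r addr0.
    under eq_bigr => i _ do rewrite nth_rcons ltn_ord.
    move=> /ib c0 i; rewrite ltnS leq_eqVlt => /predU1P[->//|]; exact: c0.
  by move=> v; rewrite mem_rcons inE => /predU1P[->|/be].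
by move/nmax; rewrite ltnn.
Qed.

Lemma ldim_ge e z : lin_independent z -> {in z, forall u, lspan e u} ->
  (size z <= ldim (lspan e))%N.
Proof.
move=> iz ze; rewrite /ldim; case: xgetP => [d _ [b [<- ib be]]|].
  by apply: size_independent => // u uz; rewrite be; apply: ze.
by have [b ib be] := lspan_basis e => /(_ (size b)) []; exists b.
Qed.
End LinearDimension.

Section Growth.
Local Notation R := Rdefinitions.R.
Variables (k : fieldType) (D : pzRingType) (f : {rmorphism k -> D}) (M : lmodType D).

(** As the limsup is at most n0, the ratio of logarithms is eventually below n0 + 1/2; squaring
    makes the exponents integers. *)
Lemma gkdim_growth (n0 : nat) (V : seq D) (F : seq M) :
    (gkdim f M <= (n0%:R : R)%:E)%E ->
  exists N, forall n, (N <= n)%N -> (1 < n)%N -> (0 < gk_growth f V F n)%N ->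
    (gk_growth f V F n ^ 2 < n ^ (n0.*2.+1))%N.
Proof.
move=> gk; set u := gk_growth f V F.
pose w n : \bar R := (ln (u n)%:R / ln n%:R : R)%:E.
have : (limn_esup w < (n0%:R + 2^-1 : R)%:E)%E.
  apply: (@le_lt_trans _ _ (n0%:R : R)%:E); last by rewrite lte_fin; lra.
  apply: le_trans gk; apply: ereal_sup_ubound; exists (V, F) => //.
rewrite /limn_esup /limf_esup => /ereal_inf_lt[_ [B [N _ NB] <-] wB].
exists N => n Nn n1 un.
have : (w n < (n0%:R + 2^-1 : R)%:E)%E.
  by apply: le_lt_trans wB; apply: ereal_sup_ubound; exists n => //; apply: NB.
rewrite /w lte_fin.
have n1' : (1 : R) < n%:R by rewrite ltr1n.
have ln0 : 0 < ln (n%:R : R) by rewrite ln_gt0.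
rewrite ltr_pdivrMr // => lnu.
have un0 : (0 : R) < (u n)%:R by rewrite ltr0n.
have nn0 : (0 : R) < n%:R by lra.
rewrite -(ltr_nat R) !natrX -ltr_ln ?posrE ?exprn_gt0 // !lnXn //.
have e : (n0.*2.+1)%:R = 2 * n0%:R + 1 :> R by rewrite -addn1 natrD -mul2n natrM.
rewrite -[X in X < _]mulr_natl -[X in _ < X]mulr_natl e.
move: (ln _) (ln _) (n0%:R) lnu ln0 => x y c; lra.
Qed.

Lemma gk_wordsS V (F : seq M) n a x : a \in 1 :: V -> x \in gk_words (1 :: V) F n ->
  a *: x \in gk_words (1 :: V) F n.+1.
Proof. by move=> aV xn; apply/allpairsP; exists (a, x). Qed.

Lemma gk_words_prod V (m : M) s : {subset s <= V} ->
  (\prod_(d <- s) d) *: m \in gk_words (1 :: V) [:: m] (size s).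
Proof.
elim: s => [|d s IH] sV; first by rewrite big_nil scale1r mem_head.
rewrite big_cons -scalerA; apply: gk_wordsS.
  by rewrite inE (sV d) ?mem_head ?orbT.
by apply: IH => x xs; apply: sV; rewrite inE xs orbT.
Qed.

Lemma gk_words_le V (F : seq M) n m x : (n <= m)%N ->
  x \in gk_words (1 :: V) F n -> x \in gk_words (1 :: V) F m.
Proof.
move=> /subnK <-; elim: (m - n)%N => [//|h IH] xn.
by rewrite addSn -[x]scale1r; apply: gk_wordsS; rewrite ?mem_head ?IH.
Qed.

(** Independent vectors indexed by [I K] would force K^(2 n0 + 2) <= growth^2 < (C K)^(2 n0 + 1),
    which fails once K is at least C^(2 n0 + 1). *)
Lemma gk_dependent (n0 C : nat) (V : seq D) (m : M) (I : nat -> finType)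
    (z : forall K, I K -> M) :
    (gkdim f M <= (n0%:R : R)%:E)%E -> (0 < C)%N ->
    (forall K, K ^ n0.+1 <= #|I K|)%N ->
    (forall K i, z K i \in gk_words (1 :: V) [:: m] (C * K)) ->
  exists K0, forall K, (K0 <= K)%N -> exists c : I K -> k,
    (exists i, c i != 0) /\ \sum_i f (c i) *: z K i = 0.
Proof.
move=> gk C0 cI zw; have [N gN] := gkdim_growth V [:: m] gk.
exists (N + (C ^ (n0.*2.+1)).+2)%N => K leK; apply: contrapT => /forallNP dep.
pose e : seq (pullback f M) := [seq z K i | i <- enum (I K)].
have se : size e = #|I K| by rewrite size_map -cardE.
have ie : lin_independent e.
  move=> c c0 j; rewrite se => ltj; apply/eqP/negP => /negP cj.
  apply: (dep (fun i => c (enum_rank i))); split.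
    by exists (enum_val (Ordinal ltj)); rewrite enum_valK.
  rewrite -[RHS]c0 (reindex (@enum_val (I K) predT)); last first.
    exact/onW_bij/enum_val_bij.
  rewrite se; apply: eq_bigr => h _; rewrite enum_valK.
  have -> : e`_h = z K (enum_val h).
    rewrite (nth_map (enum_val h)); last by have := ltn_ord h; rewrite [X in (_ < X)%N]cardE.
    by rewrite [in RHS](enum_val_nth (enum_val h)).
  by [].
have := @ldim_ge k (pullback f M) (gk_words (1 :: V) [:: m] (C * K)) e ie.
move=> /(_ _)/(leq_trans _) H.
have {}H : (K ^ n0.+1 <= gk_growth f V [:: m] (C * K))%N.
  apply: H; first by rewrite se.
  by move=> u /mapP[i _ ->]; apply: mem_lspan.
have K0 : (0 < K)%N by lia.
have CK : (K <= C * K)%N by rewrite leq_pmull.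
have := gN (C * K)%N _ _ _.
move=> /(_ _ _ _) gr.
have : (gk_growth f V [:: m] (C * K) ^ 2 < (C * K) ^ (n0.*2.+1))%N.
  by apply: gr; [lia | lia | apply: leq_trans H; rewrite expn_gt0 K0].
apply/negP; rewrite -leqNgt; apply: (@leq_trans ((K ^ n0.+1) ^ 2)); last by rewrite leq_exp2r.
rewrite expnMn -expnM; apply: (@leq_trans (K * K ^ n0.*2.+1)).
  by rewrite leq_mul2r; apply/orP; right; lia.
by rewrite -expnS; apply: leq_pexp2l => //; lia.
Qed.
End Growth.

(** * Monomials and shears of the quantum torus *)

Lemma lattice_ind n (P : 'cV[int]_n -> Prop) : P 0 ->
  (forall u v, P u -> P v -> P (u + v)) ->
  (forall i, P (delta_mx i 0) /\ P (- delta_mx i 0)) -> forall v, P v.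
Proof.
move=> P0 PD Pe v; rewrite (matrix_sum_delta v).
apply: (big_ind P) => // i _; rewrite big_ord1.
have [Pi Ni] := Pe i.
have Pn (m : nat) (u : 'cV[int]_n) : P u -> P (m%:Z *: u).
  move=> Pu; elim: m => [|m IH]; first by rewrite scale0r.
  by rewrite -[m.+1]addn1 PoszD scalerDl scale1r; apply: PD.
case: (v i 0) => m; first exact: Pn.
by rewrite NegzE scaleNr -scalerN; apply: Pn.
Qed.

Section QuantumTorusTheory.
Variables (r : nat) (k : fieldType) (q : k).
Hypothesis q_neq0 : q != 0.
Local Notation D := (qtorus r q).
Local Notation sc := (qscal r q).

Lemma scC c (d : D) : sc c * d = d * sc c.
Proof. exact: pscal_central. Qed.
Lemma scC_comm c (d : D) : GRing.comm d (sc c).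
Proof. by rewrite /GRing.comm scC. Qed.
Lemma scCA (d : D) c e : d * (sc c * e) = sc c * (d * e).
Proof. by rewrite !mulrA scC. Qed.

Lemma act_ex n (y y' : 'I_n -> D) :
    (forall i j, y i * y j = y j * y i) ->
    (forall i, y i * y' i = 1 /\ y' i * y i = 1) ->
  exists G : {rmorphism lring k n -> D},
    [/\ forall c, G (lcst k n c) = sc c, forall i : 'I_n, G (lvar k n i) = y i &
      forall d, (forall i, d * y i = y i * d) -> forall l, d * G l = G l * d].
Proof.
move=> yC yV; pose ext (z : 'I_n -> D) (i : nat) := if insub i is Some j then z j else 1.
have extE z (i : 'I_n) : ext z i = z i by rewrite /ext valK.
have [|||G [Gc Gx GC]] := @lring_ev k D sc (ext y) (ext y') n.
- by move=> c i; apply: scC_comm.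
- by move=> i j lti ltj; rewrite -[i]/(val (Ordinal lti)) -[j]/(val (Ordinal ltj)) !extE; apply: yC.
- by move=> i lti; rewrite -[i]/(val (Ordinal lti)) !extE.
exists G; split=> [//|i|d dy l]; first by rewrite Gx // extE.
apply: GC => [c|i lti]; first exact: scC_comm.
by rewrite -[i]/(val (Ordinal lti)) extE; apply: dy.
Qed.

Lemma zpow_rmorph n (G : {rmorphism lring k n -> D}) (y y' : D) (i : 'I_n) z :
  G (lvar k n i) = y -> y * y' = 1 -> zpow y y' z = G (lvar k n i ^ z).
Proof.
move=> <- yy'; have Gi : G (lvar k n i)^-1 = y'.
  by rewrite -[LHS]mulr1 -yy' mulrA -rmorphM mulVr ?lvar_unit // rmorph1 mul1r.
case: z => m /=; first by rewrite rmorphXn.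
by rewrite NegzE -invr_expz -exprVn rmorphXn Gi.
Qed.

Let rel_eq s t : @qrel r k q s t -> pclass (@qrel r k q) s = pclass (@qrel r k q) t.
Proof. by move=> st; apply/pclassP/acong_rel. Qed.
Let mulE s t : pclass (@qrel r k q) s * pclass (@qrel r k q) t = pclass (@qrel r k q) (EMul s t).
Proof. exact: pmulE. Qed.

Lemma qxV_inv i : qx q i * qxV q i = 1 /\ qxV q i * qx q i = 1 :> D.
Proof. by split; rewrite [LHS]mulE; apply: rel_eq; constructor. Qed.
Lemma qTV_inv i : qT q i * qTV q i = 1 /\ qTV q i * qT q i = 1 :> D.
Proof. by split; rewrite [LHS]mulE; apply: rel_eq; constructor. Qed.
Lemma qxC i j : qx q i * qx q j = qx q j * qx q i :> D.
Proof. by rewrite [LHS]mulE [RHS]mulE; apply: rel_eq; constructor. Qed.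
Lemma qTC i j : qT q i * qT q j = qT q j * qT q i :> D.
Proof. by rewrite [LHS]mulE [RHS]mulE; apply: rel_eq; constructor. Qed.
Lemma qTx i j : qT q i * qx q j = sc (q ^+ (i == j)) * (qx q j * qT q i) :> D.
Proof.
rewrite [LHS]mulE [X in _ * X]mulE [RHS]mulE; apply: rel_eq; constructor.
Qed.

Definition actx : {rmorphism lring k r -> D} := sval (cid (act_ex qxC qxV_inv)).
Definition actT : {rmorphism lring k r -> D} := sval (cid (act_ex qTC qTV_inv)).

Lemma actxc c : actx (lcst k r c) = sc c.
Proof. by case: (svalP (cid (act_ex qxC qxV_inv))) => H _ _; apply: H. Qed.
Lemma actxx (i : 'I_r) : actx (lvar k r i) = qx q i.
Proof. by case: (svalP (cid (act_ex qxC qxV_inv))) => _ H _; apply: H. Qed.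
Lemma actTT (i : 'I_r) : actT (lvar k r i) = qT q i.
Proof. by case: (svalP (cid (act_ex qTC qTV_inv))) => _ H _; apply: H. Qed.

(* Locked because conversion would otherwise unfold [qmono] down to raw quotient terms. *)
Definition qmon (a b : 'cV[int]_r) : D := locked (qmono (col_mx a b)).

Lemma qmono_col a b : qmono (col_mx a b) = qmon a b.
Proof. by rewrite /qmon -lock. Qed.

Lemma qmonE a b : qmon a b = actx (lmon k a) * actT (lmon k b).
Proof.
rewrite -qmono_col /qmono /lmon !rmorph_prod; congr (_ * _); apply: eq_bigr => i _.
  by rewrite col_mxEu; apply: zpow_rmorph; rewrite ?actxx // (qxV_inv i).1.
by rewrite col_mxEd; apply: zpow_rmorph; rewrite ?actTT // (qTV_inv i).1.
Qed.

Lemma qmon00 : qmon 0 0 = 1.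
Proof. by rewrite qmonE !lmon0 !rmorph1 mulr1. Qed.

Lemma qmonx i : qmon (delta_mx i 0) 0 = qx q i.
Proof. by rewrite qmonE lmon_delta lmon0 rmorph1 mulr1 actxx. Qed.
Lemma qmonT i : qmon 0 (delta_mx i 0) = qT q i.
Proof. by rewrite qmonE lmon_delta lmon0 rmorph1 mul1r actTT. Qed.

Lemma qmonxV i : qmon (- delta_mx i 0) 0 = qxV q i.
Proof.
rewrite -[LHS]mulr1 -(qxV_inv i).1 mulrA -qmonx !qmonE lmon0 rmorph1 !mulr1.
by rewrite -rmorphM lmonN rmorph1 mul1r.
Qed.
Lemma qmonTV i : qmon 0 (- delta_mx i 0) = qTV q i.
Proof.
rewrite -[LHS]mulr1 -(qTV_inv i).1 mulrA -qmonT !qmonE lmon0 rmorph1 !mul1r.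
by rewrite -rmorphM lmonN rmorph1 mul1r.
Qed.

Lemma dotzC n (u v : 'cV[int]_n) : dotz u v = dotz v u.
Proof. by apply: eq_bigr => i _; apply: mulrC. Qed.
Lemma dotzDl n (u v w : 'cV[int]_n) : dotz (u + v) w = dotz u w + dotz v w.
Proof. by rewrite /dotz -big_split; apply: eq_bigr => i _ /=; rewrite mxE mulrDl. Qed.
Lemma dotzDr n (u v w : 'cV[int]_n) : dotz w (u + v) = dotz w u + dotz w v.
Proof. by rewrite !(dotzC w) dotzDl. Qed.
Lemma dotzNl n (u w : 'cV[int]_n) : dotz (- u) w = - dotz u w.
Proof. by rewrite /dotz -sumrN; apply: eq_bigr => i _ /=; rewrite mxE mulNr. Qed.
Lemma dotzNr n (u w : 'cV[int]_n) : dotz w (- u) = - dotz w u.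
Proof. by rewrite !(dotzC w) dotzNl. Qed.
Lemma dotz0l n (w : 'cV[int]_n) : dotz 0 w = 0.
Proof. by apply: big1 => i _; rewrite mxE mul0r. Qed.
Lemma dotz0r n (w : 'cV[int]_n) : dotz w 0 = 0.
Proof. by rewrite dotzC dotz0l. Qed.
Lemma dotz_delta n (i : 'I_n) (w : 'cV[int]_n) : dotz (delta_mx i 0) w = w i 0.
Proof.
rewrite /dotz (bigD1 i) //= mxE !eqxx mul1r big1 ?addr0 // => j /negPf ji.
by rewrite mxE ji mul0r.
Qed.

Lemma qcomm_inv (t z z' : D) (m : int) : z * z' = 1 -> z' * z = 1 ->
  t * z = sc (q ^ m) * (z * t) -> t * z' = sc (q ^ (- m)) * (z' * t).
Proof.
move=> zz' z'z tz; have : z' * (t * z) * z' = z' * (sc (q ^ m) * (z * t)) * z' by rewrite tz.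
rewrite -!mulrA zz' mulr1 scCA !mulrA -[_ * z' * z]mulrA z'z mulr1 => e.
by rewrite -[_ * z' * t]mulrA e !mulrA -rmorphM -expfzDr // addNr expr0z rmorph1 mul1r.
Qed.

(** The relation is multiplicative in a and in b and passes to inverses, so it only has to be
    checked on generators. *)
Lemma qmon_comm (a b : 'cV[int]_r) :
  actT (lmon k b) * actx (lmon k a) = sc (q ^ dotz b a) * (actx (lmon k a) * actT (lmon k b)).
Proof.
have inv (G : {rmorphism lring k r -> D}) (u : 'cV_r) : G (lmon k u) * G (lmon k (- u)) = 1 /\ G (lmon k (- u)) * G (lmon k u) = 1.
  by rewrite -!rmorphM -!lmonD subrr addNr lmon0 rmorph1.
pose P (b a : 'cV[int]_r) :=
  actT (lmon k b) * actx (lmon k a) = sc (q ^ dotz b a) * (actx (lmon k a) * actT (lmon k b)).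
have P0r b' : P b' 0 by rewrite /P lmon0 dotz0r expr0z !rmorph1 mul1r mulr1 mul1r.
have P0l a' : P 0 a' by rewrite /P lmon0 dotz0l expr0z !rmorph1 mul1r mulr1 mul1r.
have PDr b' u v : P b' u -> P b' v -> P b' (u + v).
  rewrite /P => Pu Pv; rewrite lmonD dotzDr rmorphM mulrA Pu -!mulrA Pv scCA !mulrA.
  by rewrite -rmorphM -expfzDr.
have PDl a' u v : P u a' -> P v a' -> P (u + v) a'.
  rewrite /P => Pu Pv; rewrite lmonD dotzDl rmorphM -mulrA Pv scCA [actT _ * (actx _ * _)]mulrA Pu !mulrA.
  by rewrite -rmorphM -expfzDr // addrC.
have PNr b' u : P b' u -> P b' (- u).
  by move=> Pu; rewrite /P dotzNr; have [i1 i2] := inv actx u; apply: qcomm_inv Pu.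
have PNl a' u : P u a' -> P (- u) a'.
  rewrite /P => Pu; have [i1 i2] := inv actT u; rewrite dotzNl.
  have := @qcomm_inv (actx (lmon k a')) _ _ (- dotz u a') i1 i2.
  rewrite opprK => -> ; first by rewrite mulrA -rmorphM -expfzDr // addNr expr0z rmorph1 mul1r.
  by rewrite Pu mulrA -rmorphM -expfzDr // addNr expr0z rmorph1 mul1r.
apply: (lattice_ind (P := P b)) => // [u v|i]; first exact: PDr.
suff Pi : P b (delta_mx i 0) by split=> //; apply: PNr.
apply: (lattice_ind (P := fun b => P b (delta_mx i 0))) => // [u v|j]; first exact: PDl.
suff Pj : P (delta_mx j 0) (delta_mx i 0) by split=> //; apply: PNl.
rewrite /P !lmon_delta actxx actTT qTx dotz_delta mxE eqxx andbT.
by congr (sc _ * _); rewrite eq_sym; case: eqP.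
Qed.

Lemma qmonM a b a' b' :
  qmon a b * qmon a' b' = sc (q ^ dotz b a') * qmon (a + a') (b + b').
Proof.
rewrite !qmonE mulrA -[_ * _ * actx _]mulrA qmon_comm scCA !lmonD !rmorphM -!mulrA; congr (_ * _).
Qed.
End QuantumTorusTheory.

Section LMap.
Variables (k : fieldType) (n r : nat) (J : 'M[int]_(r, n)).

Lemma lmap_ex : exists G : {rmorphism lring k n -> lring k r},
  (forall c, G (lcst k n c) = lcst k r c) /\
  forall i : 'I_n, G (lvar k n i) = lmon k (J *m delta_mx i 0).
Proof.
pose e (i : nat) : 'cV[int]_r := if insub i is Some j then J *m delta_mx (j : 'I_n) 0 else 0.
have [|||G [Gc Gx _]] := @lring_ev k (lring k r) (lcst k r)
  (fun i => lmon k (e i)) (fun i => lmon k (- e i)) n.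
- by move=> c i; apply: mulrC.
- by move=> *; apply: mulrC.
- by move=> i _; rewrite mulrC lmonN.
by exists G; split=> // i; rewrite Gx // /e valK.
Qed.

Definition lmap : {rmorphism lring k n -> lring k r} := sval (cid lmap_ex).

Lemma lmap_cst c : lmap (lcst k n c) = lcst k r c.
Proof. by case: (svalP (cid lmap_ex)) => H _; apply: H. Qed.

Lemma lmap_mon a : lmap (lmon k a) = lmon k (J *m a).
Proof.
have H (i : 'I_n) : lmap (lmon k (delta_mx i 0)) = lmon k (J *m delta_mx i 0).
  by rewrite lmon_delta; case: (svalP (cid lmap_ex)) => _; apply.
apply: (lattice_ind (P := fun a => lmap (lmon k a) = lmon k (J *m a))).
- by rewrite mulmx0 !lmon0 rmorph1.
- by move=> u v eu ev; rewrite lmonD rmorphM eu ev mulmxDr lmonD.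
move=> i; split=> //; apply: (mulIr (lmon_unit k (J *m delta_mx i 0))).
by rewrite -{1}H -rmorphM lmonN rmorph1 mulmxN lmonN.
Qed.
End LMap.

Section Shear.
Variables (r : nat) (k : fieldType) (q : k).
Hypothesis q_neq0 : q != 0.
Local Notation D := (qtorus r q).
Local Notation sc := (qscal r q).
Local Notation U := (@qmon r k q).

Lemma qtorus_rmorph_eq (B : pzRingType) (g h : {rmorphism D -> B}) :
  (forall c, g (sc c) = h (sc c)) -> (forall i, g (qx q i) = h (qx q i)) ->
  (forall i, g (qT q i) = h (qT q i)) -> g =1 h.
Proof.
move=> gc gx gT d; have [t ->] := pclassE d.
have inv (x y : D) : x * y = 1 /\ y * x = 1 -> g x = h x -> g y = h y.
  move=> [xy yx] e; rewrite -[LHS]mulr1 -[1](rmorph1 h) -xy rmorphM -e mulrA -rmorphM yx.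
  by rewrite rmorph1 mul1r.
elim: t => [c|[i|i|i|i]|s IHs t IHt|s IHs t IHt].
- exact: gc.
- exact: gx.
- exact: inv (qxV_inv q i) (gx i).
- exact: gT.
- exact: inv (qTV_inv q i) (gT i).
- have -> : pclass (@qrel r k q) (EAdd s t) = (pclass (@qrel r k q) s : D) + pclass (@qrel r k q) t.
    by rewrite [RHS]paddE.
  by rewrite !rmorphD IHs IHt.
- have -> : pclass (@qrel r k q) (EMul s t) = (pclass (@qrel r k q) s : D) * pclass (@qrel r k q) t.
    by rewrite [RHS]pmulE.
  by rewrite !rmorphM IHs IHt.
Qed.

Lemma qshear_ex (S : 'M[int]_r) : S^T = S -> exists h : {rmorphism D -> D},
  [/\ forall c, h (sc c) = sc c, forall i, h (qx q i) = U (delta_mx i 0) (S *m delta_mx i 0)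
    & forall i, h (qT q i) = qT q i].
Proof.
move=> symS; pose y i := U (delta_mx i 0) (S *m delta_mx i 0).
have dotS (i j : 'I_r) : dotz (S *m delta_mx i 0) (delta_mx j 0) = S j i.
  by rewrite dotzC dotz_delta -colE mxE.
(* The scalar compensates U (e, S e) U (-e, - S e) = q^(- S_ii), where e is the i-th unit vector. *)
pose y' i := sc (q ^ S i i) * U (- delta_mx i 0) (- (S *m delta_mx i 0)).
pose g (x : qgen r) : D := match x with
  | GX i => y i | GXinv i => y' i | GT i => qT q i | GTinv i => qTV q i end.
have [h [[hB hM hc hg] _]] : exists! h : D -> D,
    [/\ zmod_morphism h, monoid_morphism h,
        forall a, h (pscal (@qrel r k q) a) = sc a & forall x, h (pgen (@qrel r k q) x) = g x].
  apply: palg_universal; first by move=> a b; apply: scC.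
  move=> _ _ [] /= => [i|i|i|i|i j|i j|i j].
  - rewrite /y /y' scCA qmonM // !subrr qmon00 mulr1 dotzNr dotS -rmorphM -expfzDr //.
    by rewrite subrr expr0z rmorph1.
  - rewrite /y /y' -mulrA qmonM // !addNr qmon00 mulr1 dotzNl dotS -rmorphM -expfzDr //.
    by rewrite subrr expr0z rmorph1.
  - exact: (qTV_inv q i).1.
  - exact: (qTV_inv q i).2.
  (* The images of the x_i commute precisely because [S] is symmetric. *)
  - rewrite /y !qmonM // !dotS addrC [S *m _ + _]addrC.
    by rewrite -[in S j i]symS mxE.
  - exact: qTC.
  - rewrite /y -qmonT !qmonM // dotz_delta dotz0r expr0z rmorph1 mul1r mxE eqxx andbT.
    rewrite addr0 add0r [_ + S *m _]addrC; congr (sc _ * _).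
    by rewrite eq_sym; case: eqP.
pose h' : {rmorphism D -> D} := HB.pack h
  (GRing.isZmodMorphism.Build _ _ h hB) (GRing.isMonoidMorphism.Build _ _ h hM).
exists h'; split; first exact: hc.
- by move=> i; apply: (hg (GX i)).
- by move=> i; apply: (hg (GT i)).
Qed.

(** The identity is a default value for nonsymmetric [S], so that no proof of symmetry has to be
    carried in the term. *)
Definition qshear (S : 'M[int]_r) : {rmorphism D -> D} :=
  if pselect (S^T = S) is left symS then sval (cid (qshear_ex symS)) else idfun.

Section Symmetric.
Variable S : 'M[int]_r.
Hypothesis symS : S^T = S.

Let qshearP : [/\ forall c, qshear S (sc c) = sc c,
    forall i, qshear S (qx q i) = U (delta_mx i 0) (S *m delta_mx i 0)
  & forall i, qshear S (qT q i) = qT q i].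
Proof. by rewrite /qshear; case: pselect => // e; exact: svalP (cid (qshear_ex e)). Qed.

Lemma qshearc c : qshear S (sc c) = sc c. Proof. by case: qshearP. Qed.
Lemma qshearx i : qshear S (qx q i) = U (delta_mx i 0) (S *m delta_mx i 0).
Proof. by case: qshearP. Qed.
Lemma qshearT i : qshear S (qT q i) = qT q i. Proof. by case: qshearP. Qed.

Lemma qshear_mon0 b : qshear S (U 0 b) = U 0 b.
Proof.
have H i : qshear S (U 0 (delta_mx i 0)) = U 0 (delta_mx i 0).
  by rewrite qmonT qshearT.
apply: (lattice_ind (P := fun b => qshear S (U 0 b) = U 0 b)); first by rewrite qmon00 rmorph1.
- move=> u v eu ev; have := qmonM q_neq0 0 u 0 v.
  by rewrite dotz0r expr0z rmorph1 mul1r addr0 => <-; rewrite rmorphM eu ev.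
move=> i; split=> //.
have i1 : U 0 (- delta_mx i 0) * U 0 (delta_mx i 0) = 1.
  by rewrite qmonM // dotz0r expr0z rmorph1 mul1r addr0 addNr qmon00.
have i2 : U 0 (delta_mx i 0) * U 0 (- delta_mx i 0) = 1.
  by rewrite qmonM // dotz0r expr0z rmorph1 mul1r addr0 subrr qmon00.
by rewrite -[LHS]mulr1 -i2 mulrA -H -rmorphM i1 rmorph1 mul1r.
Qed.

Lemma qshear_mon a b : exists2 c, c != 0 & qshear S (U a b) = sc c * U a (b + S *m a).
Proof.
have scn c c' : c != 0 -> c' != 0 -> c * c' != 0 :> k by move=> *; rewrite mulf_neq0.
have qn z : q ^ z != 0 by rewrite expfz_neq0.
have split a' b' : U a' b' = U a' 0 * U 0 b'.
  by rewrite qmonM // dotz0l expr0z rmorph1 mul1r addr0 add0r.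
suff [c c0 e] : exists2 c, c != 0 & qshear S (U a 0) = sc c * U a (S *m a).
  rewrite split rmorphM e qshear_mon0 -mulrA qmonM // addr0 [S *m a + b]addrC.
  by exists (c * q ^ dotz (S *m a) 0); rewrite ?(scn, qn) // mulrA -rmorphM.
apply: (lattice_ind (P := fun a => exists2 c, c != 0 & qshear S (U a 0) = sc c * U a (S *m a))).
- by exists 1; rewrite ?oner_neq0 // mulmx0 qmon00 !rmorph1 mul1r.
- move=> u v [c c0 eu] [d d0 ev].
  have <- : U u 0 * U v 0 = U (u + v) 0.
    by rewrite qmonM // dotz0l expr0z rmorph1 mul1r addr0.
  rewrite rmorphM eu ev -mulrA scCA qmonM // !mulrA -!rmorphM mulmxDr.
  by exists (c * d * q ^ dotz (S *m u) v); rewrite ?(scn, qn).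
move=> i; split.
  by exists 1; rewrite ?oner_neq0 // qmonx qshearx rmorph1 mul1r.
set e := delta_mx i 0.
exists (q ^ dotz (S *m e) e) => //.
have i1 : U (- e) 0 * U e 0 = 1.
  by rewrite qmonM // dotz0l expr0z rmorph1 mul1r addr0 addNr qmon00.
have i2 : U e (S *m e) * (sc (q ^ dotz (S *m e) e) * U (- e) (S *m - e)) = 1.
  rewrite scCA qmonM // mulmxN !subrr qmon00 mulr1 dotzNr -rmorphM -expfzDr //.
  by rewrite subrr expr0z rmorph1.
by rewrite -[LHS]mulr1 -i2 mulrA -qshearx -qmonx -rmorphM i1 rmorph1 mul1r.
Qed.
End Symmetric.

Lemma qshearNK (S : 'M[int]_r) : S^T = S -> cancel (qshear (- S)) (qshear S).
Proof.
move=> symS d; have symN : (- S)^T = - S by rewrite linearN /= symS.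
rewrite -[RHS]/(idfun d) -[LHS]/((qshear S \o qshear (- S)) d).
apply: qtorus_rmorph_eq => [c|i|i] /=; rewrite ?qshearc ?qshearT //.
rewrite qshearx //.
have -> : U (delta_mx i 0) (- S *m delta_mx i 0) = U (delta_mx i 0) 0 * U 0 (- S *m delta_mx i 0).
  by rewrite qmonM // dotz0l expr0z rmorph1 mul1r addr0 add0r.
rewrite rmorphM qshear_mon0 // qmonx qshearx // qmonM // dotz0r expr0z rmorph1 mul1r.
by rewrite addr0 mulNmx subrr qmonx.
Qed.

Definition shear n (S : 'M[int]_n) : 'M[int]_(n + n) := block_mx 1%:M 0 S 1%:M.

Lemma shear_symplectic n (S : 'M[int]_n) : S^T = S -> symplectic (shear S).
Proof.
move=> symS; rewrite /symplectic /shear /symplectic_form tr_block_mx !trmx1 trmx0 symS.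
rewrite !mulmx_block !(mulmx1, mul1mx, mulmx0, mul0mx, addr0, add0r, mulmxN, mulNmx).
by rewrite addNr.
Qed.

Lemma qshear_lifts (S : 'M[int]_r) : S^T = S ->
  lifts q (shear S) (qshear S) (qshear (- S)).
Proof.
move=> symS; have symN : (- S)^T = - S by rewrite linearN /= symS.
split; last 2 first.
- by move=> a; rewrite qshearc.
- move=> v; have [c c0 e] := qshear_mon symS (usubmx v) (dsubmx v).
  exists c => //; rewrite -[v]vsubmxK qmono_col e -qmono_col /shear mul_block_col !mul1mx mul0mx addr0.
  by rewrite addrC.
- by have := qshearNK symN; rewrite opprK.
- exact: qshearNK.
Qed.
End Shear.

(** * Finiteness over sheared subalgebras *)

Lemma dotzE n (u v : 'cV[int]_n) : dotz u v = (u^T *m v) 0 0.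
Proof. by rewrite mxE; apply: eq_bigr => i _; rewrite mxE. Qed.

Lemma dotz_mul m n (J : 'M[int]_(m, n)) u v : dotz u (J *m v) = dotz (J^T *m u) v.
Proof. by rewrite !dotzE trmx_mul trmxK mulmxA. Qed.

Section Action.
Variables (r : nat) (k : fieldType) (q : k).
Hypothesis q_neq0 : q != 0.
Local Notation D := (qtorus r q).
Local Notation sc := (qscal r q).
Local Notation U := (@qmon r k q).

Lemma qmon_commute a b a' b' : dotz b a' = dotz b' a -> U a b * U a' b' = U a' b' * U a b.
Proof. by move=> e; rewrite !qmonM // e addrC [b + _]addrC. Qed.

Lemma qmonVl a b : U (- a) (- b) * U a b = sc (q ^ (- dotz b a)).
Proof. by rewrite qmonM // !addNr qmon00 mulr1 dotzNl. Qed.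
Section Act.
Variables (n : nat) (S : 'M[int]_r) (J : 'M[int]_(r, n)).
Hypothesis symS : S^T = S.
Let symN : (- S)^T = - S. Proof. by rewrite linearN /= symS. Qed.

(* It maps x^a to a scalar multiple of the monomial with exponent (J a, - S J a), which is
   the preimage of x^(J a) under the shear by S. *)
Definition act : {rmorphism lring k n -> D} := qshear q_neq0 (- S) \o (actx r q \o lmap k J).

Lemma actc c : act (lcst k n c) = sc c.
Proof. by rewrite /= lmap_cst actxc qshearc. Qed.

Lemma act_mon a : exists2 c, c != 0 & act (lmon k a) = sc c * U (J *m a) (- (S *m (J *m a))).
Proof.
have [c c0 e] := qshear_mon q_neq0 symN (J *m a) 0.
exists c => //=; rewrite lmap_mon.
have -> : actx r q (lmon k (J *m a)) = U (J *m a) 0.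
  by rewrite qmonE lmon0 rmorph1 mulr1.
by rewrite e add0r mulNmx.
Qed.

(** By symmetry of [S] the hypothesis says that (a, b) is symplectically orthogonal to the exponents
    (J u, - S J u) of the monomials in the image of [act]. *)
Lemma act_comm a b l : (forall u, dotz (b + S *m a) (J *m u) = 0) ->
  U a b * act l = act l * U a b.
Proof.
move=> H; have [s ->] := lring_span l.
rewrite /lsum rmorph_sum mulr_sumr mulr_suml; apply: eq_bigr => x _.
rewrite rmorphM actc; have [c c0 ->] := act_mon x.2.
rewrite ![sc _ * (sc _ * _)]mulrA -rmorphM scCA -mulrA; congr (_ * _); apply: qmon_commute.
have := H x.2; rewrite dotzDl => /eqP; rewrite addr_eq0 => /eqP ->.
by rewrite [RHS]dotzNl [in RHS]dotzC [in RHS]dotz_mul symS.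
Qed.

(** The T-part of a sheared monomial commutes with T^c, so conjugation sees only the x-part J a, and
    c . (J a) = (J^T c) . a. *)
Lemma act_shift c l : U 0 c * act l = act (lshift_q q_neq0 (J^T *m c) l) * U 0 c.
Proof.
have [s ->] := lring_span l.
rewrite /lsum !rmorph_sum mulr_sumr mulr_suml; apply: eq_bigr => x _.
rewrite (rmorphM (lshift_q q_neq0 _)) lshift_cst lshift_mon !(rmorphM act) !actc.
have [e e0 ->] := act_mon x.2.
rewrite ![sc _ * (sc _ * _)]mulrA -!rmorphM scCA [sc _ * (sc _ * _)]mulrA -!rmorphM.
rewrite -mulrA !qmonM // dotz0r expr0z rmorph1 mul1r -dotz_mul !mulrA -!rmorphM.
congr (sc _ * U _ _); [ring | by rewrite addrC | by rewrite addrC].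
Qed.
End Act.
End Action.

(* The exponents (a, b) of the monomials x^a T^b that the shear by S carries into
   D_t(k[x_1^±1, ..., x_r^±1]). *)
Definition lat r (S : 'M[int]_r) (t : nat) (a b : 'cV[int]_r) :=
  forall i : 'I_r, (t <= i)%N -> (b + S *m a) i 0 = 0.

Lemma latD r (S : 'M[int]_r) t a b a' b' : lat S t a b -> lat S t a' b' ->
  lat S t (a + a') (b + b').
Proof.
move=> H H' i ti; rewrite mulmxDr addrACA mxE H // H' // addr0 //.
Qed.

Lemma latN r (S : 'M[int]_r) t a b : lat S t a b -> lat S t (- a) (- b).
Proof. by move=> H i ti; rewrite mulmxN -opprD mxE H // oppr0. Qed.

Section Span.
Variables (r : nat) (k : fieldType) (q : k).
Hypothesis q_neq0 : q != 0.
Local Notation D := (qtorus r q).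
Local Notation sc := (qscal r q).
Local Notation U := (@qmon r k q).
Variable M : lmodType D.

(** The subalgebra spanned by the monomials with exponents in [P] is not formed; finiteness over it
    is expressed through this [k]-span of monomial multiples of [G], which allows induction on its
    elements. *)
Inductive spn (P : 'cV[int]_r -> 'cV[int]_r -> Prop) (G : seq M) : M -> Prop :=
| spn0 : spn P G 0
| spnD u v : spn P G u -> spn P G v -> spn P G (u + v)
| spnG c a b g : P a b -> g \in G -> spn P G ((sc c * U a b) *: g).

Lemma spn_sum P G (I : Type) (s : seq I) (F : I -> M) :
  (forall i, spn P G (F i)) -> spn P G (\sum_(i <- s) F i).
Proof. by move=> H; elim/big_ind: _ => //; [exact: spn0 | exact: spnD]. Qed.

Lemma spn_mul (P P' : 'cV[int]_r -> 'cV[int]_r -> Prop) G G' c a b m :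
    (forall a' b', P a' b' -> forall g, g \in G -> forall e, spn P' G' ((sc e * (U a b * U a' b')) *: g)) ->
  spn P G m -> spn P' G' ((sc c * U a b) *: m).
Proof.
move=> H; elim=> [|u v _ IHu _ IHv|e a' b' g Pg gG].
- by rewrite scaler0; apply: spn0.
- by rewrite scalerDr; apply: spnD.
by rewrite scalerA -mulrA scCA mulrA -rmorphM; apply: H.
Qed.

Lemma spn_act S t G c a b m : lat S t a b -> spn (lat S t) G m ->
  spn (lat S t) G ((sc c * U a b) *: m).
Proof.
move=> Pab; apply: spn_mul => a' b' P' g gG e; rewrite qmonM // mulrA -rmorphM.
by apply: spnG => //; apply: latD.
Qed.

Lemma spn_mem S t G g : g \in G -> spn (lat S t) G g.
Proof.
move=> gG; rewrite -[g]scale1r -(qmon00 r q) -[U 0 0]mul1r -(rmorph1 sc).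
by apply: spnG => // i _; rewrite mulmx0 addr0 mxE.
Qed.

Lemma spn_actl n S S0 t (J : 'M[int]_(r, n)) G l m : S^T = S ->
    (forall a, lat S0 t (J *m a) (- (S *m (J *m a)))) ->
  spn (lat S0 t) G m -> spn (lat S0 t) G (act q_neq0 S J l *: m).
Proof.
move=> symS PJ Gm; have [s ->] := lring_span l.
rewrite /lsum rmorph_sum scaler_suml; apply: spn_sum => x.
rewrite rmorphM actc //; have [c c0 ->] := act_mon q_neq0 J symS x.2.
by rewrite mulrA -rmorphM; apply: spn_act.
Qed.

(* [M] is finite over the subalgebra spanned by the monomials with exponent in [lat S t]. *)
Definition fin S t := exists G, forall m, spn (lat S t) G m.
End Span.

(** The radical of an ideal is an ideal. In [spn_translates] each shift of F comes with its own
    exponent, and this merges them. *)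
Lemma ideal_radical (R : comPzRingType) (I : R -> Prop) (T : eqType) (s : seq T) (b a : T -> R) :
    I 0 -> (forall x y, I x -> I y -> I (x + y)) -> (forall x y, I y -> I (x * y)) ->
    {in s, forall x, exists n, I (a x ^+ n)} ->
  exists n, I ((\sum_(x <- s) b x * a x) ^+ n).
Proof.
move=> I0 ID IM Ia; rewrite big_seq.
elim/big_ind: _ => [|u v [n In] [m Im]|x xs].
- by exists 1%N; rewrite expr1.
- exists (n + m)%N; rewrite exprDn; elim/big_ind: _ => // i _.
  rewrite -mulr_natl; apply: (IM).
  have [le|lt] := leqP m i.
    by rewrite -(subnK le) exprD mulrA; apply: (IM).
  rewrite mulrC -[(n + m - i)%N](subnK (_ : n <= _)%N); last by rewrite -addnBA ?leq_addr // ltnW.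
  by rewrite exprD !mulrA; apply: (IM).
- by have [n In] := Ia x xs; exists n; rewrite exprMn; apply: (IM).
Qed.

Section TailMatrix.
Variable r : nat.

(** The inclusion of the last r - t coordinates; its transpose is the projection onto them. *)
Definition tail_mx (t : nat) : 'M[int]_(r, r - t) := \matrix_(i, j) ((i : nat) == (t + j)%N)%:R.

Lemma tail_mxE t (u : 'cV[int]_(r - t)) (i : 'I_r) :
  (tail_mx t *m u) i 0 = if insub (i - t)%N is Some j then (if (t <= i)%N then u j 0 else 0) else 0.
Proof.
rewrite mxE; case: insubP => [j _ je|ni].
  case: leqP => [le|lt]; last first.
    by apply: big1 => h _; rewrite mxE ltn_eqF ?mul0r // (leq_trans lt) ?leq_addr.
  rewrite (bigD1 j) //= mxE je subnKC // eqxx mul1r big1 ?addr0 // => h hj.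
  rewrite mxE (negPf (_ : (i : nat) != (t + h)%N)) ?mul0r //.
  by apply: contra_neq hj => ie; apply: val_inj; rewrite /= je ie addKn.
apply: big1 => h _; rewrite mxE (negPf (_ : (i : nat) != (t + h)%N)) ?mul0r //.
by apply: contraNneq ni => ie; rewrite ie addKn.
Qed.

Lemma tail_mx_lt t (u : 'cV[int]_(r - t)) (i : 'I_r) : (i < t)%N -> (tail_mx t *m u) i 0 = 0.
Proof. by move=> lt; rewrite tail_mxE; case: insubP => // j _ _; rewrite leqNgt lt. Qed.

Lemma tr_tail_mxE t (v : 'cV[int]_r) (j : 'I_(r - t)) (i : 'I_r) : i = (t + j)%N :> nat ->
  ((tail_mx t)^T *m v) j 0 = v i 0.
Proof.
move=> ie; rewrite mxE (bigD1 i) //= !mxE ie eqxx mul1r big1 ?addr0 // => h hi.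
by rewrite !mxE -ie (inj_eq val_inj) (negPf hi) mul0r.
Qed.

Lemma tail_mx_ge t (v : 'cV[int]_r) (i : 'I_r) : (t <= i)%N ->
  (tail_mx t *m ((tail_mx t)^T *m v)) i 0 = v i 0.
Proof.
move=> ti; rewrite tail_mxE ti insubT ?ltn_sub2r ?(leq_ltn_trans ti) // => lt.
by apply: tr_tail_mxE; rewrite /= subnKC.
Qed.

Lemma tail_mxK t : (tail_mx t)^T *m tail_mx t = 1%:M.
Proof.
apply/matrixP => i j; have lt : (t + i < r)%N by have := ltn_ord i; lia.
have := @tr_tail_mxE t (col j (tail_mx t)) i (Ordinal lt) erefl.
rewrite [in X in X = _ -> _]colE mulmxA -colE [X in X = _ -> _]mxE => ->; rewrite !mxE /=.
by rewrite eqn_add2l.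
Qed.
End TailMatrix.

(** * Relations forced by the dimension bound *)

Section Relation.
Variables (r : nat) (k : fieldType) (q : k).
Hypothesis q_neq0 : q != 0.
Hypothesis q_not_root : forall n : nat, (0 < n)%N -> q ^+ n != 1.
Local Notation D := (qtorus r q).
Local Notation sc := (qscal r q).
Local Notation U := (@qmon r k q).
Variable M : lmodType D.
Hypothesis gkM : (gkdim sc M <= (r%:R : Rdefinitions.R)%:E)%E.

Lemma qmon_pow (b : 'cV[int]_r) (m : nat) : U 0 (m%:Z *: b) = U 0 b ^+ m.
Proof.
elim: m => [|m IH]; first by rewrite scale0r qmon00.
by rewrite exprS -IH qmonM // dotz0r expr0z rmorph1 mul1r addr0 -{2}[b]scale1r -scalerDl.
Qed.

Variable S : 'M[int]_r.
Hypothesis symS : S^T = S.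
Local Notation act1 := (act q_neq0 S 1%:M).

Definition fvec (K : nat) (f : {ffun 'I_r -> 'I_K}) : 'cV[int]_r := \col_i (f i)%:Z.

Lemma act_lmon_tail n (J : 'M[int]_(r, n)) u : act q_neq0 S J (lmon k u) = act1 (lmon k (J *m u)).
Proof. by rewrite /= !lmap_mon mul1mx. Qed.

(** The sheared x_1, ..., x_r and T_tau are r + 1 elements, one more than the dimension. Exponents
    below K give K^(r+1) products, each a word of length at most (r + 1) K. *)
Lemma gk_relation0 (tau : 'I_r) (g : M) : exists K0, forall K, (K0 <= K)%N ->
  exists c : {ffun 'I_r -> 'I_K} * 'I_K -> k, (exists i, c i != 0) /\
    \sum_i sc (c i) *: ((act1 (lmon k (fvec i.1)) * U 0 ((i.2 : nat)%:Z *: delta_mx tau 0)) *: g) = 0.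
Proof.
pose v (i : 'I_r) := act1 (lvar k r i).
pose V := U 0 (delta_mx tau 0) :: codom v.
apply: (@gk_dependent k D sc M r r.+1 V g (fun K => ({ffun 'I_r -> 'I_K} * 'I_K)%type)) => //.
  by move=> K; rewrite card_prod card_ffun !card_ord expnSr.
move=> K [f b]; set L := (_ * _)%N.
pose s := flatten [seq nseq (f i) (v i) | i <- index_enum 'I_r] ++ nseq b (U 0 (delta_mx tau 0)).
have -> : act1 (lmon k (fvec f)) * U 0 ((b : nat)%:Z *: delta_mx tau 0) = \prod_(d <- s) d.
  rewrite big_cat; congr (_ * _); last by rewrite qmon_pow big_nseq iter_mulr_1.
  rewrite big_flatten big_map /lmon rmorph_prod; apply: eq_bigr => i _.
  by rewrite mxE -exprnP rmorphXn big_nseq iter_mulr_1.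
apply: (@gk_words_le _ _ _ _ (size s)); last first.
  apply: gk_words_prod => d; rewrite mem_cat => /orP[/flatten_mapP[i _]|]; rewrite mem_nseq => /andP[_ /eqP->].
    by rewrite inE codom_f orbT.
  by rewrite inE eqxx.
rewrite size_cat size_nseq size_flatten /shape -map_comp sumnE big_map /=.
rewrite /L mulSn addnC leq_add //; first exact: ltnW.
rewrite -[X in (_ <= X * _)%N]card_ord -sum_nat_const leq_sum // => i _.
by rewrite size_nseq ltnW.
Qed.

Definition masked (tau : 'I_r) K (f : {ffun 'I_r -> 'I_K}) := forall i : 'I_r, (tau < i)%N -> f i = 0%N :> nat.

(** In the relation of [gk_relation0], the x_j with j > tau are gathered into the coefficients. A
    coefficient containing a nonzero term stays nonzero, since distinct monomials are independent by
    [lmon_free]. *)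
Lemma gk_relation (tau : 'I_r) (g : M) : exists K0, forall K, (K0 <= K)%N -> (0 < K)%N ->
  exists l : {ffun 'I_r -> 'I_K} * 'I_K -> lring k (r - tau.+1),
    [/\ exists i, l i != 0, forall i, l i != 0 -> masked tau i.1 &
    \sum_i (act q_neq0 S (tail_mx r tau.+1) (l i) *
      (act1 (lmon k (fvec i.1)) * U 0 ((i.2 : nat)%:Z *: delta_mx tau 0))) *: g = 0].
Proof.
have [K0 HK] := gk_relation0 tau g; exists K0 => -[//|K] leK _.
have [c [[i0 ci0] c0]] := HK _ leK.
pose J := tail_mx r tau.+1.
pose mask (f : {ffun 'I_r -> 'I_K.+1}) : {ffun 'I_r -> 'I_K.+1} :=
  [ffun i : 'I_r => if (tau < i)%N then ord0 else f i].
pose p (i : {ffun 'I_r -> 'I_K.+1} * 'I_K.+1) := (mask i.1, i.2).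
have fvE f : fvec f = J *m (J^T *m fvec f) + fvec (mask f).
  apply/colP => i; rewrite [RHS]mxE [(fvec (mask f)) i 0]mxE ffunE [LHS]mxE.
  case: ltnP => lt; first by rewrite tail_mx_ge // mxE addr0.
  by rewrite tail_mx_lt // add0r.
pose l j := \sum_(i | p i == j) lcst k _ (c i) * lmon k (J^T *m fvec i.1).
exists l; split.
- exists (p i0); apply: contra_neq ci0 => l0.
  have := @lmon_free k q q_neq0 q_not_root _ _ [seq i <- index_enum _ | p i == p i0] (fun i => J^T *m fvec i.1) c.
  apply; [by rewrite filter_uniq ?index_enum_uniq | | by rewrite big_filter | by rewrite mem_filter eqxx mem_index_enum].
  move=> i j; rewrite !mem_filter => /andP[/eqP pi _] /andP[/eqP pj _] e.
  have [em e2] : mask i.1 = mask j.1 /\ i.2 = j.2.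
    by move: pi; rewrite -pj => -[].
  have ev : fvec i.1 = fvec j.1 by rewrite fvE e em -fvE.
  rewrite (surjective_pairing i) (surjective_pairing j) e2; congr (_, _).
  by apply/ffunP => h; have /colP/(_ h) := ev; rewrite !mxE => -[]; apply: val_inj.
- move=> j lj i lti; have [i1 /eqP pj _] : exists2 i1, p i1 == j & True.
    apply: contrapT => /forall2NP H; case/eqP: lj; apply: big1 => i1 pi1.
    by case: (H i1).
  by rewrite -pj /p /= ffunE lti.
- rewrite -[RHS]c0 [RHS](partition_big p xpredT) //; apply: eq_bigr => j _.
  rewrite /l (rmorph_sum (act q_neq0 S _)) mulr_suml scaler_suml; apply: eq_bigr => i /eqP <-.
  rewrite rmorphM actc // act_lmon_tail scalerA -!mulrA; congr ((_ * _) *: _).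
  by rewrite [in RHS](fvE i.1) lmonD rmorphM -mulrA.
Qed.
End Relation.

Section DigitShear.
Variables (r : nat) (tau : 'I_r) (K : nat).

(* Its row tau reads off the base-K number with digits a_0, ..., a_tau (shifted by one). *)
Definition digit_mx : 'M[int]_r := \matrix_(i, j)
  (if i == tau then (if (j <= tau)%N then K%:Z ^+ j.+1 else 0)
   else if j == tau then (if (i <= tau)%N then K%:Z ^+ i.+1 else 0) else 0).

Lemma digit_mx_sym : digit_mx^T = digit_mx.
Proof.
apply/matrixP => i j; rewrite !mxE.
by case: (eqVneq j tau) => [ej|_]; case: (eqVneq i tau) => [ei|_] //; rewrite ei ej.
Qed.

Lemma digit_mx_supp (i j : 'I_r) : (tau < i)%N || (tau < j)%N -> digit_mx i j = 0.
Proof.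
rewrite mxE; case: eqVneq => [->|_]; first by rewrite ltnn => /= lt; rewrite [(j <= _)%N]leqNgt lt.
by case: eqVneq => [->|_] //; rewrite ltnn orbF => lt; rewrite [(i <= _)%N]leqNgt lt.
Qed.

Lemma digit_mx_row (a : 'cV[int]_r) : (digit_mx *m a) tau 0 =
  \sum_(i < tau.+1) a (widen_ord (ltn_ord tau) i) 0 * K%:Z ^+ i.+1.
Proof.
pose E (n : nat) := (if insub n is Some j then a (j : 'I_r) 0 else 0) * K%:Z ^+ n.+1.
transitivity (\sum_(i < tau.+1) E i); last first.
  apply: eq_bigr => i _; rewrite /E insubT ?(leq_trans (ltn_ord i)) // => lt.
  by congr (a _ _ * _); apply: val_inj.
rewrite (big_ord_widen r E) // mxE [RHS]big_mkcond; apply: eq_bigr => i _.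
by rewrite mxE eqxx ltnS /E valK; case: ifP => _; rewrite ?mul0r // mulrC.
Qed.
End DigitShear.

(** * Reducing the powers of T_tau by a relation *)

Section Climb.
Variables (r : nat) (k : fieldType) (q : k).
Hypothesis q_neq0 : q != 0.
Local Notation D := (qtorus r q).
Local Notation sc := (qscal r q).
Local Notation U := (@qmon r k q).
Variable M : lmodType D.

Variables (tau : 'I_r) (S S' : 'M[int]_r).
Hypotheses (symS : S^T = S).
Local Notation J := (tail_mx r tau.+1).
Local Notation A := (act q_neq0 S J).
Local Notation del := (delta_mx tau 0).
Hypothesis SS' : forall i j : 'I_r, (tau < i)%N || (tau < j)%N -> S' i j = S i j.

Lemma tail_row (i : 'I_r) (a : 'cV[int]_r) : (tau < i)%N -> (S' *m a) i 0 = (S *m a) i 0.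
Proof. by move=> lt; rewrite !mxE; apply: eq_bigr => j _; rewrite SS' ?lt. Qed.

Lemma tail_col (u : 'cV[int]_(r - tau.+1)) : S' *m (J *m u) = S *m (J *m u).
Proof.
apply/colP => i; rewrite mxE [RHS]mxE; apply: eq_bigr => j _.
have [le|lt] := leqP j tau; first by rewrite tail_mx_lt // !mulr0.
by rewrite SS' ?lt ?orbT.
Qed.

(* The obstruction to a monomial of [lat S tau.+1] lying in [lat S' tau]. *)
Definition height (a b : 'cV[int]_r) : int := (b + S' *m a) tau 0.

Lemma lat_height a b : lat S tau.+1 a b -> lat S' tau a (b - height a b *: del).
Proof.
move=> H i ti.
have -> : (b - height a b *: del + S' *m a) i 0 = (b + S' *m a) i 0 - height a b * (i == tau)%:R.
  by rewrite !mxE eqxx andbT addrAC.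
move: ti; rewrite leq_eqVlt => /predU1P[e|lt].
  by rewrite (_ : i = tau) ?eqxx ?mulr1 ?subrr //; apply: val_inj.
rewrite -val_eqE /= gtn_eqF // mulr0 subr0 mxE tail_row //.
by have := H i lt; rewrite mxE.
Qed.

Lemma lat_tail u : lat S' tau (J *m u) (- (S *m (J *m u))).
Proof. by move=> i _; rewrite tail_col addNr mxE. Qed.

Lemma lat_tail_orth a b u : lat S tau.+1 a b -> dotz (b + S *m a) (J *m u) = 0.
Proof.
move=> H; apply: big1 => i _; have [lt|le] := leqP tau.+1 i; first by rewrite H // mul0r.
by rewrite tail_mx_lt // mulr0.
Qed.

Lemma lat_sub a b : lat S' tau a b -> lat S tau.+1 a b.
Proof.
move=> H i lt; have := H i (ltnW lt).
by rewrite mxE tail_row // [RHS in _ -> RHS = _]mxE.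
Qed.

Lemma qmon_split a b z : U a b = U a (b - z *: del) * U 0 (z *: del).
Proof. by rewrite qmonM // dotz0r expr0z rmorph1 mul1r addr0 subrK. Qed.

Lemma qmon_delD z z' : U 0 (z *: del) * U 0 (z' *: del) = U 0 ((z + z') *: del).
Proof. by rewrite qmonM // dotz0r expr0z rmorph1 mul1r addr0 scalerDl. Qed.

Lemma del_act z l : U 0 (z *: del) * A l = A l * U 0 (z *: del).
Proof.
apply: act_comm => // u; rewrite mulmx0 addr0 /dotz (bigD1 tau) //= tail_mx_lt // mulr0 add0r.
by apply: big1 => i /negPf ne; rewrite !mxE ne mulr0 mul0r.
Qed.

Lemma lat_act a b l : lat S tau.+1 a b -> U a b * A l = A l * U a b.
Proof. by move=> H; apply: act_comm => // u; apply: lat_tail_orth. Qed.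

Variables (I : finType) (l : I -> lring k (r - tau.+1)) (a b : I -> 'cV[int]_r) (g : M).
Hypothesis lab : forall i, lat S tau.+1 (a i) (b i).
Hypothesis rel0 : \sum_i (A (l i) * U (a i) (b i)) *: g = 0.
Local Notation w i := (height (a i) (b i)).
Hypothesis w_inj : forall i j, l i != 0 -> l j != 0 -> w i = w j -> i = j.
Hypothesis l_neq0 : exists i, l i != 0.
Variables (F : lring k (r - tau.+1)).
Hypothesis dvF : forall i, l i != 0 -> exists l', F = l' * l i.
Variables (W : nat) (G : seq M).
Hypothesis wW : forall i, 0 <= w i < W%:Z.
Hypothesis gW : forall i, (i < W)%N -> U 0 (i%:Z *: del) *: g \in G.

Definition eventually_in z := exists n, spn (lat S' tau) G (A (F ^+ n) *: (U 0 (z *: del) *: g)).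

(* Multiplying the relation by a power of T_tau expresses its term of index i, hence
   F T_tau^z g, through the others. *)
Lemma climb_pivot i z : l i != 0 ->
  (forall j, l j != 0 -> j != i -> eventually_in (z + w j - w i)) -> eventually_in z.
Proof.
move=> li H.
have /choice[n nP] j : exists n, l j != 0 -> j != i ->
    spn (lat S' tau) G (A (F ^+ n) *: (U 0 ((z + w j - w i) *: del) *: g)).
  have [lj|] := boolP (l j != 0); last by move=> _; exists 0%N.
  have [_|ji] := eqVneq j i; first by exists 0%N.
  by have [n Hn] := H j lj ji; exists n.
pose m := (\max_j n j)%N.
pose v' j := b j - w j *: del.
pose c j := q ^ dotz ((z - w i) *: del) (a j).
(* After translation by T_tau^(z - w i), the j-th term becomes its coefficient times a monomial of
   [lat S' tau], applied to T_tau^(z + w j - w i) g. *)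
have termE j : U 0 ((z - w i) *: del) *: ((A (l j) * U (a j) (b j)) *: g) =
    A (l j) *: ((sc (c j) * U (a j) (v' j)) *: (U 0 ((z + w j - w i) *: del) *: g)).
  rewrite !scalerA; congr (_ *: _); rewrite [LHS]mulrA del_act -!mulrA; congr (_ * _).
  rewrite (qmon_split (a j) (b j) (w j)) mulrA qmonM // add0r -mulrA; congr (_ * _).
  rewrite [z + w j - _]addrAC -qmon_delD mulrA; congr (_ * _).
  by rewrite [RHS]qmonM // dotz0r expr0z rmorph1 mul1r addr0; congr (U _ _); apply: addrC.
have lv j : lat S' tau (a j) (v' j) by apply: lat_height.
have dA j y x : A y *: ((sc (c j) * U (a j) (v' j)) *: x) = (sc (c j) * U (a j) (v' j)) *: (A y *: x).
  rewrite !scalerA; congr (_ *: _).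
  by rewrite -[in RHS]mulrA (lat_act _ (lat_sub (lv j))) scCA.
have others j : j != i -> spn (lat S' tau) G
    (A (F ^+ m) *: (U 0 ((z - w i) *: del) *: ((A (l j) * U (a j) (b j)) *: g))).
  move=> ji; have [->|lj] := eqVneq (l j) 0.
    by rewrite rmorph0 mul0r scale0r !scaler0; apply: spn0.
  rewrite termE [A (F ^+ m) *: _]scalerA -rmorphM.
  have -> : F ^+ m * l j = (l j * F ^+ (m - n j)) * F ^+ n j.
    by rewrite -mulrA -exprD subnK ?leq_bigmax // mulrC.
  rewrite rmorphM -scalerA dA; apply: spn_actl => //; first exact: lat_tail.
  by apply: spn_act => //; apply: nP.
have [l' Fl] := dvF li.
have own : spn (lat S' tau) G
    (A (F ^+ m) *: (U 0 ((z - w i) *: del) *: ((A (l i) * U (a i) (b i)) *: g))).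
  have := congr1 (fun x => A (F ^+ m) *: (U 0 ((z - w i) *: del) *: x)) rel0.
  rewrite !scaler0 (bigD1 i) //= !scalerDr => /eqP; rewrite addr_eq0 => /eqP ->.
  rewrite -scaleN1r -(rmorph1 sc) -rmorphN -[sc _]mulr1 -(qmon00 r q).
  apply: spn_act => //; first by move=> h _; rewrite mulmx0 addr0 mxE.
  rewrite !scaler_sumr; elim/big_ind: _ => //; [exact: spn0 | exact: spnD].
exists m.+1.
move: own; rewrite termE [z + w i - w i]addrK [A (F ^+ m) *: _]scalerA -rmorphM dA.
set x := U 0 _ *: g => own.
have := spn_actl q_neq0 l' symS lat_tail (spn_act q_neq0 (c i)^-1 (latN (lv i)) own).
have c0 : c i != 0 by rewrite expfz_neq0.
rewrite [(sc (c i)^-1 * _) *: _]scalerA -mulrA scCA qmonVl // !mulrA -!rmorphM mulVf // mul1r.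
rewrite scalerA -scC -scalerA [A l' *: (A _ *: _)]scalerA -rmorphM.
move/(@spn_act _ _ _ q_neq0 M S' tau G (q ^ dotz (v' i) (a i)) 0 0).
have -> : l' * (F ^+ m * l i) = F ^+ m.+1 by rewrite exprS Fl; ring.
rewrite qmon00 mulr1 scalerA -rmorphM -expfzDr // subrr expr0z rmorph1 scale1r; apply.
by move=> h _; rewrite mulmx0 addr0 mxE.
Qed.

(** For z >= W the pivot is the term of largest height and the exponents decrease; for z < 0 it is
    the term of least height and they increase. Heights lie in [0, W), so a descent from z >= W
    never becomes negative, and an ascent from z < 0 ends among the nonnegative exponents already
    treated. *)
Lemma climb z : eventually_in z.
Proof.
have [i0 li0] := l_neq0.
pose s := [seq i <- enum I | l i != 0].
have s0 : s != [::].
  apply/negP => /eqP e; have : i0 \in s by rewrite mem_filter li0 mem_enum.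
  by rewrite e.
have sP i : (i \in s) = (l i != 0) by rewrite mem_filter mem_enum andbT.
have [i1 li1 min1] := seq_argmin (fun i => w i) s0.
have [i2 li2 max2] := seq_argmin (fun i => - w i) s0.
rewrite sP in li1; rewrite sP in li2.
have up (n : nat) : eventually_in n%:Z.
  elim/ltn_ind: n => n IH.
  have [lt|le] := ltnP n W.
    by exists 0%N; rewrite expr0 rmorph1 scale1r; apply: spn_mem; apply: gW.
  apply: (climb_pivot li2) => j lj ji.
  have wj : w j < w i2.
    rewrite lt_neqAle; apply/andP; split; first by apply: contra_neq ji => /w_inj; apply.
    by have := max2 j; rewrite sP lj lerN2; apply.
  have := wW j; have := wW i2 => W2 Wj.
  pose y : int := n%:Z + w j - w i2; rewrite -[_ - _]/y.
  have -> : y = (absz y)%:Z by rewrite /y; lia.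
  by apply: IH; rewrite /y; lia.
case: z => [n|n]; first exact: up.
rewrite NegzE; elim/ltn_ind: n => n IH.
apply: (climb_pivot li1) => j lj ji.
have wj : w i1 < w j.
  rewrite lt_neqAle; apply/andP; split; first by apply: contra_neq ji => /esym /w_inj; apply.
  by have := min1 j; rewrite sP lj; apply.
have := wW j; have := wW i1 => W1 Wj.
set y := _ - _; have [y0|y0] := leP 0 y.
  by rewrite -[y]gez0_abs //; apply: up.
have -> : y = - (`|y|.-1.+1)%N%:Z by lia.
by apply: IH; rewrite /y; lia.
Qed.
End Climb.

Section Step.
Variables (r : nat) (k : fieldType) (q : k).
Hypothesis q_neq0 : q != 0.
Hypothesis q_not_root : forall n : nat, (0 < n)%N -> q ^+ n != 1.
Local Notation D := (qtorus r q).
Local Notation sc := (qscal r q).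
Local Notation U := (@qmon r k q).
Variable M : lmodType D.
Hypothesis gkM : (gkdim sc M <= (r%:R : Rdefinitions.R)%:E)%E.

(* Conjugation by T-monomials shifts F, and the shifts of F generate the unit ideal: so
   finitely many T-translates of the span of G add up to M. *)
Lemma spn_translates (S S' : 'M[int]_r) (tau : 'I_r) (G : seq M) (F : lring k (r - tau.+1)) :
    S^T = S -> (forall i j : 'I_r, (tau < i)%N || (tau < j)%N -> S' i j = S i j) ->
    F != 0 ->
    (forall m, exists n, spn (lat S' tau) G (act q_neq0 S (tail_mx r tau.+1) (F ^+ n) *: m)) ->
  fin M S' tau.
Proof.
move=> symS SS' F0 HF.
have [ts ts1] := shift_ideal1 q_neq0 q_not_root F0.
pose J := tail_mx r tau.+1.
pose G' := [seq U 0 (J *m x.2) *: h | x <- ts, h <- G].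
exists G' => m.
have tr x y : x \in ts -> spn (lat S' tau) G y -> spn (lat S' tau) G' (U 0 (J *m x.2) *: y).
  move=> xts; rewrite -[U 0 _]mul1r -(rmorph1 sc); apply: spn_mul => a b ab g gG e.
  have -> : U 0 (J *m x.2) * U a b = sc (q ^ dotz (J *m x.2) a) * (U a b * U 0 (J *m x.2)).
    by rewrite !qmonM // dotz0r expr0z rmorph1 mul1r addrC [b + _]addrC.
  rewrite mulrA -rmorphM mulrA -scalerA; apply: spnG => //.
  by apply/allpairsP; exists (x, g).
pose I l := spn (lat S' tau) G' (act q_neq0 S J l *: m).
have [||||n] := @ideal_radical _ I _ ts (fun x => x.1) (fun x => lshift_q q_neq0 x.2 F).
- by rewrite /I rmorph0 scale0r; apply: spn0.
- by move=> x y Ix Iy; rewrite /I rmorphD scalerDl; apply: spnD.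
- move=> x y Iy; rewrite /I rmorphM -scalerA; apply: spn_actl => // a.
  exact: lat_tail SS' a.
(* Write c for [J *m x.2]. Some F^n carries T^(-c) m into the span of [G]; applying T^c moves that
   span to the translates and conjugates F^n into the n-th power of the shift of F. *)
- move=> x xts; have [n Hn] := HF (U 0 (- (J *m x.2)) *: m).
  exists n; have := tr x _ xts Hn.
  rewrite scalerA act_shift // mulmxA tail_mxK mul1mx -scalerA [U 0 _ *: (U 0 _ *: _)]scalerA.
  by rewrite qmonM // dotz0r expr0z rmorph1 mul1r addr0 subrr qmon00 scale1r rmorphXn.
by rewrite ts1 expr1n /I rmorph1 scale1r.
Qed.

Lemma fin_step (S : 'M[int]_r) (tau : 'I_r) : S^T = S -> fin M S tau.+1 ->
  exists S', [/\ S'^T = S', forall i j : 'I_r, (tau < i)%N || (tau < j)%N -> S' i j = S i j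
    & fin M S' tau].
Proof.
move=> symS [G HG].
have /choice[K0 HK0] := gk_relation q_neq0 q_not_root gkM symS tau.
(* One base K must serve all generators, since the new matrix S' depends on K. *)
pose K := (\max_(g <- G) K0 g).+1.
have /choice[l Hl] (g : M) : exists l : {ffun 'I_r -> 'I_K} * 'I_K -> lring k (r - tau.+1), g \in G ->
    [/\ exists i, l i != 0, forall i, l i != 0 -> masked tau i.1 &
    \sum_i (act q_neq0 S (tail_mx r tau.+1) (l i) *
      (act q_neq0 S 1%:M (lmon k (fvec i.1)) * U 0 ((i.2 : nat)%:Z *: delta_mx tau 0))) *: g = 0].
  have [gG|_] := boolP (g \in G); last by exists (fun=> 0).
  by have [|//|l Hl] := HK0 g K _; [rewrite leqW //; exact: (@leq_bigmax_seq _ G xpredT K0 g) | exists l].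
pose S' := S + digit_mx tau K.
have SS' (i j : 'I_r) : (tau < i)%N || (tau < j)%N -> S' i j = S i j.
  by move=> ij; rewrite mxE digit_mx_supp ?addr0.
exists S'; split=> //; first by rewrite linearD /= symS digit_mx_sym.
pose a (i : {ffun 'I_r -> 'I_K} * 'I_K) := fvec i.1.
pose b (i : {ffun 'I_r -> 'I_K} * 'I_K) := - (S *m a i) + (i.2 : nat)%:Z *: delta_mx tau 0.
have /choice[c cP] i : exists c, c != 0 /\
    act q_neq0 S 1%:M (lmon k (a i)) * U 0 ((i.2 : nat)%:Z *: delta_mx tau 0) = sc c * U (a i) (b i).
  have [c c0 ce] := act_mon q_neq0 1%:M symS (a i); exists c; split=> //.
  by rewrite ce mul1mx -mulrA qmonM // dotz0r expr0z rmorph1 mul1r addr0.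
pose l' g i := l g i * lcst k _ (c i).
have l'0 g i : (l' g i != 0) = (l g i != 0).
  by rewrite mulf_eq0 fmorph_eq0 negb_or (cP i).1 andbT.
(* A single denominator, divisible by every nonzero coefficient of the relations of all
   generators. *)
pose F := \prod_(g <- G) \prod_(i | l' g i != 0) l' g i.
have F0 : F != 0.
  by rewrite prodf_seq_neq0; apply/allP => g _ /=; apply/prodf_neq0.
pose w i := height tau S' (a i) (b i).
(* The height has base-K digits [i.2] followed by the entries of [i.1] up to index tau. The entries
   beyond tau are zero by [masked], so the height determines i. *)
have wE i : w i = (i.2 : nat)%:Z + \sum_(j < tau.+1) ((i.1 (widen_ord (ltn_ord tau) j)) : nat)%:Z * K%:Z ^+ j.+1.
  rewrite /w /height /b /S' mulmxDl addrACA addNr add0r mxE digit_mx_row !mxE !eqxx mulr1; congr (_ + _).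
  by apply: eq_bigr => j _; rewrite mxE.
pose W := (\max_i absz (w i)).+1.
have wW i : 0 <= w i < W%:Z.
  have w0 : 0 <= w i.
    by rewrite wE addr_ge0 //; apply: sumr_ge0 => j _; rewrite mulr_ge0 // exprn_ge0.
  rewrite w0 -[w i]gez0_abs //= ltz_nat ltnS; exact: (leq_bigmax (F := fun i => absz (w i))).
have lab i : lat S tau.+1 (a i) (b i).
  move=> h lt; rewrite /b addrAC addNr add0r !mxE -val_eqE /= gtn_eqF // mulr0 //.
(* These are the powers of T_tau in the window [0, W) at which [climb] stops. *)
pose G' := [seq U 0 (i%:Z *: delta_mx tau 0) *: g | g <- G, i <- iota 0 W].
have clim g z : g \in G -> eventually_in q_neq0 (tau := tau) S S' g F G' z.
  move=> gG; have [l0 lm lrel] := Hl g gG.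
  apply: (@climb _ _ _ q_neq0 M tau S S' symS SS' _ (l' g) a b g lab _ _ _ F _ W G' wW).
  - rewrite -[RHS]lrel; apply: eq_bigr => i _; congr (_ *: _).
    by rewrite (cP i).2 rmorphM actc // -mulrA.
  - move=> i j; rewrite !l'0 => /lm mi /lm mj wij.
    pose d n : int := if n is h.+1 then
      (if insub h is Some x then (i.1 (x : 'I_r) : nat)%:Z - (j.1 x : nat)%:Z else 0)
      else (i.2 : nat)%:Z - (j.2 : nat)%:Z.
    have d0 : forall n, (n < tau.+2)%N -> d n = 0.
      apply: (@digits_eq0 K) => [[_|h _]|].
      + by rewrite /d; have := ltn_ord i.2; have := ltn_ord j.2; lia.
      + rewrite /d; case: insub => [x|]; last by rewrite normr0.
        by have := ltn_ord (i.1 x); have := ltn_ord (j.1 x); lia.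
      + transitivity (w i - w j); last by rewrite /w wij subrr.
        rewrite !wE big_ord_recl /= mulr1 opprD addrACA -sumrB; congr (_ + _).
        apply: eq_bigr => h _; rewrite /= insubT ?(leq_trans (ltn_ord h)) // => lt.
        by rewrite -mulrBl; congr ((Posz (i.1 _) - Posz (j.1 _)) * _); apply: val_inj.
    rewrite (surjective_pairing i) (surjective_pairing j); congr (_, _).
      apply/ffunP => x; apply: val_inj; have [lt|le] := ltnP tau x.
        by rewrite /= mi // mj.
      by have := d0 x.+1; rewrite /d valK ltnS => /(_ le) /=; lia.
    by apply: val_inj; have := d0 0%N isT; rewrite /d /=; lia.
  - by have [i li] := l0; exists i; rewrite l'0.
  - move=> i li; rewrite /F (big_rem g) //= (bigD1 i) //=.
    by set X := \prod_(_ <- rem _ _) _; set Y := \prod_(_ | _) _; exists (X * Y); ring.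
  - by move=> i lt; apply/allpairsP; exists (g, i); rewrite mem_iota.
apply: (spn_translates symS SS' F0 (G := G')) => m.
elim: (HG m) => [|u v _ [n nP] _ [h hP]|e a' b' g ab gG].
- by exists 0%N; rewrite scaler0; apply: spn0.
- have up x n1 n2 : (n1 <= n2)%N -> spn (lat S' tau) G' (act q_neq0 S (tail_mx r tau.+1) (F ^+ n1) *: x) ->
      spn (lat S' tau) G' (act q_neq0 S (tail_mx r tau.+1) (F ^+ n2) *: x).
    move=> le H; rewrite -(subnK le) exprD rmorphM -scalerA.
    by apply: spn_actl => //; apply: lat_tail.
  exists (n + h)%N; rewrite scalerDr.
  by apply: spnD; [apply: up nP | apply: up hP]; rewrite ?leq_addr ?leq_addl.
(* Splitting off T_tau to the power of the height leaves a monomial of [lat S' tau], which commutes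
   with F. *)
have [n Hn] := clim g (height tau S' a' b') gG; exists n.
rewrite (qmon_split q_neq0 tau a' b' (height tau S' a' b')) !scalerA.
have lv := lat_height SS' ab.
rewrite scCA [A in sc _ * A]mulrA -(lat_act q_neq0 symS _ (lat_sub SS' lv)).
rewrite -[U a' _ * _ * _]mulrA mulrA -!scalerA.
by rewrite scalerA; apply: spn_act.
Qed.
End Step.

(** * Freeness *)

Definition free_family (R : pzRingType) (N : lmodType R) (n : nat) (e : 'I_n -> N) :=
  (forall m, exists l : 'I_n -> R, m = \sum_i l i *: e i) /\
  (forall l : 'I_n -> R, \sum_i l i *: e i = 0 -> forall i, l i = 0).

(** The dual basis lemma: [Psi] identifies N with the image of the idempotent [E], and a splitting
    of [E] yields a basis. *)
Lemma dual_basis_free (R : comPzRingType) (N : lmodType R) (J : finType) (f : J -> N)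
    (psi : J -> N -> R) :
    (forall p (E : 'M[R]_p), E *m E = E -> splits E) ->
    (forall j u v, psi j (u + v) = psi j u + psi j v) ->
    (forall j a u, psi j (a *: u) = a * psi j u) ->
    (forall m, m = \sum_j psi j m *: f j) ->
  exists n (e : 'I_n -> N), free_family e.
Proof.
move=> splitR psiD psiZ psiE.
have psi0 j : psi j 0 = 0 by rewrite -(scale0r (0 : N)) psiZ mul0r.
have psiS j (I : finType) (F : I -> N) : psi j (\sum_i F i) = \sum_i psi j (F i).
  exact: (big_morph (psi j) (psiD j) (psi0 j)).
pose g (a : 'I_#|J|) := f (enum_val a).
have gE m : m = \sum_a psi (enum_val a) m *: g a.
  rewrite {1}[m]psiE (reindex (@enum_val J predT)) //.
  exact/onW_bij/enum_val_bij.
pose Psi m : 'cV[R]_#|J| := \col_a psi (enum_val a) m.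
pose E : 'M[R]_#|J| := \matrix_(a, b) psi (enum_val a) (g b).
have EPsi m : E *m Psi m = Psi m.
  apply/colP => a; rewrite !mxE [in RHS](gE m) psiS; apply: eq_bigr => b _.
  by rewrite !mxE psiZ mulrC.
have EE : E *m E = E.
  apply/matrixP => a b; have /colP/(_ a) := EPsi (g b); rewrite !mxE => <-.
  by apply: eq_bigr => c _; rewrite !mxE.
have [n [B [C [CB BC]]]] := splitR _ E EE.
exists n, (fun i => \sum_a C a i *: g a).
have comb (l : 'cV[R]_n) : \sum_i l i 0 *: \sum_a C a i *: g a = \sum_a (C *m l) a 0 *: g a.
  under eq_bigr => i _ do rewrite scaler_sumr.
  rewrite exchange_big; apply: eq_bigr => a _; rewrite mxE scaler_suml.
  by apply: eq_bigr => i _; rewrite scalerA mulrC.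
split=> [m|l l0 i].
  exists (fun i => (B *m Psi m) i 0); rewrite comb mulmxA CB EPsi {1}[m]gE.
  by apply: eq_bigr => a _; rewrite mxE.
pose v : 'cV[R]_n := \col_i l i.
have Cv : E *m (C *m v) = 0.
  apply/colP => b; rewrite [RHS]mxE -[RHS](psi0 (enum_val b)) -[in RHS]l0.
  transitivity (psi (enum_val b) (\sum_a (C *m v) a 0 *: g a)).
    by rewrite psiS mxE; apply: eq_bigr => a _; rewrite psiZ mxE mulrC.
  by rewrite -comb; congr (psi _ _); apply: eq_bigr => h _; rewrite mxE.
have v0 : v = 0.
  by rewrite -[v]mul1mx -BC -[B]mul1mx -BC -!mulmxA (mulmxA C B) CB Cv !mulmx0.
by have /colP/(_ i) := v0; rewrite !mxE.
Qed.

(** Independent generators are kept greedily; the denominator of each dependent one is multiplied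
    into g. *)
Lemma generic_basis (R : idomainType) (N : lmodType R) (G : seq N) :
  exists (e : seq N) (g : R), [/\ lin_independent e, g != 0 &
    forall m, lspan G m -> lspan e (g *: m)].
Proof.
elim: G => [|x G [e [g [ie g0 eG]]]].
  exists [::], 1; split; [by [] | exact: oner_neq0 | ].
  by move=> m [c ->]; exists (fun=> 0); rewrite !big_ord0 scaler0.
have [[h [h0 hx]]|nx] := pselect (exists h, h != 0 /\ lspan e (h *: x)).
  exists e, (g * h); split; rewrite ?mulf_neq0 //.
  move=> m [c ->]; rewrite big_ord_recl scalerDr; apply: lspanD.
    have -> : g * h *: (c 0%N *: x) = (g * c 0%N) *: (h *: x) by rewrite !scalerA; congr (_ *: _); rewrite mulrAC.
    exact: lspanZ.
  rewrite mulrC -scalerA; apply: lspanZ; apply: eG.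
  by exists (fun i => c i.+1); apply: eq_bigr.
exists (rcons e x), g; split => //.
  move=> c; rewrite size_rcons big_ord_recr /= nth_rcons ltnn eqxx.
  under eq_bigr => i _ do rewrite nth_rcons ltn_ord.
  move=> c0; have cx : c (size e) = 0.
    apply/eqP/negP => /negP cx; apply: nx; exists (c (size e)); split=> //.
    exists (fun i => - c i); under eq_bigr => i _ do rewrite scaleNr.
    by rewrite sumrN; apply/eqP; rewrite -addr_eq0 addrC c0.
  move: c0; rewrite cx scale0r addr0 => /ie c0 i.
  by rewrite ltnS leq_eqVlt => /predU1P[->//|]; apply: c0.
move=> m [c ->]; rewrite big_ord_recl scalerDr; apply: lspanD.
  by apply/lspanZ/lspanZ/mem_lspan; rewrite mem_rcons mem_head.
apply: (@lspan_sub _ _ e) => [z ze|]; first by rewrite mem_rcons inE ze orbT.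
by apply: eG; exists (fun i => c i.+1); apply: eq_bigr.
Qed.

Section Free.
Variables (r : nat) (k : fieldType) (q : k).
Hypothesis q_neq0 : q != 0.
Hypothesis q_not_root : forall n : nat, (0 < n)%N -> q ^+ n != 1.
Local Notation D := (qtorus r q).
Local Notation sc := (qscal r q).
Local Notation U := (@qmon r k q).
Variable M : lmodType D.

(** Here t counts the steps already made. A step at tau < s alters only entries with both indices at
    most tau, so S remains supported on the first s indices, which places the shear in Sp(2s, Z). *)
Lemma fin_shear s : (gkdim sc M <= (r%:R : Rdefinitions.R)%:E)%E -> (s <= r)%N -> fin M 0 s ->
  exists S : 'M[int]_r, [/\ S^T = S, forall i j : 'I_r, (s <= i)%N || (s <= j)%N -> S i j = 0
    & fin M S 0].
Proof.
move=> gkM le_sr fin0.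
suff H t : (t <= s)%N -> exists S : 'M[int]_r, [/\ S^T = S,
    forall i j : 'I_r, (s <= i)%N || (s <= j)%N -> S i j = 0 & fin M S (s - t)].
  by have [S] := H s (leqnn s); rewrite subnn; exists S.
elim: t => [_|t IH lt].
  by exists 0; rewrite subn0; split=> // [|i j _]; rewrite ?trmx0 ?mxE.
have [S [symS S0]] := IH (ltnW lt).
have ltr : (s - t.+1 < r)%N by lia.
rewrite (_ : (s - t)%N = (Ordinal ltr).+1); last by rewrite /=; lia.
move=> /(fin_step q_neq0 q_not_root gkM symS)[S' [symS' SS' finS']].
exists S'; split=> // i j ij; rewrite SS' ?S0 //=.
by case/orP: ij => le; apply/orP; [left|right]; apply: leq_trans le; lia.
Qed.

Variable S : 'M[int]_r.
Hypothesis symS : S^T = S.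
Local Notation L := (lring k r).
Local Notation A := (act q_neq0 S (1%:M : 'M[int]_r)).
Local Notation N := (pullback A M).

(** At level 0 the exponents are the pairs (a, - S a), whose monomials are, up to scalars, the
    images of Laurent monomials under [act]. *)
Lemma spn_lspan (G : seq M) m : spn (lat S 0) G m -> lspan (G : seq N) m.
Proof.
elim=> [|u v _ Hu _ Hv|c a b g ab gG]; [exact: lspan0 | exact: lspanD |].
have -> : b = - (S *m a).
  by apply/colP => i; apply/eqP; rewrite mxE -addr_eq0; have := ab i isT; rewrite mxE => ->.
have [e e0 eA] := act_mon q_neq0 1%:M symS a; rewrite mul1mx in eA.
have <- : A (lcst k r (c * e^-1) * lmon k a) = sc c * U a (- (S *m a)).
  by rewrite rmorphM actc // eA mulrA -rmorphM mulrVK // unitfE.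
exact: (@lspanZ _ N _ (lcst k r (c * e^-1) * lmon k a) g (@mem_lspan _ N G g gG)).
Qed.

(* Coordinates with respect to a generic basis e, conjugated by T-translations, form with
   the translates of e a dual basis, since the shifts of the denominator g generate the
   unit ideal. *)
Theorem fin_free : fin M S 0 -> exists n (e : 'I_n -> N), free_family e.
Proof.
move=> [G HG]; have HN (m : N) : lspan (G : seq N) m by apply: spn_lspan.
have [e [g [ie g0 eG]]] := generic_basis (G : seq N).
have /choice[phi phiE] (m : N) : exists c : 'I_(size e) -> L, g *: m = \sum_i c i *: e`_i.
  by have [c ->] := eG m (HN m); exists (fun i => c i).
have phiU (m : N) (c : 'I_(size e) -> L) : g *: m = \sum_i c i *: e`_i -> phi m = c.
  move=> mc; apply/funext => i; apply: subr0_eq.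
  pose d (j : nat) : L := if insub j is Some h then phi m h - c h else 0.
  have dE (j : 'I_(size e)) : d j = phi m j - c j by rewrite /d valK.
  rewrite -dE; apply: ie => //.
  under eq_bigr => j _ do rewrite dE scalerBl.
  by rewrite sumrB -phiE -mc subrr.
have phiD u v i : phi (u + v) i = phi u i + phi v i.
  rewrite (phiU (u + v) (fun i => phi u i + phi v i)) // scalerDr !phiE -big_split.
  by apply: eq_bigr => j _; rewrite scalerDl.
have phiZ a u i : phi (a *: u) i = a * phi u i.
  rewrite (phiU (a *: u) (fun i => a * phi u i)) // scalerA mulrC -scalerA phiE scaler_sumr.
  by apply: eq_bigr => j _; rewrite scalerA.
have [ts ts1] := shift_ideal1 q_neq0 q_not_root g0.
pose T (c : 'cV[int]_r) (m : N) : N := (U 0 c *: (m : M)).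
have TA c l (m : N) : T c (l *: m) = lshift_q q_neq0 c l *: T c m.
  rewrite -[l *: m]/(A l *: (m : M)) -[RHS]/(A _ *: (U 0 c *: (m : M))).
  by rewrite /T !scalerA act_shift // trmx1 mul1mx.
have TD c u v : T c (u + v) = T c u + T c v by exact: (@scalerDr _ M).
have T0 c : T c 0 = 0 by exact: (@scaler0 _ M).
have TK c m : T c (T (- c) m) = m.
  rewrite /T scalerA qmonM // dotz0r expr0z rmorph1 mul1r addr0 subrr qmon00.
  exact: (@scale1r _ M).
pose x0 : L * 'cV[int]_r := (0, 0).
pose x (i : 'I_(size ts)) := nth x0 ts i.
apply: (@dual_basis_free L N ('I_(size ts) * 'I_(size e))%type
  (fun j => T (x j.1).2 e`_j.2)
  (fun j m => (x j.1).1 * lshift_q q_neq0 (x j.1).2 (phi (T (- (x j.1).2) m) j.2))).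
- by move=> p E; apply: swan.
- by move=> j u v; rewrite TD phiD rmorphD mulrDr.
(* Translation by T^(-c) twists scalars by the shift by -c, which [lshift_q] at c undoes; the
   resulting coordinate is linear. *)
- by move=> j a u; rewrite TA phiZ rmorphM lshiftD addrN lshift0 mulrCA.
move=> m; rewrite -(pair_bigA _ (fun i j => ((x i).1 *
  lshift_q q_neq0 (x i).2 (phi (T (- (x i).2) m) j)) *: T (x i).2 e`_j)) /=.
rewrite -[LHS]scale1r -ts1 (big_nth x0) big_mkord scaler_suml; apply: eq_bigr => i _.
under eq_bigr => j _ do rewrite -scalerA.
rewrite -scaler_sumr -scalerA; congr (_ *: _).
rewrite -[m in LHS](TK (x i).2) -TA phiE.
rewrite (big_morph (T _) (TD _) (T0 _)); apply: eq_bigr => j _.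
by rewrite TA.
Qed.
End Free.

(** * From generated subalgebras to spans of monomials, and the conclusion *)

Lemma gen_subalg_ind (A D : pzRingType) (f : {rmorphism A -> D}) (S : set D) (P : D -> Prop) :
    (forall a, P (f a)) -> (forall u v, P u -> P v -> P (u + v)) ->
    (forall u v, P u -> P v -> P (u * v)) -> (forall d, S d -> P d) ->
  forall d, d \in gen_subalg f S -> P d.
Proof. by move=> Pf PD PM PS d /asboolP; apply; split. Qed.

Lemma mem_gen_subalg (A D : pzRingType) (f : {rmorphism A -> D}) (S : set D) d :
  S d -> d \in gen_subalg f S.
Proof. by move=> Sd; apply/asboolP => P [_]; apply. Qed.

Lemma const_gen_subalg (A D : pzRingType) (f : {rmorphism A -> D}) (S : set D) a :
  f a \in gen_subalg f S.
Proof. by apply/asboolP => P [[Pf _ _] _]. Qed.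

Lemma sp_incl_shear s r (S : 'M[int]_r) (le_sr : (s <= r)%N) :
    (forall i j : 'I_r, (s <= i)%N || (s <= j)%N -> S i j = 0) ->
  sp_incl r (shear (\matrix_(i, j) S (widen_ord le_sr i) (widen_ord le_sr j))) = shear S.
Proof.
move=> S0; apply/matrixP => i j; rewrite mxE /sub_index /shear.
case: (fintype.splitP i) => a ia; case: (fintype.splitP j) => b jb.
- have -> : i = lshift r a by apply: val_inj.
  have -> : j = lshift r b by apply: val_inj.
  rewrite block_mxEul mxE eq_lshift.
  case: insubP => [a' _ ea|_] //=; case: insubP => [b' _ eb|_] //=.
  by rewrite block_mxEul mxE -!val_eqE /= ea eb.
- have -> : i = lshift r a by apply: val_inj.
  have -> : j = rshift r b by apply: val_inj.
  rewrite block_mxEur mxE eq_lrshift.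
  case: insubP => [a' _ ea|_] //=; case: insubP => [b' _ eb|_] //=.
  by rewrite block_mxEur mxE.
- have -> : i = rshift r a by apply: val_inj.
  have -> : j = lshift r b by apply: val_inj.
  rewrite block_mxEdl eq_rlshift.
  case: insubP => [a' _ ea|na] //=; last by rewrite S0 // leqNgt na.
  case: insubP => [b' _ eb|nb] //=; last by rewrite S0 // orbC leqNgt nb.
  by rewrite block_mxEdl mxE; congr (S _ _); apply: val_inj.
- have -> : i = rshift r a by apply: val_inj.
  have -> : j = rshift r b by apply: val_inj.
  rewrite block_mxEdr mxE eq_rshift.
  case: insubP => [a' _ ea|_] //=; case: insubP => [b' _ eb|_] //=.
  by rewrite block_mxEdr mxE -!val_eqE /= ea eb.
Qed.

Section Conclusion.
Variables (r : nat) (k : fieldType) (q : k).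
Hypothesis q_neq0 : q != 0.
Hypothesis q_not_root : forall n : nat, (0 < n)%N -> q ^+ n != 1.
Local Notation D := (qtorus r q).
Local Notation sc := (qscal r q).
Local Notation U := (@qmon r k q).
Variable M : lmodType D.

Lemma finite_over_fin s : finite_over (sub_gens r q s) M -> fin M 0 s.
Proof.
move=> [G GT]; exists (G : seq M).
have Gspn (d : D) : d \in gen_subalg sc (sub_gens r q s) ->
    forall m : M, spn (lat 0 s) (G : seq M) m -> spn (lat 0 s) (G : seq M) (d *: m).
  have mono (a b : 'cV[int]_r) : (forall i : 'I_r, (s <= i)%N -> b i 0 = 0) ->
      forall m : M, spn (lat 0 s) (G : seq M) m -> spn (lat 0 s) (G : seq M) (U a b *: m).
    move=> b0 m Gm; rewrite -[U a b]mul1r -(rmorph1 sc); apply: spn_act => // i si.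
    by rewrite mul0mx addr0 b0.
  move: d; apply: (gen_subalg_ind (P := fun d => forall m : M,
    spn (lat 0 s) (G : seq M) m -> spn (lat 0 s) (G : seq M) (d *: m))).
  - move=> c m Gm; rewrite -[sc c]mulr1 -(qmon00 r q); apply: spn_act => // i _.
    by rewrite mul0mx addr0 mxE.
  - by move=> u v Hu Hv m Gm; rewrite scalerDl; apply: spnD; [apply: Hu | apply: Hv].
  - by move=> u v Hu Hv m Gm; rewrite -scalerA; apply/Hu/Hv.
  move=> d [[i [->|->]]|[i lti [->|->]]].
  - by rewrite -qmonx; apply: mono => j _; rewrite mxE.
  - by rewrite -qmonxV; apply: mono => j _; rewrite mxE.
  - rewrite -qmonT; apply: mono => j lej; rewrite mxE.
    by rewrite (_ : j == i = false) //; apply/eqP => e; move: lej lti; rewrite e; lia.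
  - rewrite -qmonTV; apply: mono => j lej; rewrite !mxE.
    by rewrite (_ : j == i = false) ?oppr0 //; apply/eqP => e; move: lej lti; rewrite e; lia.
move=> m; have : lspan G m by rewrite GT.
move=> [c ->]; apply: spn_sum => i; apply: (Gspn); first exact: valP.
by apply: spn_mem; apply: mem_nth.
Qed.

Lemma sub_gens_full (d : D) : d \in gen_subalg sc (sub_gens r q r).
Proof.
have [t ->] := pclassE d.
elim: t => [c|[i|i|i|i]|s IHs t IHt|s IHs t IHt].
- exact: const_gen_subalg.
- by apply: mem_gen_subalg; left; exists i; left.
- by apply: mem_gen_subalg; left; exists i; right.
- by apply: mem_gen_subalg; right; exists i => //; left.
- by apply: mem_gen_subalg; right; exists i => //; right.
- have -> : pclass (@qrel r k q) (EAdd s t) = (pclass (@qrel r k q) s : D) + pclass (@qrel r k q) t.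
    by rewrite [RHS]paddE.
  exact: rpredD.
- have -> : pclass (@qrel r k q) (EMul s t) = (pclass (@qrel r k q) s : D) * pclass (@qrel r k q) t.
    by rewrite [RHS]pmulE.
  exact: rpredM.
Qed.

Lemma finitely_generated_fin : finitely_generated M -> fin M 0 r.
Proof.
move=> [G GT]; apply: finite_over_fin; exists G; apply/seteqP; split=> // m _.
have : lspan G m by rewrite GT.
by move=> [c ->]; exists (fun i => Subalg (sub_gens_full (c i))).
Qed.

Lemma qmon_laurent s (u : 'cV[int]_r) : (forall i : 'I_r, (i < s)%N -> u i 0 = 0) ->
  U u 0 \in gen_subalg sc (laurent_gens r q s).
Proof.
move=> u0; rewrite -qmono_col; apply: rpredM; apply: rpred_prod => i _; last first.
  by rewrite col_mxEd mxE; exact: rpred1.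
rewrite col_mxEu; have [lti|lei] := ltnP i s; first by rewrite u0 //; exact: rpred1.
by case: (u i 0) => m; apply: rpredX; apply: mem_gen_subalg; exists i => //; [left|right].
Qed.

Variable S : 'M[int]_r.
Hypothesis symS : S^T = S.

(** The shear sends (a, - S a) to (a, 0). So any lift turns the monomials of [lat S 0] into Laurent
    monomials in the x_i, up to nonzero scalars that lie in the subalgebra. *)
Lemma fin_twist phi psi : fin M S 0 -> lifts q (shear S) phi psi ->
  finite_over (laurent_gens r q 0) (pullback psi M).
Proof.
move=> [G GM] [phiK _ phic phiU].
pose N := over_subalg sc (laurent_gens r q 0) (pullback psi M).
exists (G : seq N); apply/seteqP; split=> // m _; have := GM m.
elim=> [|u v _ Hu _ Hv|c a b g ab gG]; [exact: (@lspan0 _ N) | exact: (@lspanD _ N) |].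
have eb : b = - (S *m a).
  by apply/colP => i; apply/eqP; rewrite mxE -addr_eq0; have := ab i isT; rewrite mxE => ->.
have [e e0 eU] := phiU (col_mx a b).
rewrite /shear mul_block_col !mul1mx mul0mx addr0 {2}eb subrr !qmono_col in eU.
have al : sc (c * e) * U a 0 \in gen_subalg sc (laurent_gens r q 0).
  apply: rpredM; first exact: const_gen_subalg.
  exact: qmon_laurent.
have <- : psi (sc (c * e) * U a 0) = sc c * U a b.
  by rewrite -[RHS]phiK (rmorphM phi) phic eU mulrA -rmorphM.
exact: (@lspanZ _ N _ (Subalg al) g (@mem_lspan _ N G g gG)).
Qed.

Variable s : nat.
Hypothesis suppS : forall i j : 'I_r, (s <= i)%N || (s <= j)%N -> S i j = 0.
Local Notation L := (lring k r).
Local Notation A := (act q_neq0 S (1%:M : 'M[int]_r)).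
Local Notation N := (pullback A M).

(** Since [S] vanishes on indices from s on, shearing leaves the variables x_(s+1), ..., x_r
    alone. *)
Lemma act_tail (u : 'cV[int]_r) : (forall i : 'I_r, (i < s)%N -> u i 0 = 0) ->
  exists2 c, c != 0 & A (lmon k u) = sc c * U u 0.
Proof.
move=> u0; have [c c0 e] := act_mon q_neq0 1%:M symS u; exists c => //.
rewrite e mul1mx (_ : S *m u = 0) ?oppr0 //; apply/colP => i; rewrite !mxE big1 // => j _.
by have [ltj|lej] := ltnP j s; [rewrite u0 // mulr0 | rewrite suppS ?lej ?orbT // mul0r].
Qed.

(** Invariance under the shifts of the first s variables records that l involves only the others; in
    [free_tail] it makes l times a monomial an eigenvector of these shifts. *)
Lemma laurent_act d : d \in gen_subalg sc (laurent_gens r q s) ->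
  exists l, d = A l /\ forall i : 'I_r, (i < s)%N -> lshift_q q_neq0 (delta_mx i 0) l = l.
Proof.
have gen (u : 'cV[int]_r) : (forall i : 'I_r, (i < s)%N -> u i 0 = 0) ->
    exists l, U u 0 = A l /\ forall i : 'I_r, (i < s)%N -> lshift_q q_neq0 (delta_mx i 0) l = l.
  move=> u0; have [c c0 e] := act_tail u0.
  exists (lcst k r c^-1 * lmon k u); split.
    by rewrite (rmorphM A) actc // e mulrA -rmorphM mulVf // rmorph1 mul1r.
  move=> i lti; rewrite rmorphM lshift_cst lshift_mon dotz_delta u0 //.
  by rewrite expr0z rmorph1 mul1r.
move: d; apply: gen_subalg_ind.
- by move=> c; exists (lcst k r c); rewrite actc //; split=> // i _; rewrite lshift_cst.
- move=> _ _ [l [-> lS]] [m [-> mS]]; exists (l + m); rewrite (rmorphD A); split=> // i lti.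
  by rewrite rmorphD lS ?mS.
- move=> _ _ [l [-> lS]] [m [-> mS]]; exists (l * m); rewrite (rmorphM A); split=> // i lti.
  by rewrite rmorphM lS ?mS.
have d0 (i j : 'I_r) : (s <= i)%N -> (j < s)%N -> (j == i) = false.
  by move=> lei ltj; apply/eqP => e; move: ltj lei; rewrite e; lia.
move=> d [i lei [->|->]].
  by rewrite -qmonx; apply: gen => j ltj; rewrite mxE d0.
by rewrite -qmonxV; apply: gen => j ltj; rewrite !mxE d0 // oppr0.
Qed.

Lemma free_tail n (e : 'I_n -> N) : free_family e -> free_over (laurent_gens r q s) M.
Proof.
move=> [espan efree]; set K := over_subalg sc (laurent_gens r q s) M.
pose head (u : 'cV[int]_r) := forall i : 'I_r, (s <= i)%N -> u i 0 = 0.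
pose B : set K := fun m => exists u i, head u /\ m = lmon k u *: e i.
exists B; split.
  move=> b ub bB c c0 j0 ltj0.
  have /choice[p pP] (j : 'I_(size b)) : exists p : 'cV[int]_r * 'I_n,
      head p.1 /\ b`_j = lmon k p.1 *: e p.2.
    by have [u [i [hu bj]]] := bB _ (mem_nth 0 (ltn_ord j)); exists (u, i).
  have /choice[l lP] (j : 'I_(size b)) : exists l, val (c j) = A l /\
      forall i : 'I_r, (i < s)%N -> lshift_q q_neq0 (delta_mx i 0) l = l.
    by apply: laurent_act; apply: valP.
  have sum0 : \sum_i (\sum_(j | (p j).2 == i) l j * lmon k (p j).1) *: e i = 0.
    under eq_bigr => i _ do rewrite scaler_suml.
    rewrite (exchange_big_dep predT) //= -[RHS]c0; apply: eq_bigr => j _.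
    rewrite (big_pred1 (p j).2) => [|i]; last by rewrite eq_sym.
    rewrite -scalerA -(pP j).2.
    by rewrite -[LHS]/(A (l j) *: (b`_j : M)) -(lP j).1.
  pose j1 := Ordinal ltj0; have := efree _ sum0 (p j1).2.
  rewrite -big_filter => w0.
  have /eqP : l j1 * lmon k (p j1).1 = 0.
    (* The terms attached to one basis vector have distinct exponents in the first s variables,
       hence distinct eigenvalues under the corresponding shifts, so each term vanishes. *)
    apply: (shift_eigen (q_neq0 := q_neq0) q_not_root (I := fun x => x = 0)
      (s := [seq j <- index_enum 'I_(size b) | (p j).2 == (p j1).2])
      (u := fun j => (p j).1) (w := fun j => l j * lmon k (p j).1)
      (X := fun i : 'I_r => (i < s)%N)) w0 _ _.
    - by move=> x y -> ->; rewrite addr0.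
    - by move=> d x ->; rewrite mulr0.
    - by move=> i x _ ->; rewrite rmorph0.
    - move=> j i lti; rewrite rmorphM (lP j).2 // mulrCA; congr (_ * _).
      by apply: lshift_delta => d; apply: lshift_mon.
    - by rewrite filter_uniq ?index_enum_uniq.
    - move=> j j'; rewrite !mem_filter => /andP[/eqP ej _] /andP[/eqP ej' _] H.
      apply/eqP; rewrite -val_eqE -(nth_uniq 0 (ltn_ord j) (ltn_ord j') ub).
      rewrite (pP j).2 (pP j').2 ej ej'; suff -> : (p j).1 = (p j').1 by [].
      apply/colP => i; have [lti|lei] := ltnP i s; first exact: H.
      by rewrite (pP j).1 // (pP j').1.
    - by rewrite mem_filter eqxx mem_index_enum.
  rewrite mulf_eq0 => /orP[/eqP l0|/eqP m0]; last first.
    by have := lmon_unit k (p j1).1; rewrite m0 unitr0.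
  by apply: val_inj; rewrite -[j0]/(val j1) (lP j1).1 l0 rmorph0.
move=> m; pose Q (m : K) := exists2 b : seq K, (forall x, x \in b -> B x) & lspan b m.
have Q0 : Q 0 by exists [::] => //; apply: lspan0.
have QD x y : Q x -> Q y -> Q (x + y).
  move=> [b bB bx] [b' bB' by_]; exists (b ++ b').
    by move=> z; rewrite mem_cat => /orP[/bB|/bB'].
  apply: lspanD.
    by apply: lspan_sub bx => z zb; rewrite mem_cat zb.
  by apply: lspan_sub by_ => z zb; rewrite mem_cat zb orbT.
suff : Q m by [].
have [l ->] := espan m.
apply: (big_ind Q) => // i _; have [t ->] := lring_span (l i).
rewrite /lsum scaler_suml; apply: (big_ind Q) => // -[c u] _ /=.
(* The head [u1] of the exponent belongs to the basis element, and the tail [u2] to its coefficient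
   in the Laurent subalgebra. *)
pose u1 : 'cV[int]_r := \col_i (if (i < s)%N then u i 0 else 0).
pose u2 : 'cV[int]_r := \col_i (if (i < s)%N then 0 else u i 0).
have uE : u = u2 + u1.
  by apply/colP => j; rewrite !mxE; case: ifP; rewrite ?addr0 ?add0r.
have u20 (j : 'I_r) : (j < s)%N -> u2 j 0 = 0 by rewrite mxE => ->.
have [d d0 du] := act_tail u20.
have al : sc (c * d) * U u2 0 \in gen_subalg sc (laurent_gens r q s).
  apply: rpredM; first exact: const_gen_subalg.
  exact: qmon_laurent.
have Bx : B (lmon k u1 *: e i).
  by exists u1, i; split=> // j lej; rewrite mxE ltnNge lej.
exists [:: (lmon k u1 *: e i : K)].
  by move=> x; rewrite inE => /eqP ->.
rewrite uE lmonD mulrA -scalerA -[X in lspan _ X]/(A (lcst k r c * lmon k u2) *: (lmon k u1 *: e i : M)).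
rewrite (rmorphM A) actc // du mulrA -rmorphM.
exact: (@lspanZ _ K _ (Subalg al) _ (@mem_lspan _ K _ _ (mem_head _ _))).
Qed.
End Conclusion.

Theorem theorem3p3 (k : fieldType) (q : k) (q_neq0 : q != 0)
    (q_not_root : forall n : nat, (0 < n)%N -> q ^+ n != 1)
    (s r : nat) (le_sr : (s <= r)%N) :
  (forall M : lmodType (qtorus r q),
    holonomic M -> finite_over (sub_gens r q s) M ->
    (exists2 h : 'M[int]_(s + s), symplectic h &
       twist_finite_laurent (sp_incl r h) M) /\
    free_over (laurent_gens r q s) M) /\
  (forall M : lmodType (qtorus r q),
    holonomic M ->
    exists2 g : 'M[int]_(r + r), symplectic g & twist_finite_laurent g M).
Proof.
split=> M [fgM gkM].
  move=> /finite_over_fin => /(_ q_neq0)/(fin_shear q_neq0 q_not_root gkM le_sr)[S [symS suppS finS]].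
  split.
    exists (shear (\matrix_(i, j) S (widen_ord le_sr i) (widen_ord le_sr j))).
      apply: shear_symplectic; apply/matrixP => i j; rewrite !mxE.
      by rewrite -[in LHS]symS mxE.
    rewrite sp_incl_shear //; split=> [|phi psi]; last exact: fin_twist.
    by exists (qshear q_neq0 S), (qshear q_neq0 (- S)); apply: qshear_lifts.
  have [n [e /free_tail]] := fin_free q_neq0 q_not_root symS finS.
  exact.
have [S [symS _ finS]] := fin_shear q_neq0 q_not_root gkM (leqnn r) (finitely_generated_fin q_neq0 fgM).
exists (shear S); first exact: shear_symplectic.
split=> [|phi psi]; last exact: fin_twist.
by exists (qshear q_neq0 S), (qshear q_neq0 (- S)); apply: qshear_lifts.
Qed.
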